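(* Let $f=f^+-f^-\in L^\infty(\mathbb{R}^n)$ have compact support $S_f$ and satisfy $\int_{\mathbb{R}^n} f\,dx=0$, and let $\Omega\subset\mathbb{R}^n$ be a convex bounded domain with $\Omega\supset \operatorname{conv} S_f$. Then, for any $c>\min_{\mathcal M_+(\Omega)}\mathcal E$ and any $\mu^0\in\mathscr M_c:=\{\mu\in\mathcal M_+(\Omega):\mathcal E(\mu)\le c\}$, the class of minimizing movements $MM(\mu^0,\mathcal E,d_w)$ is not empty. Its elements are curves of $d_w$-maximal slope for $\mathcal E$ with respect to its strong upper gradient $|\partial\mathcal E|$ and, for any such curve $t\mapsto\mu(t)$, $$\mathcal E(\mu(t))=\mathcal E(\mu^0)-\int_0^t\big[|\partial\mathcal E|(\mu(s))\big]^2ds,\qquad\forall t>0.$$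
   Context: $\mathcal M_+(\Omega)$ is the set of finite non-negative Borel measures on $\Omega$, and $\mathcal E:\mathcal M_+(\Omega)\to[0,+\infty]$ is $$\mathcal E(\mu):=\sup_{u\in C^1(\overline\Omega),\ \int_\Omega u\,dx=0}\left(2\int_\Omega fu\,dx-\int_\Omega|\nabla u|^2\,d\mu\right)+\int_\Omega d\mu .$$ $\mathcal M_+(\Omega)$ is equipped with the metric $$d_w(\mu,\nu):=\Big(\sum_{k=0}^{+\infty}2^{-k}\Big|\int_\Omega\phi_k\,d\mu-\int_\Omega\phi_k\,d\nu\Big|^2\Big)^{1/2},$$ for a given sequence $\{\phi_k\}\subset C^0(\overline\Omega)$ dense in the uniform-norm unit sphere of $C^0(\overline\Omega)$. Let $(\mathscr S,d)$ be a metric space, $\phi:\mathscr S\to(-\infty,+\infty]$, $\mathrm{Dom}(\phi)=\{\phi<+\infty\}$. Minimizing movements: for a sequence of time steps $\boldsymbol\tau=\{\tau_k\}_{k\in\mathbb N}$, $\tau_k>0$, $\sum_k\tau_k=+\infty$, and a starting point $\mu_0\in \mathrm{Dom}(\phi)$, choose recursively $\mu_{k+1}\in\operatorname{argmin}_{\nu\in\mathscr S}\big(\phi(\nu)+\frac{d^2(\mu_k,\nu)}{2\tau_k}\big)$; the associated piecewise constant interpolation in time (with value $\mu_0$ at $t=0$) is a discrete trajectory $\mu_{\boldsymbol\tau}$. $MM(\mu^0,\phi,d)$ is the class of curves $\mu:[0,+\infty)\to\mathscr S$ such that for every sequence of partitions $\boldsymbol\tau^n$ with $\sup_k\tau^n_k\to0$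 there are discrete trajectories $\mu_{\boldsymbol\tau^n}$ with $\phi(\mu_{\boldsymbol\tau^n}(0))\to\phi(\mu^0)$, $\limsup_n d(\mu_{\boldsymbol\tau^n}(0),\mu^0)<+\infty$, and $\mu_{\boldsymbol\tau^n}(t)\to\mu(t)$ for all $t\in[0,+\infty)$ (convergence in $d$). Slope: $|\partial\phi|(\mu):=\limsup_{\nu\to\mu}\frac{(\phi(\mu)-\phi(\nu))^+}{d(\mu,\nu)}$ for $\mu\in \mathrm{Dom}(\phi)$. Metric derivative: $|v'|(t)=\lim_{s\to t}\frac{d(v(s),v(t))}{|s-t|}$. A function $g:\mathscr S\to[0,+\infty]$ is a strong upper gradient for $\phi$ if for every absolutely continuous $v:(a,b)\to\mathscr S$ the function $g\circ v$ is Borel and $|\phi(v(t_0))-\phi(v(t_1))|\le\int_{t_0}^{t_1}g(v(s))|v'|(s)\,ds$ for all $a<t_0\le t_1<b$. A curve $v:(a,b)\to\mathscr S$ is a curve of maximal slope for $\phi$ with respect to the upper gradient $g$ if $\phi\circ v$ coincides a.e. with a non-increasing map $\psi$ with $\psi'(t)\le-\frac12|v'|^2(t)-\frac12g^2(v(t))$ for a.e. $t\in(a,b)$.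
   Formalization: The measures in M_+(Ω) may charge the boundary (they live on the closure of Ω), and curves in MM(μ⁰,E,d_w) are required to start at μ⁰; without these changes, non-emptiness and the energy identity respectively can fail. *)

(* Defs.v *)
From HB Require Import structures.
From mathcomp Require Import all_boot all_order all_algebra.
From mathcomp Require Import all_classical all_reals all_analysis.
From mathcomp Require Import measurable_realfun lra.

Set Implicit Arguments.
Unset Strict Implicit.
Unset Printing Implicit Defensive.

Import Order.TTheory GRing.Theory Num.Theory.
Import numFieldNormedType.Exports.

Local Open Scope classical_set_scope.
Local Open Scope ring_scope.

Definition rV_display : measure_display. Proof. by constructor. Qed.

HB.instance Definition _ (R : realType) (n : nat) :=
  @isMeasurable.Build rV_display 'rV[R]_n <<s @open 'rV[R]_n >>
    (@sigma_algebra0 _ setT _) (@sigma_algebraC _ _)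
    (@sigma_algebra_bigcup _ setT _).

Section sigma_finite_measure_of.
Context d (T : measurableType d) (R : realType) (mu : set T -> \bar R).
Hypotheses (mu0 : mu set0 = 0%E) (mu_ge0 : forall A, (0 <= mu A)%E).
Hypotheses (muU : semi_sigma_additive mu) (muF : sigma_finite setT mu).

#[local] HB.instance Definition _ := isMeasure.Build _ _ _ mu mu0 mu_ge0 muU.
#[local] HB.instance Definition _ := Measure_isSigmaFinite.Build _ _ _ mu muF.

Lemma sigma_finite_measure_of :
  exists m : {sigma_finite_measure set T -> \bar R}, m = mu :> (set T -> \bar R).
Proof. by exists mu. Qed.

End sigma_finite_measure_of.

Section lebesgue_rV.
Context {R : realType}.

Lemma open_measurable_rV n (U : set 'rV[R]_n) : open U -> measurable U.
Proof. exact: sub_sigma_algebra. Qed.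

Lemma measurable_coord_rV n (i : 'I_n) :
  measurable_fun [set: 'rV[R]_n] (fun v => v ord0 i).
Proof.
apply: (measurability _ (measurable_realfun.RGenOpens.measurableE R)) => _ [_ [a [b ->] <-]].
rewrite setTI; apply: open_measurable_rV.
apply: open_comp; last exact: interval_open.
by move=> v _; exact: coord_continuous.
Qed.

Lemma measurable_fun_rVP d (T : measurableType d) n (f : T -> 'rV[R]_n) :
  (forall i, measurable_fun setT (fun t => f t ord0 i)) ->
  measurable_fun setT f.
Proof.
move=> mf; apply: (@measurability _ _ _ _ _ _ (@open 'rV[R]_n)) => //.
move=> _ [U oU <-]; rewrite setTI.
pose c (q : 'rV[rat]_n) : 'rV[R]_n := map_mx ratr q.
pose B (qk : 'rV[rat]_n * nat) := ball (c qk.1) (qk.2.+1%:R^-1 : R).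
pose D := [set qk | B qk `<=` U].
have -> : U = \bigcup_(qk in D) B qk.
  apply/seteqP; split=> [x Ux|x [qk Dqk]]; last exact: Dqk.
  have /nbhs_ballP[e /= e0 eU] : nbhs x U by exact: open_nbhs_nbhs.
  have [k ke] : exists k : nat, k.+1%:R^-1 < e / 2 :> R.
    have e2 : 0 < e / 2 by rewrite divr_gt0.
    have [N _ /(_ N)] := near_infty_natSinv_lt (PosNum e2).
    by rewrite /= leqnn => /(_ isT); exists N.
  have [r rE r0] : exists2 r : R, r = k.+1%:R^-1 & 0 < r.
    by exists k.+1%:R^-1; rewrite // invr_gt0.
  rewrite -rE in ke.
  have qx i : exists q : rat, `|x ord0 i - ratr q| < r.
    have [|q] := @rat_in_itvoo R (x ord0 i - r) (x ord0 i + r); first by lra.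
    rewrite in_itv/= => /andP[q1 q2]; exists q.
    by rewrite ltr_norml; apply/andP; split; lra.
  pose q : 'rV[rat]_n := \row_i projT1 (cid (qx i)).
  have xq : ball (c q) r x.
    split=> // i j; rewrite ord1 /ball /= !mxE distrC.
    by case: cid.
  exists (q, k) => [|/=]; last by rewrite /B/= -rE.
  move=> y; rewrite /B/= -rE => qy; apply: eU.
  have xy := ball_triangle (ball_sym xq) qy.
  by apply: le_ball xy; rewrite /=; lra.
rewrite preimage_bigcup bigcup_mkcond.
apply: countable_bigcupT_measurable; first exact: countableP.
move=> -[q k]; case: ifPn => _; last exact: measurable0.
rewrite /B/=.
have -> : f @^-1` ball (c q) (k.+1%:R^-1 : R) =
    \bigcap_(i in [set: 'I_n]) ((fun t => f t ord0 i) @^-1` ball (c q ord0 i) (k.+1%:R^-1 : R)).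
  apply/seteqP; split=> [t [_ H] i _|t H] /=; first exact: H.
  split; first by rewrite invr_gt0.
  by move=> i j; rewrite ord1; exact: H.
apply: fin_bigcap_measurable => // i _.
rewrite -[X in measurable X]setTI; apply: mf => //.
exact: measurable_ball.
Qed.

Definition consrV n (p : measurableTypeR R * 'rV[R]_n) : 'rV[R]_n.+1 :=
  row_mx (p.1 : R)%:M p.2.

Lemma consrV0 n p : @consrV n p ord0 ord0 = p.1.
Proof.
transitivity (row_mx ((p.1 : R)%:M : 'M[R]_1) p.2 ord0 (lshift n ord0)).
  by rewrite /consrV; congr (fun_of_matrix _ _ _); exact: val_inj.
by rewrite row_mxEl mxE.
Qed.

Lemma consrVS n p j : @consrV n p ord0 (lift ord0 j) = p.2 ord0 j.
Proof.
transitivity (row_mx ((p.1 : R)%:M : 'M[R]_1) p.2 ord0 (rshift 1 j)).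
  by rewrite /consrV; congr (fun_of_matrix _ _ _); exact: val_inj.
by rewrite row_mxEr.
Qed.

Lemma measurable_consrV n : measurable_fun setT (@consrV n).
Proof.
apply: measurable_fun_rVP => i.
case: (unliftP ord0 i) => [j|] ->.
  rewrite (funext ((@consrVS n) ^~ j)).
  apply: (@measurableT_comp _ _ _ _ _ _ (fun v : 'rV[R]_n => v ord0 j)).
    exact: measurable_coord_rV.
  exact: measurable_snd.
rewrite (funext (@consrV0 n)); exact: measurable_fst.
Qed.

Fixpoint lebesgue_rV n : set 'rV[R]_n -> \bar R :=
  match n with
  | 0%N => \d_(0 : 'rV[R]_0)
  | m.+1 => pushforward (lebesgue_measure \x @lebesgue_rV m)%E (@consrV m)
  end.

Lemma lebesgue_rV_sigma_finite_measure n :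
  exists m : {sigma_finite_measure set 'rV[R]_n -> \bar R},
    m = @lebesgue_rV n :> (set _ -> _).
Proof.
elim: n => [|n [m mE]]; first by exists \d_(0 : 'rV[R]_0).
pose pm : {measure set (measurableTypeR R * 'rV[R]_n)%type -> \bar R} :=
  (lebesgue_measure \x m)%E.
pose p := pushforward pm (@consrV n).
pose q := measure_function_pushforward__canonical__measure_function_Measure
  pm (@measurable_consrV n).
have sfp : sigma_finite setT p.
  have [F UF mF] : sigma_finite setT pm.
    have /sigma_finiteP[G [TG ndG Goo]] := sigma_finiteT (@lebesgue_measure R).
    have /sigma_finiteP[H [TH ndH Hoo]] := sigma_finiteT m.
    exists (fun k => G k `*` H k).
      rewrite -setXTT TG TH predeqE => -[x y]; split.
        move=> [/= [i _ Gx] [j _ Hy]]; exists (maxn i j) => //; split.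
        - by move: x Gx; exact/subsetPset/ndG/leq_maxl.
        - by move: y Hy; exact/subsetPset/ndH/leq_maxr.
      by move=> [i _ []/= ? ?]; split; exists i.
    move=> k; have [mG Gk] := Goo k; have [mH Hk] := Hoo k.
    split; first exact: measurableX.
    by rewrite /pm/= product_measure1E// lte_mul_pinfty// ge0_fin_numE.
  pose g (v : 'rV[R]_n.+1) : measurableTypeR R * 'rV[R]_n :=
    (v ord0 ord0, \row_j v ord0 (lift ord0 j)).
  have mg : measurable_fun setT g.
    apply: measurable_fun_pair; first exact: measurable_coord_rV.
    apply: measurable_fun_rVP => i.
    have -> : (fun t : 'rV[R]_n.+1 => (\row_j t ord0 (lift ord0 j)) ord0 i) =
      (fun t : 'rV[R]_n.+1 => t ord0 (lift ord0 i)) by apply/funext=> t; rewrite mxE.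
    exact: measurable_coord_rV.
  have gK : cancel (@consrV n) g.
    move=> [x v]; rewrite /g consrV0; congr pair.
    by apply/rowP=> j; rewrite mxE consrVS.
  exists (fun k => g @^-1` F k) => [|k].
    by rewrite -preimage_bigcup -UF preimage_setT.
  have [mFk Fk] := mF k; split.
    by rewrite -[X in measurable X]setTI; exact: mg.
  rewrite /p /pushforward (_ : _ @^-1` _ = F k)//.
  by apply/seteqP; split=> z /=; rewrite gK.
have [P PE] := sigma_finite_measure_of (measure0 q) (measure_ge0 q)
  (@measure_semi_sigma_additive _ _ _ q) sfp.
by exists P; rewrite PE /= /p /pm mE.
Qed.

Let lebesgue_rV0 n : @lebesgue_rV n set0 = 0%E.
Proof. by have [m <-] := lebesgue_rV_sigma_finite_measure n. Qed.

Let lebesgue_rV_ge0 n A : (0 <= @lebesgue_rV n A)%E.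
Proof. by have [m <-] := lebesgue_rV_sigma_finite_measure n. Qed.

Let lebesgue_rV_sigma_additive n : semi_sigma_additive (@lebesgue_rV n).
Proof.
have [m <-] := lebesgue_rV_sigma_finite_measure n.
exact: measure_semi_sigma_additive.
Qed.

Let lebesgue_rV_sigma_finite n : sigma_finite setT (@lebesgue_rV n).
Proof.
have [m <-] := lebesgue_rV_sigma_finite_measure n; exact: sigma_finiteT.
Qed.

HB.instance Definition _ n := isMeasure.Build _ _ _ (@lebesgue_rV n)
  (lebesgue_rV0 n) (@lebesgue_rV_ge0 n) (@lebesgue_rV_sigma_additive n).

HB.instance Definition _ n := Measure_isSigmaFinite.Build _ _ _
  (@lebesgue_rV n) (lebesgue_rV_sigma_finite n).

End lebesgue_rV.

Section transport_energy.
Context {R : realType} {n : nat}.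
Local Notation leb := (@lebesgue_rV R n).

(* [f] is only relevant up to null sets, hence the essential support. *)
Definition ess_support (f : 'rV[R]_n -> R) : set 'rV[R]_n :=
  ~` \bigcup_(U in [set U | open U /\ {ae leb, forall x, U x -> f x = 0}]) U.

Definition conv_hull (A : set 'rV[R]_n) : set 'rV[R]_n :=
  \bigcap_(C in [set C : set 'rV[R]_n | convex_set C /\ A `<=` C]) C.

(* [u] is in $C^1(\overline\Omega)$ and [Du] is the continuous extension of its
   gradient to $\overline\Omega$, on which it is determined by [u]; the values
   outside $\overline\Omega$ are irrelevant. *)
Definition C1_closure (Omega : set 'rV[R]_n) (u : 'rV[R]_n -> R)
    (Du : 'rV[R]_n -> 'rV[R]_n) : Prop :=
  [/\ {within closure Omega, continuous u},
      {within closure Omega, continuous Du} &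
      forall x, Omega x -> forall i : 'I_n,
        is_derive x (delta_mx 0 i : 'rV[R]_n) u (Du x 0 i)].

(* The norm of ['rV[R]_n] in the library is the sup norm. *)
Definition sqr_euclid (v : 'rV[R]_n) : R := \sum_(i < n) v 0 i ^+ 2.

(* Finite Borel measures, as measures on the whole space. They may charge the
   boundary: this is the positive cone of the dual of $C^0(\overline\Omega)$,
   the space whose weak-* topology is metrized on bounded sets by [d_w] below,
   and in which energy sublevels are compact. *)
Record Mplus (Omega : set 'rV[R]_n) := MkMplus {
  Mplus_measure :> {finite_measure set 'rV[R]_n -> \bar R} ;
  Mplus_closure : Mplus_measure (~` closure Omega) = 0%E }.

Definition transport_energy (f : 'rV[R]_n -> R) (Omega : set 'rV[R]_n)
    (mu : Mplus Omega) : \bar R :=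
  (ereal_sup [set y | exists u Du,
     [/\ C1_closure Omega u Du,
         \int[leb]_(x in Omega) (u x)%:E = 0 &
         y = 2%:E * \int[leb]_(x in Omega) (f x * u x)%:E
             - \int[mu]_(x in closure Omega) (sqr_euclid (Du x))%:E]]
   + \int[mu]_(x in closure Omega) 1)%E.

Definition uniform_unit_sphere (K : set 'rV[R]_n) (g : 'rV[R]_n -> R) : Prop :=
  {within K, continuous g} /\ sup [set `|g x| | x in K] = 1.

Definition dense_in_unit_sphere (K : set 'rV[R]_n)
    (phi : nat -> 'rV[R]_n -> R) : Prop :=
  (forall k, uniform_unit_sphere K (phi k)) /\
  (forall g, uniform_unit_sphere K g -> forall e : R, 0 < e ->
     exists k, forall x, K x -> `|phi k x - g x| < e).

(* [d_w mu nu = 0] means that [mu] and [nu] agree on Borel sets; it does not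
   entail the Leibniz equality of the two records, as the library's measures
   are set functions with arbitrary values on non-measurable sets. The metric
   notions below are thus stated for a distance function on a type, without
   appealing to equality of points. *)
Definition d_w (Omega : set 'rV[R]_n) (phi : nat -> 'rV[R]_n -> R)
    (mu nu : Mplus Omega) : R :=
  Num.sqrt (limn (series (fun k : nat => 2 ^- k *
    `| \int[mu]_(x in closure Omega) phi k x
       - \int[nu]_(x in closure Omega) phi k x | ^+ 2))).

End transport_energy.

Section metric_gradient_flows.
Context {R : realType} {S : Type}.
Variables (phi : S -> \bar R) (d : S -> S -> R).
Local Notation leb := (@lebesgue_measure R).

Definition eitv_oo (a b : \bar R) : set R :=
  [set t | (a < t%:E)%E && (t%:E < b)%E].

Definition time_steps (tau : nat -> R) : Prop :=
  (forall k, 0 < tau k) /\ series tau k @[k --> \oo] --> +oo.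

Definition is_argmin (F : S -> \bar R) (x : S) : Prop :=
  forall y, (F x <= F y)%E.

Definition discrete_trajectory (tau : nat -> R) (v : R -> S) : Prop :=
  exists m : nat -> S,
    [/\ (phi (m 0%N) < +oo)%E,
        forall k, is_argmin
          (fun nu => phi nu + (d (m k) nu ^+ 2 / (2 * tau k))%:E)%E (m k.+1),
        v 0 = m 0%N &
        forall k t, series tau k < t <= series tau k.+1 -> v t = m k.+1].

(* Curves defined on [0, +oo[ are functions on [R], whose values at negative
   times are irrelevant. The first condition says that [mu] starts from [mu0];
   the convergence of the energies and the bound on the distances of the
   initial data do not imply it. *)
Definition minimizing_movements (mu0 : S) : set (R -> S) :=
  [set mu | d (mu 0) mu0 = 0 /\
    forall tau : nat -> nat -> R, (forall j, time_steps (tau j)) ->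
      ereal_sup [set (tau j k)%:E | k in [set: nat]] @[j --> \oo] --> 0%E ->
      exists v : nat -> R -> S,
        [/\ forall j, discrete_trajectory (tau j) (v j),
            phi (v j 0) @[j --> \oo] --> phi mu0,
            (limn_esup (fun j => (d (v j 0) mu0)%:E) < +oo)%E &
            forall t, 0 <= t -> d (v j t) (mu t) @[j --> \oo] --> (0 : R)]].

(* The point [nu = mu] contributes 0 to the supremum since [0^-1 = 0]; the
   slope at an isolated point is thus 0. *)
Definition slope (mu : S) : \bar R :=
  if (phi mu < +oo)%E then
    ereal_inf [set ereal_sup
      [set (maxe 0 (phi mu - phi nu) * ((d mu nu)^-1)%:E)%E
        | nu in [set nu | d mu nu < r]] | r in [set r : R | 0 < r]]
  else +oo%E.

Definition metric_quotient (v : R -> S) (t s : R) : R :=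
  d (v s) (v t) / `|s - t|.

Definition metric_derivable (v : R -> S) (t : R) : Prop :=
  cvg (metric_quotient v t s @[s --> t^']).

Definition metric_derivative (v : R -> S) (t : R) : R :=
  lim (metric_quotient v t s @[s --> t^']).

Definition absolutely_continuous_curve (a b : \bar R) (v : R -> S) : Prop :=
  exists2 m : R -> R, leb.-integrable (eitv_oo a b) (EFin \o m) &
    forall s t, eitv_oo a b s -> eitv_oo a b t -> s <= t ->
      ((d (v s) (v t))%:E <= \int[leb]_(r in `[s, t]) (m r)%:E)%E.

(* No condition is imposed when both energies are infinite, in which case their
   difference is meaningless. *)
Definition strong_upper_gradient (g : S -> \bar R) : Prop :=
  (forall x, (0 <= g x)%E) /\
  forall (a b : \bar R) (v : R -> S), absolutely_continuous_curve a b v ->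
    measurable_fun (eitv_oo a b) (g \o v) /\
    forall t0 t1, eitv_oo a b t0 -> eitv_oo a b t1 -> t0 <= t1 ->
      (phi (v t0) < +oo)%E \/ (phi (v t1) < +oo)%E ->
      (`|phi (v t0) - phi (v t1)|
        <= \int[leb]_(s in `[t0, t1]) (g (v s) * (metric_derivative v s)%:E))%E.

Definition curve_of_maximal_slope (g : S -> \bar R) (a b : \bar R)
    (v : R -> S) : Prop :=
  exists psi : R -> R,
    [/\ forall s t, eitv_oo a b s -> eitv_oo a b t -> s <= t -> psi t <= psi s,
        {ae leb, forall t, eitv_oo a b t -> phi (v t) = (psi t)%:E} &
        {ae leb, forall t, eitv_oo a b t ->
          [/\ metric_derivable v t, derivable psi t 1 &
              ((derive1 psi t)%:E <= - ((metric_derivative v t ^+ 2 / 2)%:E)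
                                 - (2^-1)%:E * g (v t) ^+ 2)%E]}].

End metric_gradient_flows.

(* Main.v *)
(** The map sending [mu] to [(\int phi_k dmu)_k] embeds the measures isometrically in
    a weighted l^2 space, along whose segments the energy is convex; it is moreover
    lower semicontinuous with complete sublevels, by Riesz representation. A proximal
    step therefore satisfies a discrete evolution variational inequality (EVI).
    Weighting the EVI of each of two schemes with the step of the other cancels the
    energies and leaves a Kobayashi recursion for the distance of the iterates, so
    that the schemes converge to a limit independent of the partitions. The limit
    satisfies the EVI, which forces |mu'|^2 = - (E o mu)' = |dE|^2(mu) a.e.
    By convexity the slope is a global difference quotient. It is a strong upper
    gradient: along an absolutely continuous curve [v], the Moreau envelope of E is
    absolutely continuous with derivative at most |dE|(v) |v'|, and one lets the
    parameter of the envelope tend to 0. *)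

Require Import Defs.
From HB Require Import structures.
From mathcomp Require Import all_boot all_order all_algebra.
From mathcomp Require Import all_classical all_reals all_analysis.
From mathcomp Require Import measurable_realfun ring lra.

Set Implicit Arguments.
Unset Strict Implicit.
Unset Printing Implicit Defensive.

Import Order.TTheory GRing.Theory Num.Theory.
Import numFieldNormedType.Exports.

Local Open Scope classical_set_scope.
Local Open Scope ring_scope.

(** All that concerns schemes, slopes and flows is proved for an abstract [convex_energy], over a
    distance that need not separate points. On the concrete side, Riesz representation is used
    twice: to produce convex combinations of measures and to produce limits of Cauchy sequences. The
    slope of the initial datum may be infinite, so the Lipschitz bounds degenerate at time 0. They
    hold on [[a, +oo[] with constants coming from the decay [|dE|^2(mu(t)) <= E(mu(0)) / t], and the
    energy identity is recovered by letting [a] tend to 0. Existence may start every scheme exactly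
    at [mu0], so the Kobayashi recursion compares schemes with a common starting point. Conversely,
    a given minimizing movement is studied through uniform partitions, whose discrete initial points
    may vary. The upper gradient inequality integrates a product whose measurability is not
    established; measurable densities are compared with it from below. *)

Section finite_measure_of.
Context d (T : measurableType d) (R : realType) (m : {measure set T -> \bar R}).
Hypothesis m_fin : (m setT < +oo)%E.

Let fin_m : fin_num_fun m.
Proof.
move=> A mA; rewrite ge0_fin_numE//; apply: le_lt_trans m_fin.
by apply: le_measure; rewrite ?inE.
Qed.

Let m' : set T -> \bar R := m.

#[local] HB.instance Definition _ := Measure.on m'.
#[local] HB.instance Definition _ := Measure_isFinite.Build _ _ _ m' fin_m.

Lemma finite_measure_of :
  exists nu : {finite_measure set T -> \bar R}, nu = m :> (set T -> \bar R).
Proof. by exists m'. Qed.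

End finite_measure_of.

Section measure_packing.
Context d (T : measurableType d) (R : realType).

Lemma measure_of (m : set T -> \bar R) :
  m set0 = 0%E -> (forall A, (0 <= m A)%E) -> semi_sigma_additive m ->
  exists m' : {measure set T -> \bar R}, m' = m :> (set T -> \bar R).
Proof.
move=> m0 m_ge0 mU.
pose b := isMeasure.Build _ _ _ m m0 m_ge0 mU.
pose m' : {measure set T -> \bar R} := HB.pack m b.
by exists m'.
Qed.

Lemma density_measure (mu : {measure set T -> \bar R}) (f : T -> \bar R) :
  measurable_fun setT f -> (forall x, (0 <= f x)%E) ->
  exists m : {measure set T -> \bar R},
    forall A, m A = (\int[mu]_(x in A) f x)%E.
Proof.
move=> mf f0.
have [m mE] := @measure_of (fun A => (\int[mu]_(x in A) f x)%E)
  (@integral_set0 _ _ _ mu f) (fun A => @integral_ge0 _ _ _ mu A f (fun x _ => f0 x))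
  (semi_sigma_additive_nng_induced mf f0).
by exists m => A; rewrite mE.
Qed.

(* The integral is the supremum of the integrals of simple functions below the
   integrand, so it is monotone even when the larger function is not
   measurable. *)
Lemma ge0_le_integral_nonmeasurable (mu : {measure set T -> \bar R})
    (D : set T) (f h : T -> \bar R) :
  measurable D -> measurable_fun D f ->
  (forall x, D x -> (0 <= f x)%E) -> (forall x, D x -> (0 <= h x)%E) ->
  {ae mu, forall x, D x -> (f x <= h x)%E} ->
  (\int[mu]_(x in D) f x <= \int[mu]_(x in D) h x)%E.
Proof.
move=> mD mf f0 h0 [N [mN N0 fhN]].
have -> : (\int[mu]_(x in D) f x = \int[mu]_(x in D `\` N) f x)%E.
  by rewrite -ge0_negligible_integral.
rewrite ge0_integralE; last by move=> x [Dx _]; exact: f0.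
rewrite ge0_integralE//; apply: ge_ereal_sup => /= _ [g gf <-].
apply: ereal_sup_ubound; exists g => // x; apply: le_trans (gf x) _.
rewrite !patchE; case: ifPn => [|_].
  rewrite inE => -[Dx Nx]; rewrite mem_set//.
  by apply: contrapT => fh; apply/Nx/fhN => /= /(_ Dx).
by case: ifPn => // /[!inE] Dx; exact: h0.
Qed.

End measure_packing.

(** * Absolutely continuous functions and metric derivatives *)

Section absolutely_continuous_functions.
Context {R : realType}.
Local Notation mu := (@lebesgue_measure R).

Lemma cumulative_of (f : R -> R) :
  nondecreasing f -> (forall x, f @ at_right x --> f x) ->
  exists g : cumulative R R, g = f :> (R -> R).
Proof.
move=> ndf rcf.
pose b := isCumulative.Build R _ R f ndf rcf.
pose g : cumulative R R := HB.pack f b.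
by exists g.
Qed.

Lemma lebesgue_stieltjes_itv (g : cumulative R R) (s t : R) : s <= t ->
  lebesgue_stieltjes_measure g `]s, t]%classic = (g t - g s)%:E.
Proof.
move=> st; rewrite /lebesgue_stieltjes_measure /measure_extension/=.
rewrite measurable_mu_extE/=; last exact: is_ocitv.
by rewrite wlength_itv_bnd.
Qed.

(** The Stieltjes measures of [g1] and [g2] add up to the measure of density [m], as both sides
    agree on half-open intervals. Each is therefore dominated by a finite absolutely continuous
    measure, and Radon-Nikodym provides [p]. *)
Lemma cumulative_density (g1 g2 : cumulative R R) (m : R -> R) :
  mu.-integrable setT (EFin \o m) -> (forall x, 0 <= m x) ->
  (forall s t, s <= t ->
    g1 t - g1 s + (g2 t - g2 s) = \int[mu]_(x in `]s, t]) m x) ->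
  exists p : R -> R, mu.-integrable setT (EFin \o p) /\
    forall s t, s <= t -> g1 t - g1 s = \int[mu]_(x in `]s, t]) p x.
Proof.
move=> im m0 g12.
have [rho rhoE] := @density_measure _ (measurableTypeR R) _ mu (EFin \o m)
  (measurable_int _ im) m0.
have [g gE] : exists g : cumulative R R, g = (g1 \+ g2) :> (R -> R).
  apply: cumulative_of => [s t st|x].
    by apply: lerD; exact: cumulative_is_nondecreasing.
  by apply: cvgD; exact: cumulative_is_right_continuous.
have rho_itv s t : s <= t -> rho `]s, t]%classic = (g t - g s)%:E.
  move=> st; rewrite rhoE.
  rewrite -[LHS]fineK; last first.
    by apply: integrable_fin_num => //; exact: integrableS im.
  by rewrite -/(Rintegral _ _ _) -g12// gE /=; congr EFin; ring.
have g_rho := @lebesgue_stieltjes_measure_unique _ g rho.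
have g_sum := @lebesgue_stieltjes_measure_unique _ g
  (measure_add (lebesgue_stieltjes_measure g1) (lebesgue_stieltjes_measure g2)).
have sum_rho A : measurable A ->
    (lebesgue_stieltjes_measure g1 A + lebesgue_stieltjes_measure g2 A = rho A)%E.
  move=> mA; rewrite -g_rho//; last first.
    move=> X [[s t]] _ <- /=; have [st|ts] := leP s t.
      by rewrite lebesgue_stieltjes_itv// rho_itv.
    by rewrite set_itv_ge ?bnd_simp -?leNgt ?(ltW ts)// !measure0.
  rewrite g_sum//=; first by rewrite /measure_add/= /msum !big_ord_recl big_ord0/= adde0.
  move=> X [[s t]] _ <- /=; have [st|ts] := leP s t.
    rewrite /msum !big_ord_recl big_ord0/= adde0.
    by rewrite !lebesgue_stieltjes_itv// gE /= -EFinD; congr EFin; ring.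
  by rewrite set_itv_ge ?bnd_simp -?leNgt ?(ltW ts)// !measure0.
have le1 A : measurable A -> (lebesgue_stieltjes_measure g1 A <= rho A)%E.
  by move=> mA; rewrite -sum_rho// leeDl.
have [nu nuE] : exists nu : {finite_measure set (measurableTypeR R) -> \bar R},
    nu = lebesgue_stieltjes_measure g1 :> (set _ -> \bar R).
  apply: finite_measure_of; apply: le_lt_trans (le1 _ measurableT) _.
  rewrite rhoE; apply: integrable_lty => //.
have numu : nu `<< mu.
  apply/null_content_dominatesP => A mA A0.
  apply/eqP; rewrite eq_le measure_ge0 andbT nuE.
  apply: le_trans (le1 _ mA) _; rewrite rhoE null_set_integral//.
  by apply: measurable_funTS; exact: measurable_int im.
have [p [p0 pfin ip pE]] := radon_nikodym_sigma_finite numu.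
have fp : EFin \o (fine \o p) = p by apply/funext => x /=; rewrite fineK.
exists (fine \o p); split; first by rewrite fp.
move=> s t st; rewrite /Rintegral -/(comp _ _).
have -> : (fun x : R => ((fine \o p) x)%:E) = p by rewrite -[RHS]fp.
have nust : nu `]s, t]%classic = (g1 t - g1 s)%:E.
  by rewrite nuE lebesgue_stieltjes_itv.
by rewrite -(pE _ (measurable_itv `]s, t])) nust.
Qed.

Section majorized_increments.
Variable m : R -> R.
Hypotheses (im : mu.-integrable setT (EFin \o m)) (m0 : forall x, 0 <= m x).

Let M t := \int[mu]_(x in `]-oo, t]) m x.

Lemma Rintegral_primitiveB (p : R -> R) (s t : R) :
  mu.-integrable setT (EFin \o p) -> s <= t ->
  \int[mu]_(x in `]-oo, t]) p x - \int[mu]_(x in `]-oo, s]) p x =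
  \int[mu]_(x in `]s, t]) p x.
Proof.
move=> ip st; rewrite Rintegral_itvB ?bnd_simp//.
exact: integrableS ip.
Qed.

Lemma majorized_right_continuous (g : R -> R) :
  (forall s t, s <= t -> `|g t - g s| <= \int[mu]_(x in `]s, t]) m x) ->
  forall x, g @ at_right x --> g x.
Proof.
move=> gm x.
have ix : mu.-integrable `[x, x + 1] (EFin \o m) by exact: integrableS im.
have /cvgrPdist_lt Px := parameterized_integral_cvg_left (ltr_pwDr ltr01 (lexx x)) ix.
apply/cvgrPdist_lt => e e0; rewrite /at_right near_withinE.
apply: filterS (Px e e0) => y; rewrite sub0r normrN => ye xy.
rewrite distrC; apply: le_lt_trans (gm _ _ (ltW xy)) _.
rewrite Rintegral_itv_obnd_cbnd; last exact: integrableS im.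
exact: le_lt_trans (ler_norm _) ye.
Qed.

(** As [F] varies at most as much as the primitive [M] of [m], both [(M + F) / 2] and [(M - F) / 2]
    are nondecreasing, and their increments add up to those of [M]. This Jordan decomposition
    adapted to the majorant reduces the claim to monotone functions. *)
Lemma majorized_density (F : R -> R) :
  (forall s t, s <= t -> `|F t - F s| <= \int[mu]_(x in `]s, t]) m x) ->
  exists p : R -> R, mu.-integrable setT (EFin \o p) /\
    forall s t, s <= t -> F t - F s = \int[mu]_(x in `]s, t]) p x.
Proof.
move=> Fm.
have ME s t : s <= t -> M t - M s = \int[mu]_(x in `]s, t]) m x.
  exact: Rintegral_primitiveB.
have bnd s t : s <= t -> - (M t - M s) <= F t - F s <= M t - M s.
  by move=> st; rewrite ME// -ler_norml Fm.
have [g1 g1E] : exists g : cumulative R R, g = (fun t => (M t + F t) / 2) :> (R -> R).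
  apply: cumulative_of => [s t st|].
    by have := bnd _ _ st; lra.
  apply: majorized_right_continuous => s t st; rewrite -ME//.
  by have := bnd _ _ st; rewrite ler_norml; lra.
have [g2 g2E] : exists g : cumulative R R, g = (fun t => (M t - F t) / 2) :> (R -> R).
  apply: cumulative_of => [s t st|].
    by have := bnd _ _ st; lra.
  apply: majorized_right_continuous => s t st; rewrite -ME//.
  by have := bnd _ _ st; rewrite ler_norml; lra.
have [s t st|p [ip pE]] := @cumulative_density g1 g2 m im m0.
  by rewrite g1E g2E -ME//; field.
(* [F] is [2 * g1 - M], so twice the density of [g1] minus [m] is a density of [F]. *)
have i2p : mu.-integrable setT (EFin \o (fun x => 2 * p x)).
  by have := integrableZl measurableT 2 ip.
exists (fun x => 2 * p x - m x); split; first by have := integrableB measurableT i2p im.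
move=> s t st; rewrite RintegralB//; last 2 first.
- exact: integrableS i2p.
- exact: integrableS im.
rewrite RintegralZl//; last exact: integrableS ip.
by rewrite -pE// -ME// g1E; field.
Qed.

End majorized_increments.

Lemma primitive_derive_ae (p F : R -> R) :
  mu.-integrable setT (EFin \o p) ->
  (forall s t, s <= t -> F t - F s = \int[mu]_(x in `]s, t]) p x) ->
  {ae mu, forall x : R, is_derive x (1 : R) F (p x)}.
Proof.
move=> ip Fp; have lp : locally_integrable setT p.
  by have := integrable_locally measurableT ip; rewrite patch_setT.
have iNy y : mu.-integrable `]-oo, y] (EFin \o p) by exact: integrableS ip.
have [P PE] : exists P : R -> R, P = fun y => \int[mu]_(x in `]-oo, y]) p x.
  by eexists.
have PB s t : s <= t -> P t - P s = \int[mu]_(x in `]s, t]) p x.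
  by move=> st; rewrite PE Rintegral_primitiveB.
have FP : F = (fun y => P y + (F 0 - P 0)).
  apply/funext => y; have [y0|/ltW y0] := leP 0 y.
    by have := Fp _ _ y0; rewrite -PB//; lra.
  by have := Fp _ _ y0; rewrite -PB//; lra.
have := FTC1Ny iNy lp; rewrite /= -PE; apply: filterS => [|x [dP P'x]].
  exact: (ae_filter_ringOfSetsType mu).
have dPx : is_derive x (1 : R) P (p x) by apply: DeriveDef => //; rewrite -derive1E.
rewrite FP -[p x]addr0.
exact: is_deriveD.
Qed.
End absolutely_continuous_functions.

Section difference_quotients.
Context {R : realType}.

Lemma is_derive_quotient (F : R -> R) (t f : R) : is_derive t (1 : R) F f ->
  (F s - F t) / (s - t) @[s --> t^'] --> f.
Proof.
move=> [/cvg_ex[/= l dl] DF].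
have {DF} lf : l = f by rewrite -DF; apply/esym/cvg_lim.
rewrite {}lf in dl; apply/cvgrPdist_lt => e e0.
have /cvgrPdist_lt/(_ e e0) := dl.
rewrite !near_withinE => /nbhs_ballP[r /= r0 fr].
apply/nbhs_ballP; exists r => //= s; rewrite /ball/= => sr st.
have := fr (s - t); rewrite /ball/= sub0r normrN distrC => /(_ sr).
rewrite subr_eq0 => /(_ st).
by rewrite /GRing.scale/= mulr1 subrK mulrC.
Qed.

Lemma is_derive_norm_quotient (F : R -> R) (t f : R) :
  is_derive t (1 : R) F f ->
  `|F s - F t| / `|s - t| @[s --> t^'] --> `|f|.
Proof.
move=> /is_derive_quotient/cvg_norm.
by under eq_fun do rewrite normrM normfV.
Qed.

End difference_quotients.

Section metric_derivative_ae.
Context {R : realType} {S : Type} (d : S -> S -> R).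
Local Notation mu := (@lebesgue_measure R).
Hypothesis d_sym : forall x y, d x y = d y x.
Hypothesis d_triangle : forall x y z, d x z <= d x y + d y z.
Variables (w : R -> S) (m : R -> R).
Hypotheses (im : mu.-integrable setT (EFin \o m)) (m0 : forall x, 0 <= m x).
Hypothesis w_ac : forall s t, s <= t ->
  d (w s) (w t) <= \int[mu]_(x in `]s, t]) m x.

(** The points at rational times are dense on the curve, so countably many distance functions see
    all of it, and their exceptional null sets can be united. *)
Let qn (k : nat) : R := ratr (odflt (0 : rat) (unpickle k)).

Let qnP (q : rat) : exists k, qn k = ratr q.
Proof. by exists (pickle q); rewrite /qn pickleK. Qed.

Let F k t := d (w t) (w (qn k)).

Let dist_F k s t : `|F k t - F k s| <= d (w s) (w t).
Proof.
rewrite ler_norml /F lerBlDr lerBrDr.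
have := d_triangle (w s) (w t) (w (qn k)).
have := d_triangle (w t) (w s) (w (qn k)).
by rewrite (d_sym (w t) (w s)) => H1 H2; apply/andP; split; lra.
Qed.

Let small_right s e : 0 < e ->
  \forall t \near s^'+, d (w s) (w t) < e.
Proof.
move=> e0.
have ix : mu.-integrable `[s, s + 1] (EFin \o m) by exact: integrableS im.
have := parameterized_integral_cvg_left (ltr_pwDr ltr01 (lexx s)) ix.
move=> /cvgrPdist_lt/(_ e e0) Ps.
rewrite /at_right near_withinE.
apply: filterS Ps => t; rewrite sub0r normrN => te st.
apply: le_lt_trans (w_ac (ltW st)) _.
rewrite Rintegral_itv_obnd_cbnd; last exact: integrableS im.
exact: le_lt_trans (ler_norm _) te.
Qed.

(** For a rational time just to the right of [s], the corresponding point is close to [w s], and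
    [F k t - F k s] is then close to [d (w s) (w t)]. *)
Let d_le_of_F s t c : (forall k, F k t - F k s <= c) -> d (w s) (w t) <= c.
Proof.
move=> Fc; apply/ler_addgt0Pr => e e0.
have e2 : 0 < e / 2 by lra.
have := small_right s e2; rewrite /at_right near_withinE.
move=> /nbhs_ballP[r /= r0 sr].
have [q] : exists q, ratr q \in `]s, (s + r)[ by apply: rat_in_itvoo; lra.
rewrite in_itv/= => /andP[sq qr].
have [k kq] := qnP q; have := Fc k; rewrite /F kq.
have : d (w s) (w (ratr q)) < e / 2.
  by apply: sr => //; rewrite /ball/= distrC gtr0_norm; lra.
have := d_triangle (w s) (w (ratr q)) (w t).
by rewrite (d_sym (w t)); lra.
Qed.

(** The candidate is the supremum over [k] of [|p k t|], with [p k] the density of [F k]. The [F k]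
    are 1-Lipschitz in the point, which bounds the quotient below by that of each [F k]; integrating
    the densities bounds [d (w s) (w t)] by the integral of [M], whose primitive is differentiable
    almost everywhere. *)
Lemma metric_derivative_ae : exists M : R -> R, (forall t, 0 <= M t) /\
  {ae mu, forall t : R, metric_quotient d w t s @[s --> t^'] --> M t}.
Proof.
have pF k : exists p : R -> R, mu.-integrable setT (EFin \o p) /\
    forall s t, s <= t -> F k t - F k s = \int[mu]_(x in `]s, t]) p x.
  apply: (majorized_density im m0) => s t st.
  exact: le_trans (dist_F _ _ _) (w_ac st).
have {pF} [p /all_and2[ip pE]] := choice pF.
have [Im ImE] : exists F : R -> R, F = fun y => \int[mu]_(x in `]-oo, y]) m x.
  by eexists.
have ImB s t : s <= t -> Im t - Im s = \int[mu]_(x in `]s, t]) m x.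
  by move=> st; rewrite ImE Rintegral_primitiveB.
(* Truncating at [m] makes the supremum finite everywhere and [M] integrable; as [|p k| <= m] almost
   everywhere, it changes nothing up to a null set. *)
pose h k x := Num.min `|p k x| (m x).
have h_ge0 k x : 0 <= h k x by rewrite le_min normr_ge0 m0.
have h_le k x : h k x <= m x by rewrite ge_min lexx orbT.
have h_ub x : has_ubound (range (h ^~ x)).
  by exists (m x) => _ [k _ <-].
pose M x := sups (h ^~ x) 0%N.
have hM k x : h k x <= M x.
  by apply: ub_le_sup; [exact: has_ubound_sdrop|exists k].
have M_le x : M x <= m x.
  by apply: ge_sup; [exists (h 0%N x); exists 0%N|move=> _ [k _ <-]].
have M_ge0 x : 0 <= M x by apply: le_trans (hM 0%N x).
have mm : measurable_fun setT m by have /measurable_EFinP := measurable_int _ im.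
have mM : measurable_fun setT M.
  apply: measurable_fun_sups => [x _|k]; first exact: h_ub.
  apply: measurable_minr => //; apply: measurableT_comp => //.
  by have /measurable_EFinP := measurable_int _ (ip k).
have iM : mu.-integrable setT (EFin \o M).
  apply: le_integrable im => //; first exact/measurable_EFinP.
  by move=> x _ /=; rewrite lee_fin !ger0_norm.
have [IM IME] : exists F : R -> R, F = fun y => \int[mu]_(x in `]-oo, y]) M x.
  by eexists.
have IMB s t : s <= t -> IM t - IM s = \int[mu]_(x in `]s, t]) M x.
  by move=> st; rewrite IME Rintegral_primitiveB.
have dF : {ae mu, forall t : R, forall k, is_derive t (1 : R) (F k) (p k t)}.
  by apply: ae_foralln => k; exact: primitive_derive_ae (ip k) (pE k).
have p_le : {ae mu, forall t : R, forall k, `|p k t| <= m t}.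
  move: dF (primitive_derive_ae im ImB).
  apply: filterS2 => [|t dF dI k]; first exact: (ae_filter_ringOfSetsType mu).
  have dI' := is_derive_norm_quotient dI; rewrite (ger0_norm (m0 t)) in dI'.
  apply: (ler_cvg_to (is_derive_norm_quotient (dF k)) dI').
  apply: nearW => s; apply: ler_wpM2r; first by rewrite invr_ge0.
  have [st|/ltW ts] := leP t s.
    apply: le_trans (dist_F k t s) _; apply: le_trans (w_ac st) _.
    by rewrite -ImB//; exact: ler_norm.
  rewrite distrC (distrC (Im _)).
  apply: le_trans (dist_F k s t) _; apply: le_trans (w_ac ts) _.
  by rewrite -ImB//; exact: ler_norm.
have p_leM : {ae mu, forall t : R, forall k, `|p k t| <= M t}.
  apply: filterS p_le => [|t pm k]; first exact: (ae_filter_ringOfSetsType mu).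
  by rewrite (le_trans _ (hM k t))// le_min lexx pm.
have dM s t : s <= t -> d (w s) (w t) <= IM t - IM s.
  move=> st; apply: d_le_of_F => k; rewrite pE// IMB//.
  have ipst : mu.-integrable `]s, t] (EFin \o p k) by exact: integrableS (ip k).
  have iMst : mu.-integrable `]s, t] (EFin \o M) by exact: integrableS iM.
  apply: le_trans (ler_norm _) _; apply: le_trans (le_normr_Rintegral _ _) _ => //.
  apply: fine_le.
  - by apply: integrable_fin_num => //; exact: integrable_norm ipst.
  - exact: integrable_fin_num.
  have pMst : {ae mu, forall x, `]s, t]%classic x -> (`|p k x|%:E <= (M x)%:E)%E}.
    apply: filterS p_leM => [|x pM ?]; first exact: (ae_filter_ringOfSetsType mu).
    by rewrite lee_fin.
  apply: (ge0_le_integral_nonmeasurable _ _ _ _ pMst) => //.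
    exact: measurable_int (integrable_norm ipst).
  by move=> x ?; rewrite lee_fin.
exists M; split => //.
move: dF (primitive_derive_ae iM IMB) p_le.
apply: filterS3 => [|t dF dI pm]; first exact: (ae_filter_ringOfSetsType mu).
have hp k : h k t = `|p k t| by rewrite /h min_l.
apply/cvgrPdist_le => e e0.
have [_ [k _ <-] Mk] : exists2 x, sdrop (h ^~ t) 0%N x & M t - e / 2 < x.
  apply: sup_gt; last by change (M t - e / 2 < M t); rewrite ltrBlDr ltrDl divr_gt0.
  by exists (h 0%N t); exists 0%N.
have /cvgrPdist_le/(_ _ e0) := is_derive_norm_quotient dI.
rewrite (ger0_norm (M_ge0 t)) => up.
have e2 : 0 < e / 2 by lra.
have /cvgrPdist_le/(_ _ e2) low := is_derive_norm_quotient (dF k).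
near=> s.
have u1 : `| M t - `|IM s - IM t| / `|s - t| | <= e by near: s.
have l1 : `| `|p k t| - `|F k s - F k t| / `|s - t| | <= e / 2 by near: s.
have q1 : `|F k s - F k t| / `|s - t| <= metric_quotient d w t s.
  by apply: ler_wpM2r; rewrite ?invr_ge0// d_sym dist_F.
have q2 : metric_quotient d w t s <= `|IM s - IM t| / `|s - t|.
  apply: ler_wpM2r; rewrite ?invr_ge0//.
  have [st|/ltW ts] := leP s t.
    by apply: le_trans (dM _ _ st) _; rewrite distrC ler_norm.
  by rewrite d_sym; apply: le_trans (dM _ _ ts) _; rewrite ler_norm.
move: u1 l1; rewrite !ler_norml -hp => /andP[a1 a2] /andP[b1 b2].
by apply/andP; split; lra.
Unshelve. all: by end_near. Qed.

End metric_derivative_ae.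

(** These are properties of a convex energy on a Hilbert space, without separation of points, which
    [d_w] does not provide. In [energy_interp] a single [z] serves all [w], with equality as on a
    Hilbert segment; energies enter through real bounds to avoid arithmetic with [+oo]. Completeness
    is asked of sublevels, where the mass of the measures is bounded. *)
Record convex_energy (R : realType) (S : Type) (phi : S -> \bar R)
    (d : S -> S -> R) : Prop := {
  dist_ge0 : forall x y, 0 <= d x y ;
  dist_refl : forall x, d x x = 0 ;
  dist_sym : forall x y, d x y = d y x ;
  dist_triangle : forall x y z, d x z <= d x y + d y z ;
  energy_ge0 : forall x, (0 <= phi x)%E ;
  energy_dom : exists x, (phi x < +oo)%E ;
  energy_interp : forall x y (th : R), 0 <= th <= 1 -> exists z,
    (forall w, d w z ^+ 2 =
      (1 - th) * d w x ^+ 2 + th * d w y ^+ 2 - th * (1 - th) * d x y ^+ 2) /\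
    (forall a b : R, (phi x <= a%:E)%E -> (phi y <= b%:E)%E ->
      (phi z <= ((1 - th) * a + th * b)%:E)%E) ;
  energy_lsc : forall (x : nat -> S) y (c : R),
    (forall n, (phi (x n) <= c%:E)%E) -> d (x n) y @[n --> \oo] --> (0 : R) ->
    (phi y <= c%:E)%E ;
  energy_complete : forall (x : nat -> S) (c : R),
    (forall n, (phi (x n) <= c%:E)%E) ->
    (forall e : R, 0 < e -> exists N, forall i j,
      (N <= i)%N -> (N <= j)%N -> d (x i) (x j) < e) ->
    exists y, d (x n) y @[n --> \oo] --> (0 : R) }.

(** * Slopes of convex energies *)

Section convex_energy_theory.
Context {R : realType} {S : Type} (phi : S -> \bar R) (d : S -> S -> R).
Hypothesis H : convex_energy phi d.

Local Notation F x := (fine (phi x)).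
Local Notation Dom x := (phi x < +oo)%E.

Lemma energy_fineK x : Dom x -> ((F x)%:E = phi x)%E.
Proof. by move=> xoo; rewrite fineK// ge0_fin_numE// (energy_ge0 H). Qed.

Lemma energy_fine_ge0 x : 0 <= F x.
Proof. by apply: fine_ge0; exact: energy_ge0 H _. Qed.

Lemma energy_fine_le x (c : R) : (phi x <= c%:E)%E -> Dom x /\ F x <= c.
Proof.
move=> xc; have Dx : Dom x by apply: le_lt_trans xc _; rewrite ltry.
by split => //; rewrite -lee_fin energy_fineK.
Qed.

Lemma energy_lsc_near (x : nat -> S) y (c : R) :
  d (x n) y @[n --> \oo] --> (0 : R) ->
  (forall e, 0 < e -> \forall n \near \oo, (phi (x n) <= (c + e)%:E)%E) ->
  (phi y <= c%:E)%E.
Proof.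
move=> xy xc; apply/lee_addgt0Pr => e e0.
have [N _ Nc] := xc e e0.
apply: (@energy_lsc _ _ _ _ H (fun n => x (n + N)%N)) => [n|].
  by apply: Nc; rewrite /= leq_addl.
by rewrite (cvg_shiftn N (fun n => d (x n) y)).
Qed.

(** Lower semicontinuity along a constant sequence gives both inequalities. It stands in for the
    equality of points at distance 0. *)
Lemma dist0_energy x y : d x y = 0 -> phi x = phi y.
Proof.
have le a b : d a b = 0 -> (phi b <= phi a)%E.
  move=> ab; have [aoo|] := ltP (phi a) +oo%E; last by rewrite leye_eq => /eqP ->; exact: leey.
  rewrite -(energy_fineK aoo).
  apply: (@energy_lsc _ _ _ _ H (fun=> a)) => [n|]; first by rewrite energy_fineK.
  by rewrite ab; exact: cvg_cst.
move=> xy; apply/eqP; rewrite eq_le (le x y)// andbT le//.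
by rewrite (dist_sym H).
Qed.

Lemma dist_quadrilateral x y z t : `|d x y - d z t| <= d x z + d y t.
Proof.
rewrite ler_norml.
have := dist_triangle H x z y; have := dist_triangle H z t y.
have := dist_triangle H z x t; have := dist_triangle H x y t.
by rewrite (dist_sym H z x) (dist_sym H t y); lra.
Qed.

Lemma dist_cvg (x : nat -> S) y z : d (x n) y @[n --> \oo] --> (0 : R) ->
  d (x n) z @[n --> \oo] --> d y z.
Proof.
move=> /cvgrPdist_le xy; apply/cvgrPdist_le => e e0.
near=> n; rewrite distrC; apply: le_trans (dist_quadrilateral _ _ _ _) _.
rewrite (dist_refl H) addr0.
have : `|0 - d (x n) y| <= e by near: n; exact: xy.
by rewrite sub0r normrN ger0_norm// (dist_ge0 H).
Unshelve. all: by end_near. Qed.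

(* By convexity the local slope is at most [C] exactly when this global bound
   holds. *)
Definition slope_bound (x : S) (C : R) : Prop :=
  forall w b, (phi w <= b%:E)%E -> (phi x <= (b + C * d x w)%:E)%E.

Lemma slope_bound_dom x C : slope_bound x C -> Dom x.
Proof.
move=> xC; have [w wd] := energy_dom H.
by have /(xC w) : (phi w <= (F w)%:E)%E; [rewrite energy_fineK|
  move=> /le_lt_trans; apply; rewrite ltry].
Qed.

Lemma slope_bound_fine x C w : slope_bound x C -> Dom w ->
  F x <= F w + C * d x w.
Proof.
move=> xC wd; have /(xC w) : (phi w <= (F w)%:E)%E by rewrite energy_fineK.
by case/energy_fine_le.
Qed.

Lemma slope_ge0 x : (0 <= slope phi d x)%E.
Proof.
rewrite /slope; case: ifPn => _; last exact: leey.
apply: le_ereal_inf_tmp => _ [r /= r0 <-].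
apply: ereal_sup_ubound; exists x => /=; first by rewrite (dist_refl H).
by rewrite (dist_refl H) invr0 mule0.
Qed.

(** A step of fraction [th] from [x] towards [w] has length [th * d x w] and lowers the energy by at
    least [th * (F x - b)]. The global quotient is thus attained arbitrarily close to [x], which
    makes the local slope control it. *)
Lemma slope_leP x (C : R) : 0 <= C ->
  (slope phi d x <= C%:E)%E <-> slope_bound x C.
Proof.
move=> C0; split; last first.
  move=> xC; have xd := slope_bound_dom xC; rewrite /slope xd.
  apply: le_trans; first by apply: ereal_inf_lbound; exists 1 => //=; exact: ltr01.
  apply: ge_ereal_sup => _ [w /= _ <-].
  have [wd|] := ltP (phi w) +oo%E; last first.
    rewrite leye_eq => /eqP ->; rewrite -(energy_fineK xd) /= (_ : maxe _ _ = 0%E).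
      by rewrite mul0e lee_fin.
    by apply/max_idPl; rewrite leNye.
  rewrite -(energy_fineK xd) -(energy_fineK wd) -EFinB.
  rewrite -EFin_max -EFinM lee_fin.
  have [->|dxw] := eqVneq (d x w) 0; first by rewrite invr0 mulr0.
  have d0 : 0 < d x w by rewrite lt_def dxw (dist_ge0 H).
  rewrite ler_pdivrMr// ge_max (mulr_ge0 C0 (ltW d0))/=.
  by have := slope_bound_fine xC wd; lra.
move=> sC; have xd : Dom x.
  by move: sC; rewrite /slope; case: ifP => // _; rewrite leye_eq.
move=> w b wb; rewrite -(energy_fineK xd) lee_fin leNgt; apply/negP => lt_b.
have [dxw|dxw] := eqVneq (d x w) 0.
  move: lt_b; rewrite dxw mulr0 addr0 ltNge => /negP; apply.
  by rewrite -lee_fin (energy_fineK xd) (dist0_energy dxw).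
have d0 : 0 < d x w by rewrite lt_def dxw (dist_ge0 H).
pose C' := (F x - b) / d x w.
have CC' : C < C' by rewrite /C' ltr_pdivlMr//; lra.
suff : (C'%:E <= slope phi d x)%E.
  by move=> /le_trans/(_ sC); rewrite lee_fin leNgt CC'.
rewrite /slope xd; apply: le_ereal_inf_tmp => _ [r /= r0 <-].
(* The second term places [z] at distance at most [r / 2] from [x], inside the ball. *)
pose th := Num.min (1 / 2) (r / (2 * d x w)).
have th0 : 0 < th by rewrite lt_min; apply/andP; split; [lra|rewrite divr_gt0// mulr_gt0].
have th1 : th <= 1 / 2 by rewrite ge_min lexx.
have thr : th * d x w < r.
  have : th <= r / (2 * d x w) by rewrite ge_min lexx orbT.
  rewrite ler_pdivlMr ?mulr_gt0// mulrCA => thr.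
  by have := mulr_gt0 th0 d0; lra.
have [|z [dz phiz]] := @energy_interp _ _ _ _ H x w th; first lra.
have dxz : d x z = th * d x w.
  apply/eqP; rewrite -(@eqrXn2 _ 2)//; last by rewrite mulr_ge0// ltW.
    by rewrite dz (dist_refl H); apply/eqP; ring.
  exact: dist_ge0 H _ _.
have xle : (phi x <= (F x)%:E)%E by rewrite energy_fineK.
have /energy_fine_le[zd zle] := phiz _ _ xle wb.
apply: le_trans; last first.
  by apply: ereal_sup_ubound; exists z => //=; rewrite dxz.
rewrite -(energy_fineK xd) -(energy_fineK zd) -EFinB -EFin_max -EFinM lee_fin dxz.
rewrite ler_pdivlMr ?mulr_gt0// le_max; apply/orP; right.
have -> : C' * (th * d x w) = th * (F x - b) by rewrite /C'; field.
by lra.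
Qed.

End convex_energy_theory.

(** * Proximal steps and Moreau envelopes *)

Section proximal_steps.
Context {R : realType} {S : Type} (phi : S -> \bar R) (d : S -> S -> R).
Hypothesis H : convex_energy phi d.

Local Notation F x := (fine (phi x)).
Local Notation Dom x := (phi x < +oo)%E.

(** The global form of the bound passes to the limit: for a fixed [w], only the continuous
    [d (x n) w] and the lower semicontinuous [phi (x n)] depend on [n]. *)
Lemma slope_bound_lsc (x : nat -> S) y C :
  d (x n) y @[n --> \oo] --> (0 : R) ->
  (forall n, slope_bound phi d (x n) C) -> slope_bound phi d y C.
Proof.
move=> xy xC w b wb; apply: (energy_lsc_near H xy) => e e0.
have : C * d (x n) w @[n --> \oo] --> C * d y w.
  by apply: cvgM; [exact: cvg_cst|exact: (dist_cvg H xy)].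
move=> /cvgrPdist_le/(_ e e0); apply: filterS => n.
rewrite ler_norml => /andP[ne _].
by apply: le_trans (xC n w b wb) _; rewrite lee_fin; lra.
Qed.

Definition proximal_energy (tau : R) (x u : S) : \bar R :=
  (phi u + (d x u ^+ 2 / (2 * tau))%:E)%E.

Lemma proximal_energy_fine tau x u : Dom u ->
  proximal_energy tau x u = (F u + d x u ^+ 2 / (2 * tau))%:E.
Proof. by move=> ud; rewrite /proximal_energy EFinD (energy_fineK H). Qed.

(* Minimizing sequences are Cauchy, by strict convexity of the squared
   distance. *)
Lemma proximal_minimizer (tau : R) x : 0 < tau ->
  exists u, is_argmin (proximal_energy tau x) u.
Proof.
move=> tau0; pose A := [set F u + d x u ^+ 2 / (2 * tau) | u in [set u | Dom u]].
have A_ge0 : lbound A 0.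
  move=> _ [u _ <-]; apply: addr_ge0; first exact: energy_fine_ge0 H _.
  by rewrite divr_ge0 ?sqr_ge0//; lra.
have infA : has_inf A.
  split; last by exists 0.
  by have [u ud] := energy_dom H; exists (F u + d x u ^+ 2 / (2 * tau)); exists u.
pose j := inf A.
have jle u : Dom u -> j <= F u + d x u ^+ 2 / (2 * tau).
  by move=> ud; apply: ge_inf; [exact: infA.2|exists u].
have /choice[u uP] (n : nat) : exists u, Dom u /\
    F u + d x u ^+ 2 / (2 * tau) < j + n.+1%:R^-1.
  have [_ [u ud <-] uj] := @inf_adherent _ A n.+1%:R^-1 ltac:(by rewrite invr_gt0 ltr0n) infA.
  by exists u.
(* The midpoint has value at least [j], while the identity of [energy_interp] gains
   [d (u n) (u m) ^+ 2 / (8 * tau)] over the mean of two almost minimal values; hence the constant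
   4. *)
have u_near (n m : nat) : d (u n) (u m) ^+ 2 <= 4 * tau * (n.+1%:R^-1 + m.+1%:R^-1).
  have [nd nj] := uP n; have [md mj] := uP m.
  have [|z [dz phiz]] := @energy_interp _ _ _ _ H (u n) (u m) (1 / 2); first lra.
  have nle : (phi (u n) <= (F (u n))%:E)%E by rewrite (energy_fineK H).
  have mle : (phi (u m) <= (F (u m))%:E)%E by rewrite (energy_fineK H).
  have /(energy_fine_le H)[zd zle] := phiz _ _ nle mle.
  have := jle z zd; rewrite dz.
  have c0 : 0 < (2 * tau)^-1 by rewrite invr_gt0; lra.
  have tc : tau * (2 * tau)^-1 = 1 / 2 by field; lra.
  move=> jz; rewrite -(ler_pM2r c0); move: zle nj mj jz.
  move: (2 * tau)^-1 n.+1%:R^-1 m.+1%:R^-1 tc => c a b tc zle nj mj jz.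
  have -> : 4 * tau * (a + b) * c = (tau * c) * 4 * (a + b) by ring.
  by rewrite tc; lra.
have u_le n : (phi (u n) <= (j + 1)%:E)%E.
  have [nd nj] := uP n; rewrite -(energy_fineK H nd) lee_fin.
  have n1 : n.+1%:R^-1 <= 1 :> R by rewrite invf_le1 ?ler1n.
  apply: (@le_trans _ _ (j + n.+1%:R^-1)); last by rewrite lerD2l.
  apply: le_trans (ltW nj); rewrite lerDl divr_ge0 ?sqr_ge0//; lra.
have [|y uy] := @energy_complete _ _ _ _ H u (j + 1) u_le.
  move=> e e0; have e1 : 0 < e ^+ 2 / (8 * tau) by rewrite divr_gt0 ?exprn_gt0//; lra.
  have [N _ Ne] := near_infty_natSinv_lt (PosNum e1).
  exists N => i k Ni Nk; have := u_near i k.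
  have /= := Ne i Ni; have /= := Ne k Nk.
  rewrite !ltr_pdivlMr; try lra.
  move=> h1 h2 h3; rewrite -(ltr_pXn2r (ltn0Sn 1)) ?nnegrE ?(dist_ge0 H) ?(ltW e0)//.
  apply: le_lt_trans h3 _; move: h1 h2.
  by move: (i.+1%:R^-1) (k.+1%:R^-1) => a b; lra.
exists y => v; have [vd|] := ltP (phi v) +oo%E; last first.
  by rewrite leye_eq => /eqP; rewrite /proximal_energy => ->; rewrite addye// leey.
rewrite (proximal_energy_fine _ _ vd).
apply: (@le_trans _ _ j%:E); last by rewrite lee_fin jle.
(* Along the sequence the energy is at most [j] minus the penalty, up to a small term, and the
   penalty converges; moving it to the right leaves a sublevel bound for [phi] alone. *)
suff : (phi y <= (j - d x y ^+ 2 / (2 * tau))%:E)%E.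
  move=> /(energy_fine_le H)[yd]; rewrite proximal_energy_fine// lee_fin; lra.
apply: (energy_lsc_near H uy) => e e0.
have cvd : d x (u n) ^+ 2 / (2 * tau) @[n --> \oo] --> d x y ^+ 2 / (2 * tau).
  apply: cvgM; last exact: cvg_cst.
  rewrite expr2.
  have dxu : d x (u n) @[n --> \oo] --> d x y.
    by under eq_fun do rewrite (dist_sym H x); rewrite (dist_sym H x); exact: (dist_cvg H uy).
  by under eq_fun do rewrite expr2; exact: cvgM.
have e2 : 0 < e / 2 by lra.
have := near_infty_natSinv_lt (PosNum e2).
move: cvd => /cvgrPdist_le/(_ _ e2); apply: filterS2 => n.
rewrite ler_norml => /andP[h1 h2] /= h3.
have [nd nj] := uP n; rewrite -(energy_fineK H nd) lee_fin.
by move: n.+1%:R^-1 h3 nj => a; lra.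
Qed.

Lemma argmin_dom (tau : R) x u : 0 < tau ->
  is_argmin (proximal_energy tau x) u -> Dom u.
Proof.
move=> tau0 um; have [w wd] := energy_dom H.
have := um w; rewrite (proximal_energy_fine _ _ wd) /proximal_energy.
by case: (phi u) => [r|//|//]; rewrite ltry.
Qed.

(* Discrete evolution variational inequality: compare the minimizer [u] with the
   points of the geodesic from [u] to [w] near [u]. *)
Lemma proximal_evi (tau : R) x u w : 0 < tau ->
  is_argmin (proximal_energy tau x) u -> Dom w ->
  d u w ^+ 2 - d x w ^+ 2 + d x u ^+ 2 <= 2 * tau * (F w - F u).
Proof.
move=> tau0 um wd; have ud := argmin_dom tau0 um.
have ule : (phi u <= (F u)%:E)%E by rewrite (energy_fineK H).
have wle : (phi w <= (F w)%:E)%E by rewrite (energy_fineK H).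
have key th : 0 < th <= 1 ->
    d u w ^+ 2 - d x w ^+ 2 + d x u ^+ 2 - 2 * tau * (F w - F u) <=
    th * d u w ^+ 2.
  move=> th01; have [|z [dz phiz]] := @energy_interp _ _ _ _ H u w th; first lra.
  have /(energy_fine_le H)[zd zle] := phiz _ _ ule wle.
  have := um z; rewrite !proximal_energy_fine// lee_fin dz => uz.
  have : (F u - F z) * (2 * tau) <=
      (1 - th) * d x u ^+ 2 + th * d x w ^+ 2 - th * (1 - th) * d u w ^+ 2 -
      d x u ^+ 2.
    by rewrite -ler_pdivlMr; [rewrite mulrBl; lra|lra].
  have : (th * (F u - F w)) * (2 * tau) <= (F u - F z) * (2 * tau).
    by rewrite ler_pM2r; lra.
  move=> h1 h2; rewrite -(ler_pM2l (_ : 0 < th)); last lra.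
  by move: (le_trans h1 h2); lra.
apply/ler_addgt0Pr => e e0.
have [d0|d0] := eqVneq (d u w) 0.
  by have := key 1; rewrite d0 expr0n/= => /(_ ltac:(lra)); lra.
have du0 : 0 < d u w ^+ 2 by rewrite exprn_gt0// lt_def d0 (dist_ge0 H).
pose th := Num.min 1 (e / d u w ^+ 2).
have th0 : 0 < th by rewrite lt_min ltr01 divr_gt0.
have th1 : th <= 1 by rewrite ge_min lexx.
have : th * d u w ^+ 2 <= e by rewrite -ler_pdivlMr// ge_min lexx orbT.
by have := key th ltac:(lra); lra.
Qed.

(** The variational inequality at [w = x] counts [d x u ^+ 2] twice, which improves by a factor 2 on
    plain minimality. This factor is what lets the slopes decrease along a scheme. *)
Lemma proximal_descent (tau : R) x u : 0 < tau ->
  is_argmin (proximal_energy tau x) u -> Dom x ->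
  d x u ^+ 2 <= tau * (F x - F u).
Proof.
move=> tau0 um xd; have := proximal_evi tau0 um xd.
by rewrite (dist_refl H) (dist_sym H u x); lra.
Qed.

(** Expanding [(d x u + d u w) ^+ 2] in the variational inequality cancels the squares and leaves
    the cross term. On a Hilbert space this says that [(x - u) / tau] is a subgradient at [u]. *)
Lemma proximal_slope_bound (tau : R) x u : 0 < tau ->
  is_argmin (proximal_energy tau x) u -> slope_bound phi d u (d x u / tau).
Proof.
move=> tau0 um w b wb; have ud := argmin_dom tau0 um.
have [wd wF] := energy_fine_le H wb; rewrite -(energy_fineK H ud) lee_fin.
have := proximal_evi tau0 um wd.
have tri : d x w <= d x u + d u w := dist_triangle H x u w.
have xw0 := dist_ge0 H x w.
have : d x w ^+ 2 <= (d x u + d u w) ^+ 2 by rewrite lerXn2r// nnegrE; lra.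
move=> h1 h2.
have : F u - F w <= d x u * d u w / tau.
  by rewrite ler_pdivlMr//; lra.
by rewrite mulrAC; lra.
Qed.

(** By descent [d x u ^+ 2 <= tau * (F x - F u)], and the drop is at most [C * d x u]. With
    [proximal_slope_bound], a slope bound is not worsened by a proximal step. *)
Lemma proximal_dist_slope (tau : R) x u C : 0 < tau ->
  is_argmin (proximal_energy tau x) u -> 0 <= C -> slope_bound phi d x C ->
  d x u / tau <= C.
Proof.
move=> tau0 um C0 xC; have xd := slope_bound_dom H xC.
have ud := argmin_dom tau0 um.
have := proximal_descent tau0 um xd; have := slope_bound_fine H xC ud.
have := dist_ge0 H x u; rewrite le_eqVlt => /predU1P[<-|d0] h1 h2.
  by rewrite mul0r.
rewrite ler_pdivrMr// -(ler_pM2r d0) -expr2 (le_trans h2)//.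
by rewrite -mulrA [leRHS]mulrCA ler_pM2l//; lra.
Qed.

End proximal_steps.

Section moreau_envelope.
Context {R : realType} {S : Type} (phi : S -> \bar R) (d : S -> S -> R).
Hypothesis H : convex_energy phi d.
Local Notation mu := (@lebesgue_measure R).
Local Notation F x := (fine (phi x)).
Local Notation Dom x := (phi x < +oo)%E.

Lemma proximal_dist_le_slope (tau : R) x u : 0 < tau ->
  is_argmin (proximal_energy phi d tau x) u ->
  ((d x u / tau)%:E <= slope phi d x)%E.
Proof.
move=> tau0 um; have := slope_ge0 H x.
case sE : (slope phi d x) => [r| |]; rewrite ?leey// !lee_fin => r0.
apply: (proximal_dist_slope H tau0 um r0).
by apply/(slope_leP H _ r0); rewrite sE.
Qed.

Section fixed_time_step.
Variables (tau : R) (J : S -> S).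
Hypothesis tau_gt0 : 0 < tau.
Hypothesis J_argmin : forall x, is_argmin (proximal_energy phi d tau x) (J x).

Let tau2_gt0 : 0 < 2 * tau. Proof. by rewrite mulr_gt0. Qed.

Let tau2V_gt0 : 0 < (2 * tau)^-1. Proof. by rewrite invr_gt0. Qed.

Let tauV : tau^-1 = 2 * (2 * tau)^-1.
Proof. by rewrite invfM mulrA divff ?mul1r. Qed.

Definition moreau x := F (J x) + d x (J x) ^+ 2 / (2 * tau).

Lemma moreau_le x w : Dom w -> moreau x <= F w + d x w ^+ 2 / (2 * tau).
Proof.
move=> wd; have := J_argmin x w.
have Jd := argmin_dom H tau_gt0 (J_argmin x).
by rewrite (proximal_energy_fine H _ _ wd) (proximal_energy_fine H _ _ Jd) lee_fin.
Qed.

(** [J y] is tried as a competitor at [x]. The first order coefficient [d y (J y) / tau] is at most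
    the slope at [y]; the second order term disappears on differentiation. *)
Lemma moreauB x y :
  moreau x - moreau y <= d x y * (d y (J y) / tau + d x y / (2 * tau)).
Proof.
have yd : Dom (J y) by exact: (argmin_dom H tau_gt0 (J_argmin y)).
have := moreau_le x yd; rewrite [moreau y]/moreau.
have tri : d x (J y) <= d x y + d y (J y) := dist_triangle H _ _ _.
have : d x (J y) ^+ 2 <= (d x y + d y (J y)) ^+ 2.
  by rewrite lerXn2r ?nnegrE ?addr_ge0 ?(dist_ge0 H).
rewrite -(ler_pM2r tau2V_gt0).
rewrite tauV.
by move: (2 * tau)^-1 => c; lra.
Qed.

(** A crude bound on the displacement, which makes the envelope Lipschitz on bounded sets. *)
Lemma moreau_dist x y : Dom y ->
  d x (J x) ^+ 2 <= 2 * tau * F y + d x y ^+ 2.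
Proof.
move=> yd; have h1 := moreau_le x yd; have h2 := energy_fine_ge0 H (J x).
have tc : tau * (2 * tau)^-1 = 1 / 2 by field; rewrite gt_eqF.
move: h1; rewrite /moreau -[in X in _ -> X](ler_pM2r tau2V_gt0).
have -> : (2 * tau * F y + d x y ^+ 2) * (2 * tau)^-1 =
  2 * (tau * (2 * tau)^-1) * F y + d x y ^+ 2 * (2 * tau)^-1 by ring.
by rewrite tc; lra.
Qed.

Section along_curve.
Variables (w : R -> S) (m : R -> R).
Hypotheses (im : mu.-integrable setT (EFin \o m)) (m0 : forall x, 0 <= m x).
Hypothesis w_ac : forall s t, s <= t ->
  d (w s) (w t) <= \int[mu]_(x in `]s, t]) m x.

(** The curve has a bounded image, on which the envelope is finite and Lipschitz, so a density
    exists even where the energy is infinite. Its bound comes from dividing [moreauB] by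
    [|s - t|]. *)
Lemma moreau_curve_density : exists p : R -> R,
  [/\ mu.-integrable setT (EFin \o p),
      forall s t, s <= t ->
        moreau (w t) - moreau (w s) = \int[mu]_(x in `]s, t]) p x &
      {ae mu, forall t : R, (`|p t|%:E <=
        slope phi d (w t) * (metric_derivative d w t)%:E)%E}].
Proof.
pose B := \int[mu]_x m x.
have intle s t : \int[mu]_(x in `]s, t]) m x <= B.
  apply: fine_le.
  - by apply: integrable_fin_num => //; exact: integrableS im.
  - exact: integrable_fin_num.
  apply: ge0_subset_integral => //; first exact: measurable_int im.
  by move=> x _ /=; rewrite lee_fin.
have wB s t : d (w s) (w t) <= B.
  have [st|/ltW ts] := leP s t; first exact: le_trans (w_ac st) _.
  by rewrite (dist_sym H); exact: le_trans (w_ac ts) _.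
have [y yd] := energy_dom H.
pose L := d (w 0) y + B.
(* The leading 1 absorbs [d <= d ^+ 2 + 1 / 4], since [moreau_dist] bounds the square. *)
pose K := (1 + (2 * tau * F y + L ^+ 2)) / tau + B / (2 * tau).
have DK s t : d (w t) (J (w t)) / tau + d (w s) (w t) / (2 * tau) <= K.
  apply: lerD; last by rewrite ler_pM2r ?wB.
  rewrite ler_pM2r ?invr_gt0//.
  have dL : d (w t) y <= L.
    have := dist_triangle H (w t) (w 0) y; have := wB t 0; rewrite /L; lra.
  have dL2 : d (w t) y ^+ 2 <= L ^+ 2.
    by rewrite lerXn2r ?nnegrE ?(dist_ge0 H)// (le_trans _ dL) ?(dist_ge0 H).
  have := moreau_dist (w t) yd.
  have := sqr_ge0 (d (w t) (J (w t)) - 1 / 2).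
  by rewrite sqrrB; lra.
have K0 : 0 <= K by apply: le_trans (DK 0 0); rewrite addr_ge0// divr_ge0 ?(dist_ge0 H)// ltW.
have iKm : mu.-integrable setT (EFin \o (fun x => K * m x)).
  by have := integrableZl measurableT K im.
have [|s t st|p [ip pE]] := @majorized_density R (fun x => K * m x) iKm _ (moreau \o w).
- by move=> x; rewrite mulr_ge0.
- rewrite RintegralZl//; last exact: integrableS im.
  apply: le_trans (ler_wpM2l K0 (w_ac st)).
  rewrite ler_norml; apply/andP; split.
    rewrite lerNl opprB; apply: le_trans (moreauB _ _) _.
    by rewrite mulrC ler_wpM2r ?(dist_ge0 H)// DK.
  apply: le_trans (moreauB _ _) _.
  by rewrite mulrC (dist_sym H (w s) (w t)) ler_wpM2r ?(dist_ge0 H)// DK.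
exists p; split => //.
have [M [M0 Mcvg]] := metric_derivative_ae (dist_sym H) (dist_triangle H) im m0 w_ac.
move: Mcvg (primitive_derive_ae ip pE).
apply: filterS2 => [|t Mt dp]; first exact: (ae_filter_ringOfSetsType mu).
have -> : metric_derivative d w t = M t by exact: cvg_lim.
apply: (@le_trans _ _ (d (w t) (J (w t)) / tau * M t)%:E); last first.
  rewrite EFinM; apply: lee_wpmul2r; first by rewrite lee_fin.
  exact: proximal_dist_le_slope.
rewrite lee_fin.
pose q s := metric_quotient d w t s.
pose u s := q s * (d (w t) (J (w t)) / tau + q s * `|s - t| / (2 * tau)).
have ucvg : u s @[s --> t^'] --> d (w t) (J (w t)) / tau * M t.
  rewrite mulrC -[X in _ * X]addr0; apply: cvgM => //.
  apply: cvgD; first exact: cvg_cst.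
  rewrite -[X in _ --> X](_ : M t * `|t - t| / (2 * tau) = 0); last first.
    by rewrite subrr normr0 mulr0 mul0r.
  apply: cvgM; last exact: cvg_cst.
  apply: cvgM => //; apply: cvg_norm; apply: cvgB; last exact: cvg_cst.
  exact: cvg_within.
have qd s : s != t -> q s * `|s - t| = d (w s) (w t).
  by move=> st; rewrite /q /metric_quotient divfK// normr_eq0 subr_eq0.
have up s : s != t -> (moreau (w s) - moreau (w t)) / `|s - t| <= u s.
  move=> st; rewrite ler_pdivrMr ?normr_gt0 ?subr_eq0//.
  by apply: le_trans (moreauB _ _) _; rewrite /u qd// mulrAC qd.
(* [up] bounds the increments from [w t] from above, with [J] evaluated at the fixed point [w t]:
   the left limit then bounds [- p t] and the right limit bounds [p t]. *)
have pq := is_derive_quotient dp.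
rewrite ler_norml; apply/andP; split.
  rewrite lerNl.
  apply: (ler_cvg_to (cvgN (cvg_dnbhs_at_left pq)) (cvg_dnbhs_at_left ucvg)).
  rewrite near_withinE; apply: nearW => s /= st.
  apply: le_trans (up _ (negbT (lt_eqF st))) => /=.
  rewrite ltr0_norm ?subr_lt0// invrN mulrN//.
apply: (ler_cvg_to (cvg_dnbhs_at_right pq) (cvg_dnbhs_at_right ucvg)).
rewrite near_withinE; apply: nearW => s /= ts.
apply: le_trans (up _ (negbT (gt_eqF ts))) => /=.
by rewrite gtr0_norm ?subr_gt0.
Qed.

End along_curve.

End fixed_time_step.

End moreau_envelope.

(** * The slope is a strong upper gradient *)

Section upper_gradient.
Context {R : realType} {S : Type} (phi : S -> \bar R) (d : S -> S -> R).
Hypothesis H : convex_energy phi d.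
Local Notation mu := (@lebesgue_measure R).
Local Notation F x := (fine (phi x)).
Local Notation Dom x := (phi x < +oo)%E.

(** Envelopes bounded by [c] force [d x (u n) ^+ 2 <= 2 * c / (n + 1)] for the steps [1 / (n + 1)].
    The proximal points converge to [x] inside the sublevel [c], and lower semicontinuity
    applies. *)
Lemma moreau_lim x (c : R) :
  (forall tau u, 0 < tau -> is_argmin (proximal_energy phi d tau x) u ->
    F u + d x u ^+ 2 / (2 * tau) <= c) -> (phi x <= c%:E)%E.
Proof.
move=> xc.
have tau0 (n : nat) : 0 < n.+1%:R^-1 :> R by rewrite invr_gt0.
have [u um] := choice (fun n => proximal_minimizer H x (tau0 n)).
have ud n : Dom (u n) := argmin_dom H (tau0 n) (um n).
have d2_ge0 n : 0 <= d x (u n) ^+ 2 / (2 * n.+1%:R^-1).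
  by rewrite divr_ge0 ?sqr_ge0// mulr_ge0.
apply: (@energy_lsc _ _ _ _ H u) => [n|].
  rewrite -(energy_fineK H (ud n)) lee_fin; apply: le_trans (xc _ _ (tau0 n) (um n)).
  by rewrite lerDl.
have c0 : 0 <= c.
  by apply: le_trans (xc _ _ (tau0 0%N) (um 0%N)); rewrite addr_ge0// (energy_fine_ge0 H).
apply/cvgrPdist_lt => e e0.
have e1 : 0 < e ^+ 2 / (2 * c + 1) by rewrite divr_gt0 ?exprn_gt0//; lra.
have := near_infty_natSinv_lt (PosNum e1); apply: filterS => n /=.
rewrite ltr_pdivlMr; last lra.
move=> ne; rewrite sub0r normrN ger0_norm ?(dist_ge0 H)//.
rewrite -(ltr_pXn2r (ltn0Sn 1)) ?nnegrE ?(dist_ge0 H) ?(ltW e0)//.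
apply: le_lt_trans ne; rewrite (dist_sym H).
have := xc _ _ (tau0 n) (um n); have := energy_fine_ge0 H (u n).
move=> h1 h2.
have : d x (u n) ^+ 2 / (2 * n.+1%:R^-1) <= c by lra.
rewrite ler_pdivrMr ?mulr_gt0// => /le_trans; apply.
by rewrite mulrCA (mulrC c) mulrA (mulrC 2) -mulrA mulrDr mulr1 lerDl ltW.
Qed.

Lemma metric_derivative_ge0 (v : R -> S) t : 0 <= metric_derivative d v t.
Proof.
rewrite /metric_derivative; have [vt|/dvgP ->] := pselect (metric_derivable d v t); last first.
  exact: lexx.
apply: (cvgr_to_ge vt); apply: nearW => s.
by rewrite divr_ge0 ?(dist_ge0 H).
Qed.

(** All envelopes obey the estimate with the same [r]. At an end of finite energy the envelope is at
    most the energy, and at the other end [tau] tends to 0, so finiteness is propagated too. The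
    bound by [h] is asked on the open interval, where a clamped curve keeps its metric
    derivative. *)
Lemma ac_curve_energy_le (w : R -> S) (m : R -> R) (h : R -> \bar R) (t0 t1 r : R) :
  mu.-integrable setT (EFin \o m) -> (forall x, 0 <= m x) ->
  (forall s t, s <= t -> d (w s) (w t) <= \int[mu]_(x in `]s, t]) m x) ->
  t0 <= t1 -> (forall s, (0 <= h s)%E) ->
  {ae mu, forall t : R, `]t0, t1[%classic t ->
    (slope phi d (w t) * (metric_derivative d w t)%:E <= h t)%E} ->
  (\int[mu]_(s in `[t0, t1]) h s <= r%:E)%E ->
  (Dom (w t1) -> (phi (w t0) <= (F (w t1) + r)%:E)%E) /\
  (Dom (w t0) -> (phi (w t1) <= (F (w t0) + r)%:E)%E).
Proof.
move=> im m0 w_ac t01 h0 slope_h hr.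
have key tau J : 0 < tau ->
    (forall x, is_argmin (proximal_energy phi d tau x) (J x)) ->
    `|moreau phi d tau J (w t1) - moreau phi d tau J (w t0)| <= r.
  move=> tau0 JP.
  have [p [ip pE ph]] := moreau_curve_density H tau0 JP im m0 w_ac.
  have ip01 : mu.-integrable `]t0, t1] (EFin \o p) by exact: integrableS ip.
  have ip01c : mu.-integrable `[t0, t1] (EFin \o p) by exact: integrableS ip.
  rewrite pE// -lee_fin; apply: le_trans hr.
  apply: (@le_trans _ _ (\int[mu]_(x in `]t0, t1]) `|p x|)%:E).
    by rewrite lee_fin; exact: le_normr_Rintegral.
  have iabs : mu.-integrable `]t0, t1] (EFin \o (fun x => `|p x|)).
    exact: integrable_norm ip01.
  rewrite Rintegral_itv_obnd_cbnd//.
  rewrite /Rintegral fineK; last first.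
    by apply: integrable_fin_num => //; exact: integrable_norm ip01c.
  apply: ge0_le_integral_nonmeasurable => //.
  - exact: measurable_int (integrable_norm ip01c).
  have tt (t : R) : {ae mu, forall s : R, s != t}.
    exists [set t]; split => //; first exact: lebesgue_measure_set1.
    by move=> s /= /negP; rewrite negbK => /eqP.
  have ends : {ae mu, forall s : R, s != t0 /\ s != t1}.
    move: (tt t0) (tt t1); apply: filterS2 => //.
    exact: (ae_filter_ringOfSetsType mu).
  move: ph slope_h ends.
  apply: filterS3 => [|s ps hs [st0 st1]]; first exact: (ae_filter_ringOfSetsType mu).
  rewrite /= in_itv/= => /andP[t0s st1'].
  apply: le_trans (ps) (hs _).
  by rewrite /= in_itv/= !lt_neqAle st1 t0s st1' eq_sym st0.
have [J JP] : exists J : R -> S -> S, forall tau, 0 < tau -> forall x,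
    is_argmin (proximal_energy phi d tau x) (J tau x).
  have /choice[J JP] (tau : R) : exists J : S -> S, 0 < tau -> forall x,
      is_argmin (proximal_energy phi d tau x) (J x).
    have [tau0|tau0] := ltP 0 tau; last by exists id.
    by have [J JP] := choice (fun x => proximal_minimizer H x tau0); exists J.
  by exists J.
have end_le x y : Dom y -> (forall tau, 0 < tau ->
    moreau phi d tau (J tau) x <= moreau phi d tau (J tau) y + r) ->
    (phi x <= (F y + r)%:E)%E.
  move=> yd xy; apply: moreau_lim => tau u tau0 um.
  have := xy _ tau0; have := moreau_le H tau0 (JP _ tau0) y yd.
  rewrite (dist_refl H) expr0n mul0r addr0 => yF xr.
  apply: le_trans (le_trans xr _); last by rewrite lerD2r.
  have ud := argmin_dom H tau0 um; have := um (J tau x).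
  have Jd := argmin_dom H tau0 (JP _ tau0 x).
  by rewrite (proximal_energy_fine H _ _ ud) (proximal_energy_fine H _ _ Jd) lee_fin.
split=> wd; apply: end_le => // tau tau0; have := key _ _ tau0 (JP _ tau0);
  by rewrite ler_norml; lra.
Qed.

Lemma open_eitv_oo (a b : \bar R) : open (eitv_oo a b).
Proof.
have -> : eitv_oo a b = [set t | (a < t%:E)%E] `&` [set t | (t%:E < b)%E].
  by apply/seteqP; split=> t /=; move/andP.
apply: openI; [exact: open_ereal_gt|exact: open_ereal_lt].
Qed.

Lemma eitv_oo_itv (a b : \bar R) s t x :
  eitv_oo a b s -> eitv_oo a b t -> s <= x <= t -> eitv_oo a b x.
Proof.
move=> /andP[as_ sb] /andP[at_ tb] /andP[sx xt]; apply/andP; split.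
  by apply: lt_le_trans as_ _; rewrite lee_fin.
by apply: le_lt_trans tb; rewrite lee_fin.
Qed.

Lemma measurable_eitv_oo (a b : \bar R) :
  measurable (eitv_oo a b : set (measurableTypeR R)).
Proof. by apply: open_measurable; exact: open_eitv_oo. Qed.

Lemma ac_curve_majorant (a b : \bar R) (v : R -> S) :
  absolutely_continuous_curve d a b v ->
  exists m : R -> R, [/\ mu.-integrable setT (EFin \o m), forall x, 0 <= m x &
    forall s t, eitv_oo a b s -> eitv_oo a b t -> s <= t ->
      d (v s) (v t) <= \int[mu]_(x in `]s, t]) m x].
Proof.
move=> [m im vm]; pose D := eitv_oo a b.
have mD : measurable (D : set (measurableTypeR R)) := measurable_eitv_oo a b.
pose m' := (fun x => `|m x|) \_ D.
have im' : mu.-integrable setT (EFin \o m').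
  rewrite /m' -restrict_EFin; apply/integrable_restrict => //=.
  by rewrite setTI; exact: integrable_norm im.
exists m'; split => //.
  by move=> x; rewrite /m' patchE; case: ifP.
move=> s t Ds Dt st; rewrite -lee_fin; apply: le_trans (vm _ _ Ds Dt st) _.
have sub : `[s, t] `<=` D.
  by move=> x /=; rewrite in_itv/=; exact: eitv_oo_itv.
have i1 : mu.-integrable `[s, t] (EFin \o m) by exact: integrableS im.
have i2 : mu.-integrable `[s, t] (EFin \o m') by exact: integrableS im'.
rewrite Rintegral_itv_obnd_cbnd; last exact: integrableS im'.
rewrite /Rintegral fineK; last exact: integrable_fin_num.
apply: le_integral => // x xst; rewrite lee_fin /m' patchE ifT ?ler_norm//.
by rewrite inE; apply: sub; rewrite inE in xst.
Qed.

(** Composing with it freezes a curve outside [[t0, t1]]. A control on an interval becomes one on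
    the whole line, where the results on densities and metric derivatives are stated. *)
Definition clamp (t0 t1 t : R) : R := Num.max t0 (Num.min t t1).

Lemma clamp_ac (v : R -> S) (m : R -> R) (t0 t1 : R) :
  mu.-integrable setT (EFin \o m) -> (forall x, 0 <= m x) ->
  (forall s t, t0 <= s -> s <= t -> t <= t1 ->
      d (v s) (v t) <= \int[mu]_(x in `]s, t]) m x) ->
  t0 <= t1 ->
  forall s t, s <= t ->
    d (v (clamp t0 t1 s)) (v (clamp t0 t1 t)) <= \int[mu]_(x in `]s, t]) m x.
Proof.
move=> im m0 vm t01 s t st.
have cs : t0 <= clamp t0 t1 s <= t1 by rewrite /clamp le_max lexx ge_max t01 ge_min lexx orbT.
have ct : t0 <= clamp t0 t1 t <= t1 by rewrite /clamp le_max lexx ge_max t01 ge_min lexx orbT.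
have cst : clamp t0 t1 s <= clamp t0 t1 t.
  by rewrite /clamp ge_max !le_max lexx/= le_min !ge_min st lexx !orbT.
case/andP : cs => cs1 cs2; case/andP : ct => ct1 ct2.
apply: le_trans (vm _ _ cs1 cst ct2) _.
apply: fine_le.
- by apply: integrable_fin_num => //; exact: integrableS im.
- by apply: integrable_fin_num => //; exact: integrableS im.
apply: ge0_subset_integral => //.
- by apply: measurable_funTS; exact: measurable_int im.
- by move=> x _ /=; rewrite lee_fin.
move=> x /=; rewrite !in_itv/= /clamp => /andP[].
rewrite gt_max le_max => /andP[t0x]; rewrite gt_min => sx xt.
have t0x' : (x <= t0) = false by apply/negbTE; rewrite -ltNge.
rewrite t0x'/= le_min in xt; case/andP : xt => xt xt1.
by rewrite xt andbT; case/orP : sx => //; rewrite ltNge xt1.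
Qed.

Lemma clamp_id (t0 t1 t : R) : t0 <= t <= t1 -> clamp t0 t1 t = t.
Proof. by move=> /andP[h1 h2]; rewrite /clamp min_l// max_r. Qed.

(** An equality of image filters, so that existence and value of the limit transfer together. *)
Lemma metric_derivative_clamp (v : R -> S) (t0 t1 t : R) : t0 < t < t1 ->
  metric_quotient d (v \o clamp t0 t1) t s @[s --> t^'] =
  metric_quotient d v t s @[s --> t^'].
Proof.
move=> /andP[t0t tt1].
have tt : t0 <= t <= t1 by rewrite !ltW.
have eq_near : {near t^', metric_quotient d (v \o clamp t0 t1) t =1
    metric_quotient d v t}.
  have : \forall s \near t^', s \in `]t0, t1[.
    by apply: nbhs_dnbhs; apply: near_in_itvoo; rewrite in_itv/= t0t.
  apply: filterS => s; rewrite in_itv/= => /andP[t0s st1].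
  by rewrite /metric_quotient /= !clamp_id// !ltW.
apply/seteqP; split; apply: near_eq_cvg => //.
by apply: filterS eq_near => s ->.
Qed.

(** The curve is continuous and the slope lower semicontinuous by [slope_bound_lsc], so the times
    where the slope exceeds some [c >= 0] form an open set; for [c < 0] they fill the interval. *)
Lemma slope_curve_measurable (a b : \bar R) (v : R -> S) :
  absolutely_continuous_curve d a b v ->
  measurable_fun (eitv_oo a b : set (measurableTypeR R)) (slope phi d \o v).
Proof.
move=> /ac_curve_majorant[m [im m0 vm]].
pose D := eitv_oo a b.
have vcont t : D t -> d (v s) (v t) @[s --> t] --> (0 : R).
  move=> Dt; have t1 : t - 1 < t + 1 by lra.
  have it : mu.-integrable `[t - 1, t + 1] (EFin \o m) by exact: integrableS im.
  have [cI _ _] := (continuous_within_itvP _ t1).1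
    (parameterized_integral_continuous (ltW t1) it).
  have tin : t \in `]t - 1, t + 1[ by rewrite in_itv/=; lra.
  apply/cvgrPdist_lt => e e0.
  have /cvgrPdist_lt/(_ e e0) := cI t tin.
  have Dnear : \forall s \near t, D s.
    by apply: open_nbhs_nbhs; split => //; exact: open_eitv_oo.
  move: Dnear (near_in_itvoo tin); apply: filterS3 => s Ds.
  rewrite in_itv/= => /andP[s1 s2] st.
  rewrite sub0r normrN ger0_norm ?(dist_ge0 H)//; apply: le_lt_trans st.
  have IB x y : t - 1 <= x -> x <= y -> y <= t + 1 ->
      parameterized_integral mu (t - 1) y m - parameterized_integral mu (t - 1) x m =
      \int[mu]_(z in `]x, y]) m z.
    move=> tx xy yt; rewrite /parameterized_integral Rintegral_itvB ?bnd_simp//.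
    exact: integrableS im.
  have [st|/ltW ts] := leP s t.
    apply: le_trans (vm _ _ Ds Dt st) _.
    by rewrite -IB//; [exact: ler_norm|exact: ltW|lra].
  rewrite (dist_sym H) distrC; apply: le_trans (vm _ _ Dt Ds ts) _.
  by rewrite -IB//; [exact: ler_norm|lra|exact: ltW].
have mD : measurable (D : set (measurableTypeR R)) := measurable_eitv_oo a b.
apply: (@measurability _ _ _ _ _ _ _ (ErealGenOInfty.measurableE R)) => _ [_ [c ->] <-].
have [c0|c0] := ltP c 0.
  rewrite (_ : _ `&` _ = D)//; apply/seteqP; split=> [t []//|t Dt]; split => //=.
  by rewrite in_itv/= andbT (lt_le_trans _ (slope_ge0 H _))// lte_fin.
apply: open_measurable; rewrite openE => t [Dt /=]; rewrite in_itv/= andbT => ct.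
have Dnear : \forall s \near t, D s by apply: open_nbhs_nbhs; split => //; exact: open_eitv_oo.
rewrite /interior; apply: contrapT => not_near.
have /choice[s sP] (n : nat) : exists s, [/\ D s, d (v s) (v t) < n.+1%:R^-1 &
    (slope phi d (v s) <= c%:E)%E].
  have n0 : 0 < n.+1%:R^-1 :> R by rewrite invr_gt0.
  apply: contrapT => nos; apply: not_near.
  have /cvgrPdist_lt/(_ _ n0) := vcont _ Dt; move: Dnear.
  apply: filterS2 => s Ds; rewrite sub0r normrN ger0_norm ?(dist_ge0 H)// => sn.
  split => //=; rewrite in_itv/= andbT ltNge; apply/negP => sc.
  by apply: nos; exists s.
have : slope_bound phi d (v t) c.
  apply: (slope_bound_lsc H (x := fun n => v (s n))) => [|n]; last first.
    by have [_ _ /(slope_leP H _ c0)] := sP n.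
  apply/cvgrPdist_lt => e e0.
  have := near_infty_natSinv_lt (PosNum e0); apply: filterS => n /=.
  rewrite sub0r normrN ger0_norm ?(dist_ge0 H)//.
  by apply: lt_trans; have [] := sP n.
by move/(slope_leP H _ c0); rewrite leNgt ct.
Qed.

Lemma slope_strong_upper_gradient : strong_upper_gradient phi d (slope phi d).
Proof.
split=> [x|a b v vac]; first exact: slope_ge0 H x.
split=> [|t0 t1 Dt0 Dt1 t01 dom01]; first exact: slope_curve_measurable.
have [m [im m0 vm]] := ac_curve_majorant vac.
pose h s := (slope phi d (v s) * (metric_derivative d v s)%:E)%E.
have h0 s : (0 <= h s)%E.
  by rewrite mule_ge0 ?(slope_ge0 H)// lee_fin metric_derivative_ge0.
have : (0 <= \int[mu]_(s in `[t0, t1]) h s)%E by exact: integral_ge0.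
case hE : (\int[mu]_(s in `[t0, t1]) h s)%E => [r| |] // _; last exact: leey.
have w_ac : forall s t, s <= t ->
    d (v (clamp t0 t1 s)) (v (clamp t0 t1 t)) <= \int[mu]_(x in `]s, t]) m x.
  apply: clamp_ac => // s t t0s st tt1.
  by apply: vm => //; apply: (eitv_oo_itv Dt0 Dt1); [rewrite t0s (le_trans st)|
    rewrite (le_trans t0s)].
have [||h1 h2] := @ac_curve_energy_le (v \o clamp t0 t1) m h t0 t1 r im m0 w_ac t01 h0.
- apply: aeW => t /=; rewrite in_itv/= => tt.
  rewrite /h /metric_derivative metric_derivative_clamp//= clamp_id//.
  by case/andP : tt => *; rewrite !ltW.
- by rewrite hE.
have c0 : clamp t0 t1 t0 = t0 by rewrite clamp_id// lexx.
have c1 : clamp t0 t1 t1 = t1 by rewrite clamp_id// lexx t01.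
rewrite /= c0 c1 in h1 h2.
have [d0 d1] : Dom (v t0) /\ Dom (v t1).
  case: dom01 => dd; split => //; [have := h2 dd|have := h1 dd] => /le_lt_trans; apply; exact: ltry.
have /(energy_fine_le H)[_ {}h1] := h1 d1; have /(energy_fine_le H)[_ {}h2] := h2 d0.
rewrite -(energy_fineK H d0) -(energy_fineK H d1) -EFinB abse_EFin lee_fin ler_norml.
by apply/andP; split; lra.
Qed.

End upper_gradient.

(** * Convergence of the schemes *)

Section discrete_solutions.
Context {R : realType} {S : Type} (phi : S -> \bar R) (d : S -> S -> R).
Hypothesis H : convex_energy phi d.
Local Notation F x := (fine (phi x)).
Local Notation Dom x := (phi x < +oo)%E.

Definition proximal_sequence (tau : nat -> R) (U : nat -> S) : Prop :=
  Dom (U 0%N) /\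
  forall k, is_argmin (proximal_energy phi d (tau k) (U k)) (U k.+1).

Section one_sequence.
Variables (tau : nat -> R) (U : nat -> S).
Hypotheses (tau_gt0 : forall k, 0 < tau k) (HU : proximal_sequence tau U).
Local Notation T := (series tau).

Lemma proximal_sequence_dom k : Dom (U k).
Proof.
case: HU => U0 Us; case: k => [//|k].
exact: (argmin_dom H (tau_gt0 k) (Us k)).
Qed.

Lemma proximal_sequence_evi k w : Dom w ->
  d (U k.+1) w ^+ 2 - d (U k) w ^+ 2 + d (U k) (U k.+1) ^+ 2 <=
  2 * tau k * (F w - F (U k.+1)).
Proof. by case: HU => _ Us; exact: (proximal_evi H (tau_gt0 k) (Us k)). Qed.

Lemma proximal_sequence_descent k :
  d (U k) (U k.+1) ^+ 2 <= tau k * (F (U k) - F (U k.+1)).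
Proof.
case: HU => _ Us; apply: (proximal_descent H (tau_gt0 k) (Us k)).
exact: proximal_sequence_dom.
Qed.

Lemma proximal_sequence_decr k : F (U k.+1) <= F (U k).
Proof.
rewrite -subr_ge0 -(pmulr_rge0 _ (tau_gt0 k)).
by apply: le_trans (proximal_sequence_descent k); exact: sqr_ge0.
Qed.

Lemma proximal_sequence_le0 k : F (U k) <= F (U 0%N).
Proof. by elim: k => // k; exact: le_trans (proximal_sequence_decr k). Qed.

Lemma series_ge0 k : 0 <= T k.
Proof. by rewrite /series/=; apply: sumr_ge0 => i _; exact: ltW. Qed.

Lemma series_homo i k : (i <= k)%N -> T i <= T k.
Proof.
move=> /subnKC <-; elim: (k - i)%N => [|l IH]; first by rewrite addn0.
by rewrite addnS seriesSr (le_trans IH)// lerDl ltW.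
Qed.

(** As the energy decreases along the scheme, every intermediate energy may be replaced by the final
    one, and the distances telescope. *)
Lemma proximal_sequence_evi_sum i k w : Dom w -> (i <= k)%N ->
  d (U k) w ^+ 2 - d (U i) w ^+ 2 <= 2 * (T k - T i) * (F w - F (U k)).
Proof.
move=> wd /subnKC <-; elim: (k - i)%N => [|l IH].
  by rewrite addn0 !subrr mulr0 mul0r.
rewrite addnS seriesSr.
have := proximal_sequence_evi (i + l) wd; have := proximal_sequence_decr (i + l).
have := sqr_ge0 (d (U (i + l)%N) (U (i + l).+1)).
have : T i <= T (i + l)%N by apply: series_homo; rewrite leq_addr.
move: IH; move: (T i) (T (i + l)%N) => a b h1 h2 h3 h4 h5.
have : (b - a) * (F w - F (U (i + l)%N)) <= (b - a) * (F w - F (U (i + l).+1)).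
  by apply: ler_wpM2l; [rewrite subr_ge0|rewrite lerD2l lerN2].
move: h1 h3 h5; move: (F w) (F (U (i + l)%N)) (F (U (i + l).+1)) => p q r.
by move: (tau _) => t; lra.
Qed.

(* The discrete slopes [d (U k) (U k.+1) / tau k] decrease in [k]. *)
Lemma proximal_sequence_slope_bound k C : 0 <= C ->
  F (U 0%N) <= T k.+1 * C ^+ 2 -> slope_bound phi d (U k.+1) C.
Proof.
move=> C0 FC; case: HU => _ Us.
pose s l := d (U l) (U l.+1) / tau l.
have s_ge0 l : 0 <= s l by rewrite divr_ge0 ?(dist_ge0 H)// ltW.
have s_bound l : slope_bound phi d (U l.+1) (s l).
  exact: (proximal_slope_bound H (tau_gt0 l) (Us l)).
have s_decr l : s l.+1 <= s l.
  exact: (proximal_dist_slope H (tau_gt0 l.+1) (Us l.+1) (s_ge0 l) (s_bound l)).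
have s_step l : tau l * s l ^+ 2 <= F (U l) - F (U l.+1).
  rewrite -(ler_pM2l (tau_gt0 l)); apply: le_trans (proximal_sequence_descent l).
  by rewrite mulrA -expr2 -exprMn /s mulrCA divff ?mulr1// gt_eqF.
(* Since the slopes decrease, every term of the telescoped dissipation is at least its step times
   the last squared slope. *)
have s_sum l : T l.+1 * s l ^+ 2 <= F (U 0%N) - F (U l.+1).
  elim: l => [|l IH].
    have := s_step 0%N.
    by rewrite seriesSr /series/= big_geq// add0r.
  rewrite seriesSr mulrDl.
  have := s_step l.+1.
  have : s l.+1 ^+ 2 <= s l ^+ 2 by rewrite lerXn2r ?nnegrE.
  move=> /(ler_wpM2l (series_ge0 l.+1)); lra.
have Tk : 0 < T k.+1.
  by rewrite seriesSr ltr_pwDr// series_ge0.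
have sC : s k <= C.
  rewrite -(ler_pXn2r (ltn0Sn 1)) ?nnegrE// -(ler_pM2l Tk).
  apply: le_trans FC; apply: le_trans (s_sum k) _.
  by have := energy_fine_ge0 H (U k.+1); lra.
move=> w b wb; apply: le_trans (s_bound k w b wb) _.
by rewrite lee_fin lerD2l ler_wpM2r ?(dist_ge0 H).
Qed.

End one_sequence.

(* Multiplying the inequality of one scheme by the step of the other cancels the
   energies, leaving a linear recursion for the squared distances; the function
   [lam + Q / lam] is a supersolution of it. *)
Lemma proximal_sequences_dist (tau eta : nat -> R) (U V : nat -> S) (a b lam : R) :
  (forall k, 0 < tau k <= a) -> (forall k, 0 < eta k <= b) ->
  proximal_sequence tau U -> proximal_sequence eta V -> U 0%N = V 0%N ->
  0 < lam -> forall k j,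
  d (U k) (V j) ^+ 2 <= F (U 0%N) * (lam +
    ((series tau k - series eta j) ^+ 2 + a * series tau k + b * series eta j) / lam).
Proof.
move=> taua etab HU HV UV0 lam0.
have tau0 k : 0 < tau k by case/andP : (taua k).
have eta0 k : 0 < eta k by case/andP : (etab k).
have a0 : 0 < a by case/andP : (taua 0%N) => /lt_le_trans; exact.
have b0 : 0 < b by case/andP : (etab 0%N) => /lt_le_trans; exact.
have U0d := HU.1; have FU0 := energy_fine_ge0 H (U 0%N).
(* When one of the indices is 0, the summed inequality gives [2 * t * F (U 0)]; the
   arithmetic-geometric inequality brings it below the supersolution. *)
have amgm (t c : R) : 0 <= t -> 0 <= c -> 2 * t <= lam + (t ^+ 2 + c * t) / lam.
  move=> t0 c0; rewrite -(ler_pM2r lam0).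
  rewrite [leRHS](_ : _ = lam ^+ 2 + (t ^+ 2 + c * t)); last by field; rewrite gt_eqF.
  have := sqr_ge0 (t - lam); have := mulr_ge0 c0 t0; rewrite sqrrB; lra.
have start (sg : nat -> R) W c : (forall k, 0 < sg k) -> proximal_sequence sg W ->
    W 0%N = U 0%N -> 0 <= c -> forall j, d (W j) (U 0%N) ^+ 2 <=
    F (U 0%N) * (lam + (series sg j ^+ 2 + c * series sg j) / lam).
  move=> sg0 HW W0 c0 j.
  have := proximal_sequence_evi_sum sg0 HW U0d (leq0n j).
  rewrite -W0 (dist_refl H) expr0n/= subr0 W0 => /le_trans; apply.
  have T0 : series sg 0 = 0 by rewrite /series/= big_geq.
  rewrite T0 subr0.
  apply: le_trans (ler_wpM2l FU0 (amgm _ _ (series_ge0 sg0 j) c0)).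
  have := energy_fine_ge0 H (W j); have := series_ge0 sg0 j.
  move=> h1 h2; have := mulr_ge0 h1 h2; lra.
have s0 (sg : nat -> R) : series sg 0 = 0 by rewrite /series/= big_geq.
elim=> [|k IHk] j.
  rewrite s0 sub0r sqrrN mulr0 addr0 (dist_sym H).
  exact: start (ltW b0) _.
elim: j => [|j IHj].
  rewrite s0 subr0 mulr0 addr0 -UV0.
  exact: start (ltW a0) _.
have Vd := proximal_sequence_dom eta0 HV j.+1.
have Ud := proximal_sequence_dom tau0 HU k.+1.
have := proximal_sequence_evi tau0 HU k Vd.
have := proximal_sequence_evi eta0 HV j Ud.
have {IHk} := IHk j.+1; move: IHj.
rewrite (dist_sym H (V j.+1)) (dist_sym H (V j)).
rewrite !seriesSr.
have /andP[t0 ta] := taua k; have /andP[e0 eb] := etab j.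
have := sqr_ge0 (d (U k) (U k.+1)); have := sqr_ge0 (d (V j) (V j.+1)).
have : 0 <= F (U 0%N) / lam by rewrite divr_ge0// ltW.
have QE (Q : R) : F (U 0%N) * (lam + Q / lam) = F (U 0%N) * lam + F (U 0%N) / lam * Q.
  by ring.
rewrite !QE.
move: (F (U 0%N) / lam) (F (U 0%N) * lam) => A B.
move: (d (U k) (U k.+1) ^+ 2) (d (V j) (V j.+1) ^+ 2) => p q.
move: (d (U k.+1) (V j.+1) ^+ 2) (d (U k) (V j.+1) ^+ 2) (d (U k.+1) (V j) ^+ 2) => x y z.
move: (F (V j.+1)) (F (U k.+1)) => FV FU.
move: (tau k) (eta j) (series tau k) (series eta j) t0 ta e0 eb => t e s r t0 ta e0 eb.
move=> A0 q0 p0 hz hy hV hU.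
have st0 : 0 < t + e by lra.
have main : (t + e) * x <= e * y + t * z.
  have := ler_wpM2l (ltW e0) hU; have := ler_wpM2l (ltW t0) hV.
  have := mulr_ge0 (ltW e0) p0; have := mulr_ge0 (ltW t0) q0.
  lra.
rewrite -(ler_pM2l st0); apply: le_trans main _.
have := ler_wpM2l (ltW e0) hy; have := ler_wpM2l (ltW t0) hz.
(* Let [Q] be the numerator in the supersolution. The weighted sum of its two previous values falls
   short of [(t + e) * Q] by [t * e * ((a - t) + (b - e))]: the squares lose [t * e * (t + e)] and
   the linear terms gain [t * e * (a + b)]. *)
have := mulr_ge0 A0 (mulr_ge0 (mulr_ge0 (ltW e0) (ltW t0)) (_ : 0 <= a - t)).
move=> /(_ ltac:(lra)).
have := mulr_ge0 A0 (mulr_ge0 (mulr_ge0 (ltW e0) (ltW t0)) (_ : 0 <= b - e)).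
move=> /(_ ltac:(lra)).
lra.
Qed.

End discrete_solutions.

(** * Existence of minimizing movements *)

Section discrete_trajectories.
Context {R : realType} {S : Type} (phi : S -> \bar R) (d : S -> S -> R).
Hypothesis H : convex_energy phi d.
Local Notation F x := (fine (phi x)).
Local Notation Dom x := (phi x < +oo)%E.

Lemma time_steps_index (tau : nat -> R) (t : R) : time_steps tau -> 0 < t ->
  exists k, series tau k < t <= series tau k.+1.
Proof.
move=> [tau0 tauy] t0.
have ex : exists k, t <= series tau k.
  have /cvgryPge/(_ t)[N _ /(_ N)] := tauy.
  by rewrite /= leqnn => /(_ isT); exists N.
case: (ex_minnP ex) => -[|k] tk kmin.
  by move: tk; rewrite /series/= big_geq// leNgt t0.
exists k; rewrite tk andbT ltNge; apply/negP => /kmin.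
by rewrite ltnn.
Qed.

Lemma time_steps_index_uniq (tau : nat -> R) (t : R) i k : time_steps tau ->
  series tau i < t <= series tau i.+1 -> series tau k < t <= series tau k.+1 ->
  i = k.
Proof.
move=> [tau0 _].
wlog ik : i k / (i <= k)%N => [Hw h1 h2|].
  by have [/Hw|/ltnW/Hw] := leqP i k; [exact|move=> <-].
move=> /andP[i1 i2] /andP[k1 k2].
move: ik; rewrite leq_eqVlt => /predU1P[//|/(series_homo tau0) ik].
by have := lt_le_trans k1 i2; rewrite ltNge ik.
Qed.

Lemma discrete_trajectory_sequence (tau : nat -> R) (v : R -> S) :
  time_steps tau -> discrete_trajectory phi d tau v ->
  exists U, [/\ proximal_sequence phi d tau U, v 0 = U 0%N &
    forall t, 0 < t -> exists k, series tau k < t <= series tau k.+1 /\ v t = U k.+1].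
Proof.
move=> taus [U [U0 Us v0 vU]]; exists U; split => // t t0.
have [k kt] := time_steps_index taus t0; exists k; split => //.
exact: vU kt.
Qed.

Lemma discrete_trajectory_exists (tau : nat -> R) x : time_steps tau -> Dom x ->
  exists v, discrete_trajectory phi d tau v /\ v 0 = x.
Proof.
move=> taus xd; have tau0 := taus.1.
have [J JP] := choice (fun ky : nat * S => proximal_minimizer H ky.2 (tau0 ky.1)).
pose U := nat_rect (fun=> S) x (fun k y => J (k, y)).
have /choice[v vP] (t : R) : exists y, (t <= 0 -> y = x) /\
    (forall k, series tau k < t <= series tau k.+1 -> y = U k.+1).
  have [t0|t0] := leP t 0.
    exists x; split => // k /andP[/lt_le_trans/(_ t0)].
    by rewrite ltNge (series_ge0 tau0).
  have [k kt] := time_steps_index taus t0; exists (U k.+1); split => // i it.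
  by rewrite (time_steps_index_uniq taus kt it).
have v0 : v 0 = x by apply: (vP 0).1.
exists v; split => //; exists U; split => //.
  by move=> k; exact: (JP (k, U k)).
by move=> k t /((vP t).2).
Qed.

(** At a common time the numerator in [proximal_sequences_dist] is of the order of the mesh, so
    [lam] is fixed first, according to [e], and the mesh is chosen afterwards. *)
Lemma discrete_trajectory_close x (t e : R) : Dom x -> 0 <= t -> 0 < e ->
  exists dt : R, 0 < dt /\ forall tau eta v v',
    time_steps tau -> time_steps eta ->
    (forall k, tau k <= dt) -> (forall k, eta k <= dt) ->
    discrete_trajectory phi d tau v -> discrete_trajectory phi d eta v' ->
    v 0 = x -> v' 0 = x -> d (v t) (v' t) < e.
Proof.
move=> xd t0 e0; have A0 := energy_fine_ge0 H x.
(* Chosen with [2 * lam * F x < e ^+ 2]; the added 1 keeps the denominator positive. *)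
pose lam := e ^+ 2 / (2 * (F x + 1)).
have lam0 : 0 < lam by rewrite divr_gt0 ?exprn_gt0//; lra.
have t60 : 0 < 6 + 2 * t by lra.
(* At grid times within one step of [t] the numerator is at most [dt * (3 + 2 * t)]; the 6 leaves
   room. *)
pose dt := Num.min 1 (lam ^+ 2 / (6 + 2 * t)).
have dt0 : 0 < dt by rewrite lt_min ltr01 divr_gt0 ?exprn_gt0.
have dt1 : dt <= 1 by rewrite ge_min lexx.
have dtQ : dt * (6 + 2 * t) <= lam ^+ 2 by rewrite -ler_pdivlMr// ge_min lexx orbT.
exists dt; split => // tau eta v v' taus etas taudt etadt vt v't v0 v'0.
have [U [HU U0 vU]] := discrete_trajectory_sequence taus vt.
have [V [HV V0 vV]] := discrete_trajectory_sequence etas v't.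
move: t0; rewrite le_eqVlt => /predU1P[<-|t0].
  by rewrite v0 v'0 (dist_refl H).
have [k [/andP[kt tk] ->]] := vU _ t0; have [j [/andP[jt tj] ->]] := vV _ t0.
have taub i : 0 < tau i <= dt by rewrite taus.1 taudt.
have etab i : 0 < eta i <= dt by rewrite etas.1 etadt.
have UV0 : U 0%N = V 0%N by rewrite -U0 -V0 v0 v'0.
have := proximal_sequences_dist H taub etab HU HV UV0 lam0 k.+1 j.+1.
rewrite -U0 v0.
have := taudt k; have := etadt j; move: tk tj; rewrite !seriesSr.
move: (series tau k) (series eta j) (tau k) (eta j) kt jt => r s a b kt jt tk tj b_dt a_dt.
set Q := (X in _ * (_ + X / _)) => UVQ.
rewrite -(ltr_pXn2r (ltn0Sn 1)) ?nnegrE ?(dist_ge0 H) ?(ltW e0)//.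
apply: le_lt_trans UVQ _.
have Qlam : Q <= lam ^+ 2.
  apply: le_trans dtQ.
  have dt_ge0 := ltW dt0.
  have ra : r + a <= t + dt by lra.
  have sb : s + b <= t + dt by lra.
  have rs : `|r + a - (s + b)| <= dt by rewrite ler_norml; lra.
  have := ler_wpM2l dt_ge0 ra; have := ler_wpM2l dt_ge0 sb.
  have : `|r + a - (s + b)| ^+ 2 <= dt ^+ 2 by rewrite lerXn2r ?nnegrE.
  rewrite real_normK ?num_real//.
  have := ler_wpM2l dt_ge0 dt1.
  by rewrite /Q mulr1; lra.
have Ql : Q / lam <= lam by rewrite ler_pdivrMr// -expr2.
apply: (@le_lt_trans _ _ (F x * (lam + lam))); first by rewrite ler_wpM2l// lerD2l.
have : lam * (2 * (F x + 1)) = e ^+ 2 by rewrite /lam divfK// gt_eqF//; lra.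
by move=> <-; lra.
Qed.

Lemma uniform_time_steps j : time_steps (fun _ : nat => j.+1%:R^-1 : R).
Proof.
split=> [_|]; first by rewrite invr_gt0.
apply/cvgryPge => A.
have -> : series (fun _ : nat => j.+1%:R^-1 : R) = fun k => k%:R / j.+1%:R.
  by apply/funext => k; rewrite /series/= sumr_const_nat subn0 -[LHS]mulr_natl.
near=> k; rewrite ler_pdivlMr//; near: k.
exact: nbhs_infty_ger.
Unshelve. all: by end_near. Qed.

Lemma small_steps (tau : nat -> nat -> R) (e : R) : 0 < e ->
  ereal_sup [set (tau j k)%:E | k in [set: nat]] @[j --> \oo] --> 0%E ->
  \forall j \near \oo, forall k, tau j k <= e.
Proof.
move=> e0 tau0.
have : \forall j \near \oo,
    (ereal_sup [set (tau j k)%:E | k in [set: nat]] < e%:E)%E.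
  have nb : nbhs (0%E : \bar R) [set x | (x < e%:E)%E].
    by apply: open_ereal_lt'; rewrite lte_fin.
  exact: tau0 _ nb.
apply: filterS => j je k; rewrite -lee_fin; apply: le_trans (ltW je).
by apply: ereal_sup_ubound; exists k.
Qed.

Lemma uniform_small_steps :
  ereal_sup [set ((fun j _ : nat => j.+1%:R^-1 : R) j k)%:E | k in [set: nat]]
    @[j --> \oo] --> 0%E.
Proof.
have -> : (fun j => ereal_sup
    [set ((fun j _ : nat => j.+1%:R^-1 : R) j k)%:E | k in [set: nat]]) =
    EFin \o (fun j : nat => j.+1%:R^-1).
  apply/funext => j; rewrite (_ : [set _ | _ in _] = [set (j.+1%:R^-1)%:E]).
    by rewrite ereal_sup1.
  by apply/seteqP; split=> [_ [k _ <-]//|_ ->]; exists 0%N.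
apply: cvg_EFin; first exact: nearW.
exact: cvg_harmonic.
Qed.

Lemma discrete_trajectory_decr (tau : nat -> R) v t : time_steps tau ->
  discrete_trajectory phi d tau v -> 0 <= t -> Dom (v t) /\ F (v t) <= F (v 0).
Proof.
move=> taus vt; have [U [HU U0 vU]] := discrete_trajectory_sequence taus vt.
rewrite le_eqVlt => /predU1P[<-|/vU[k [_ ->]]].
  by rewrite U0; split => //; exact: HU.1.
rewrite U0; split; first exact: (proximal_sequence_dom H taus.1 HU).
exact: (proximal_sequence_le0 H taus.1 HU).
Qed.

(** All schemes start exactly at [x], so [discrete_trajectory_close] compares them. The uniform ones
    converge by completeness of the sublevel of [x], and any other family of partitions is compared
    with these. *)
Lemma minimizing_movements_nonempty x : Dom x ->
  minimizing_movements phi d x !=set0.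
Proof.
move=> xd.
have [v vP] := choice (fun j => discrete_trajectory_exists (uniform_time_steps j) xd).
have v_le j t : 0 <= t -> (phi (v j t) <= (F x)%:E)%E.
  move=> t0; have [vd vF] := discrete_trajectory_decr (uniform_time_steps j) (vP j).1 t0.
  by rewrite -(energy_fineK H vd) lee_fin -[x in leRHS](vP j).2.
have /choice[mu muP] (t : R) : exists y, 0 <= t -> d (v j t) y @[j --> \oo] --> (0 : R).
  have [t0|t0] := leP 0 t; last by exists x.
  have [||y vy] := @energy_complete _ _ _ _ H (fun j => v j t) (F x); last by exists y.
    by move=> j; exact: v_le.
  move=> e e0; have [dt [dt0 close]] := discrete_trajectory_close xd t0 e0.
  have [N _ Ndt] := small_steps dt0 uniform_small_steps.
  exists N => i j Ni Nj.
  apply: (close (fun=> i.+1%:R^-1) (fun=> j.+1%:R^-1)) => //; try exact: uniform_time_steps.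
  - exact: Ndt.
  - exact: Ndt.
  - exact: (vP i).1.
  - exact: (vP j).1.
  - exact: (vP i).2.
  - exact: (vP j).2.
exists mu; split.
  rewrite (dist_sym H); have := muP 0 (lexx 0).
  under eq_fun do rewrite (vP _).2.
  by move=> mu0; have := cvg_unique _ (cvg_cst _) mu0; apply; exact: Rhausdorff.
move=> tau taus tau0.
have [w wP] := choice (fun j => discrete_trajectory_exists (taus j) xd).
exists w; split => [j||| t t0].
- exact: (wP j).1.
- by under eq_fun do rewrite (wP _).2; exact: cvg_cst.
- under eq_fun do rewrite (wP _).2 (dist_refl H).
  rewrite is_cvg_limn_esupE; last exact: is_cvg_cst.
  by rewrite lim_cst// ltry.
apply/cvgrPdist_lt => e e0; have e2 : 0 < e / 2 by lra.
have [dt [dt0 close]] := discrete_trajectory_close xd t0 e2.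
have vt := muP t t0; have /cvgrPdist_lt/(_ _ e2) := vt.
move: (small_steps dt0 uniform_small_steps) (small_steps dt0 tau0).
apply: filterS3 => j vdt wdt; rewrite !sub0r !normrN !ger0_norm ?(dist_ge0 H)// => vmu.
have wv : d (w j t) (v j t) < e / 2.
  apply: (close (tau j) (fun=> j.+1%:R^-1)) => //; try exact: uniform_time_steps.
  - exact: (wP j).1.
  - exact: (vP j).1.
  - exact: (wP j).2.
  - exact: (vP j).2.
apply: le_lt_trans (dist_triangle H _ (v j t) _) _.
by rewrite [e]splitr ltrD.
Qed.

End discrete_trajectories.

(** * Variational inequality and slope bound for minimizing movements *)

Section minimizing_movement_evi.
Context {R : realType} {S : Type} (phi : S -> \bar R) (d : S -> S -> R).
Hypothesis H : convex_energy phi d.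
Local Notation F x := (fine (phi x)).
Local Notation Dom x := (phi x < +oo)%E.
Variables (x : S) (mu : R -> S).
Hypotheses (x_dom : Dom x) (mu_mm : minimizing_movements phi d x mu).

Let step (j : nat) : R := j.+1%:R^-1.

Let step_gt0 j : 0 < step j. Proof. by rewrite invr_gt0. Qed.

Let step_cvg : step j @[j --> \oo] --> (0 : R). Proof. exact: cvg_harmonic. Qed.

(** Convergence is required for every family of partitions, and the uniform ones suffice to study
    [mu]. The points [v j 0] may differ from [x], so the convergence of their energies is
    recorded. *)
Lemma minimizing_movement_approx : exists v : nat -> R -> S,
  [/\ forall j, discrete_trajectory phi d (fun=> step j) (v j),
      F (v j 0) @[j --> \oo] --> F x &
      forall t, 0 <= t -> d (v j t) (mu t) @[j --> \oo] --> (0 : R)].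
Proof.
have [_ /(_ _ uniform_time_steps uniform_small_steps)[v [vt v0 _ vmu]]] := mu_mm.
exists v; split => //.
by apply: fine_cvg; rewrite (energy_fineK H).
Qed.

Lemma minimizing_movement_start : phi (mu 0) = phi x.
Proof. by case: mu_mm => mu0 _; exact: (dist0_energy H mu0). Qed.

(** The summed discrete inequality is used between grid times within one step of [s] and [t]. Solved
    for [F (v j t)], it gives a bound converging to [c], to which lower semicontinuity applies. *)
Lemma minimizing_movement_evi (s t : R) w : 0 <= s -> s < t -> Dom w ->
  Dom (mu t) /\
  d (mu t) w ^+ 2 - d (mu s) w ^+ 2 <= 2 * (t - s) * (F w - F (mu t)).
Proof.
move=> s0 st wd; have ts0 : 0 < t - s by rewrite subr_gt0.
have t0 : 0 < t by exact: le_lt_trans st.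
have [v [vt v0 vmu]] := minimizing_movement_approx.
have discrete j : (t - s - step j) * F (v j t) <=
    (t - s + step j) * F w + (d (v j s) w ^+ 2 - d (v j t) w ^+ 2) / 2.
  have taus := @uniform_time_steps R j.
  have [U [HU U0 vU]] := discrete_trajectory_sequence taus (vt j).
  have [k [/andP[kt tk] ->]] := vU _ t0.
  (* A positive time takes the value at the right end of its step, so the grid time lies after [s];
     for [s = 0] it is 0 itself. *)
  have [i [ik vs is1 is2]] : exists i, [/\ (i <= k.+1)%N, v j s = U i,
      s <= series (fun=> step j) i & series (fun=> step j) i <= s + step j].
    move: s0; rewrite le_eqVlt => /predU1P[<-|/vU[i [/andP[i1 i2] ->]]].
      by exists 0%N; split => //; rewrite /series/= big_geq// add0r ltW.
    exists i.+1; split => //.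
      rewrite ltnS leqNgt; apply/negP => ki.
      have := series_homo taus.1 ki; rewrite leNgt => /negP; apply.
      by apply: lt_le_trans tk; exact: lt_trans i1 st.
    by rewrite seriesSr lerD2r ltW.
  have := proximal_sequence_evi_sum H taus.1 HU wd ik; rewrite -vs.
  move: tk; rewrite seriesSr /=.
  have := energy_fine_ge0 H w; have := energy_fine_ge0 H (U k.+1).
  have := step_gt0 j; rewrite -/(step j).
  move: (series _ k) (series _ i) kt is1 is2 => Tk Ti kt is1.
  move: (step j) (F (U _)) (F w) => h p q is2 h0 p0 q0 tk.
  move: (d _ _ ^+ 2) (d _ _ ^+ 2) => a b ev.
  have k1 : t - s - h <= Tk + h - Ti by lra.
  have k2 : Tk + h - Ti <= t - s + h by lra.
  have := ler_wpM2r p0 k1; have := ler_wpM2r q0 k2.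
  lra.
pose c := F w + (d (mu s) w ^+ 2 - d (mu t) w ^+ 2) / (2 * (t - s)).
suff /(energy_fine_le H)[md mc] : (phi (mu t) <= c%:E)%E.
  split => //; move: mc; rewrite /c -lerBlDl ler_pdivlMr ?mulr_gt0//; lra.
apply: (energy_lsc_near H (vmu _ (ltW t0))) => e e0.
pose r j := ((t - s + step j) * F w +
  (d (v j s) w ^+ 2 - d (v j t) w ^+ 2) / 2) / (t - s - step j).
have rc : r j @[j --> \oo] --> c.
  have -> : c = ((t - s + 0) * F w +
      (d (mu s) w ^+ 2 - d (mu t) w ^+ 2) / 2) / (t - s - 0).
    rewrite /c addr0 subr0; field; rewrite gt_eqF//.
  have dc y : 0 <= y -> d (v j y) w ^+ 2 @[j --> \oo] --> d (mu y) w ^+ 2.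
    move=> y0; have vy := dist_cvg H (vmu y y0).
    by under eq_fun do rewrite expr2; rewrite expr2; apply: cvgM.
  apply: cvgM.
    apply: cvgD.
      by apply: cvgM; [apply: cvgD => //; exact: cvg_cst|exact: cvg_cst].
    by apply: cvgM; [apply: cvgB; apply: dc => //; exact: ltW|exact: cvg_cst].
  apply: cvgV; first by rewrite subr0 gt_eqF.
  by apply: cvgB => //; exact: cvg_cst.
have /cvgrPdist_le/(_ e e0) := rc.
have /cvgrPdist_lt/(_ _ ts0) := step_cvg.
apply: filterS2 => j; rewrite sub0r normrN gtr0_norm// => js jr.
have [vd _] := discrete_trajectory_decr H (@uniform_time_steps R j) (vt j) (ltW t0).
rewrite -(energy_fineK H vd) lee_fin.
apply: (@le_trans _ _ (r j)).
  by rewrite ler_pdivlMr ?subr_gt0// mulrC discrete.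
by move: jr; rewrite ler_norml => /andP[+ _]; rewrite lerNl opprB lerBlDl.
Qed.

(** The discrete bound involves the energy of [v j 0], which only approximates that of [x].
    Enlarging [C] to [C + e] leaves a margin [t * e ^+ 2], and [e] tends to 0 at the end. *)
Lemma minimizing_movement_slope (t C : R) : 0 < t -> 0 <= C ->
  F x <= t * C ^+ 2 -> slope_bound phi d (mu t) C.
Proof.
move=> t0 C0 xC.
have [v [vt v0 vmu]] := minimizing_movement_approx.
have near_bound e : 0 < e -> slope_bound phi d (mu t) (C + e).
  move=> e0; have te : 0 < t * e ^+ 2 by rewrite mulr_gt0// exprn_gt0.
  have /cvgrPdist_lt/(_ _ te)[N _ vN] := v0.
  apply: (slope_bound_lsc H (x := fun n => v (n + N)%N t)) => [|n].
    by rewrite (cvg_shiftn N (fun n => d (v n t) (mu t))); exact: vmu (ltW t0).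
  have taus := @uniform_time_steps R (n + N).
  have [U [HU U0 vU]] := discrete_trajectory_sequence taus (vt (n + N)%N).
  have [k [/andP[kt tk] ->]] := vU _ t0.
  have Ce0 : 0 <= C + e by rewrite addr_ge0// ltW.
  apply: (proximal_sequence_slope_bound H taus.1 HU Ce0).
  apply: (@le_trans _ _ (t * (C + e) ^+ 2)); last first.
    by rewrite ler_wpM2r ?sqr_ge0.
  have := vN (n + N)%N; rewrite /= leq_addl => /(_ isT).
  rewrite -U0 ltr_norml => /andP[+ _].
  have := mulr_ge0 (ltW t0) (mulr_ge0 C0 (ltW e0)).
  move: xC; move: (F x) (F (v _ _)) => a b.
  by rewrite sqrrD; lra.
move=> w b wb; apply/lee_addgt0Pr => e e0.
have d1 : 0 < d (mu t) w + 1 by rewrite ltr_wpDl ?(dist_ge0 H).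
have e1 : 0 < e / (d (mu t) w + 1) by rewrite divr_gt0.
apply: le_trans (near_bound _ e1 w b wb) _; rewrite lee_fin.
rewrite mulrDl addrA lerD2l mulrAC ler_pdivrMr// ler_wpM2l ?(ltW e0)//.
by rewrite lerDl.
Qed.

End minimizing_movement_evi.

(** * Solutions of the evolution variational inequality *)

Section evi_flow.
Context {R : realType} {S : Type} (phi : S -> \bar R) (d : S -> S -> R).
Hypothesis H : convex_energy phi d.
Local Notation leb := (@lebesgue_measure R).
Local Notation F x := (fine (phi x)).
Local Notation Dom x := (phi x < +oo)%E.
Variables (mu : R -> S).
Hypothesis mu0_dom : Dom (mu 0).
Hypothesis mu_evi : forall (s t : R) w, 0 <= s -> s < t -> Dom w ->
  Dom (mu t) /\
  d (mu t) w ^+ 2 - d (mu s) w ^+ 2 <= 2 * (t - s) * (F w - F (mu t)).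
Hypothesis mu_slope : forall (t C : R), 0 < t -> 0 <= C ->
  F (mu 0) <= t * C ^+ 2 -> slope_bound phi d (mu t) C.

Let psi t := F (mu t).

Lemma flow_dom (t : R) : 0 <= t -> Dom (mu t).
Proof.
rewrite le_eqVlt => /predU1P[<- //|t0].
by have [] := mu_evi (lexx 0) t0 mu0_dom.
Qed.

Lemma flow_dist (s t : R) : 0 <= s -> s <= t ->
  d (mu s) (mu t) ^+ 2 <= 2 * (t - s) * (psi s - psi t).
Proof.
move=> s0; rewrite le_eqVlt => /predU1P[<-|st].
  by rewrite (dist_refl H) expr0n/= subrr !mulr0.
have [_] := mu_evi s0 st (flow_dom s0).
by rewrite (dist_refl H) expr0n/= subr0 (dist_sym H).
Qed.

Lemma flow_energy_decr (s t : R) : 0 <= s -> s <= t -> psi t <= psi s.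
Proof.
move=> s0; rewrite le_eqVlt => /predU1P[<-//|st].
have ts : 0 < 2 * (t - s) by rewrite mulr_gt0// subr_gt0.
rewrite -subr_ge0 -(pmulr_rge0 _ ts).
exact: le_trans (sqr_ge0 _) (flow_dist s0 (ltW st)).
Qed.

(** From time [a] on, the slope is at most [c] with [a * c ^+ 2 = F (mu 0)]. The energy drop is then
    at most [c * d], so [flow_dist] improves to [d <= 2 * c * (t - s)], and inserting this bounds
    the drop itself. The sum of the two constants serves both. *)
Lemma flow_lipschitz (a : R) : 0 < a -> exists C, 0 <= C /\
  forall s t, a <= s -> s <= t ->
    d (mu s) (mu t) <= C * (t - s) /\ `|psi t - psi s| <= C * (t - s).
Proof.
move=> a0; have F0 := energy_fine_ge0 H (mu 0).
pose c := Num.sqrt (F (mu 0) / a); have c0 : 0 <= c := sqrtr_ge0 _.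
have cE : a * c ^+ 2 = F (mu 0).
  by rewrite sqr_sqrtr ?divr_ge0 ?(ltW a0)// mulrC divfK// gt_eqF.
exists (2 * c + 2 * c ^+ 2); split; first by rewrite addr_ge0 ?mulr_ge0 ?sqr_ge0.
move=> s t as_ st; have s0 : 0 < s := lt_le_trans a0 as_.
have ts0 : 0 <= t - s by rewrite subr_ge0.
have sb : slope_bound phi d (mu s) c.
  by apply: mu_slope => //; rewrite -cE ler_wpM2r ?sqr_ge0.
have := slope_bound_fine H sb (flow_dom (le_trans (ltW s0) st)).
rewrite -lerBlDl -!/(psi _) => h1.
have h2 := flow_dist (ltW s0) st.
have d0 := dist_ge0 H (mu s) (mu t).
have h3 : d (mu s) (mu t) <= 2 * c * (t - s).
  move: d0; rewrite le_eqVlt => /predU1P[<-|d0]; first by rewrite !mulr_ge0.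
  rewrite -(ler_pM2l d0) -expr2; apply: le_trans h2 _.
  have := ler_wpM2l ts0 h1; rewrite -/(psi _).
  by move: (psi _) (psi _) (d _ _) (t - s) => p q e r; lra.
have h4 : psi s - psi t <= 2 * c ^+ 2 * (t - s).
  apply: le_trans h1 _; apply: le_trans (ler_wpM2l c0 h3) _.
  by rewrite mulrA mulrCA -expr2.
have h5 := flow_energy_decr (ltW s0) st.
have u0 : 0 <= c ^+ 2 * (t - s) by rewrite mulr_ge0 ?sqr_ge0.
have v0 : 0 <= c * (t - s) by rewrite mulr_ge0.
split; first by rewrite mulrDl (le_trans h3)// lerDl -mulrA mulr_ge0.
rewrite distrC ger0_norm ?subr_ge0// mulrDl (le_trans h4)// lerDr -mulrA mulr_ge0//.
Qed.

(* Telescoping the variational inequality over the [N] equal parts of [t, t+h]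
   gives the factor [(N + 1) / N], where the crude bound over [t, t+h] has a
   factor 2. *)
Lemma flow_dist_le (t h K : R) : 0 <= t -> 0 < h ->
  (forall r, 0 <= r <= h -> psi t - psi (t + r) <= K * r) ->
  d (mu (t + h)) (mu t) ^+ 2 <= K * h ^+ 2.
Proof.
move=> t0 h0 hK.
have K0 : 0 <= K.
  rewrite -(pmulr_lge0 _ h0); apply: le_trans (hK h _); last by rewrite (ltW h0) lexx.
  by rewrite subr_ge0 flow_energy_decr// lerDl ltW.
(* Testing at [mu t] adds [2 * K * (i + 1)] times the squared step, and [i * (i + 1) + 2 * (i + 1) =
   (i + 1) * (i + 2)]. *)
have main N i : (i <= N.+1)%N ->
    d (mu (t + i%:R * (h / N.+1%:R))) (mu t) ^+ 2 <=
    K * (h / N.+1%:R) ^+ 2 * (i%:R * i.+1%:R).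
  have N0 : 0 < N.+1%:R :> R by [].
  have e0 : 0 < h / N.+1%:R by rewrite divr_gt0.
  have eN l : (l <= N.+1)%N -> l%:R * (h / N.+1%:R) <= h.
    by move=> lN; rewrite mulrCA ger_pMr// ler_pdivrMr// mul1r ler_nat.
  move: (h / N.+1%:R) e0 eN => e e0 eN {N0}.
  elim: i => [_|i IH iN].
    by rewrite mul0r addr0 (dist_refl H) expr0n/= mul0r mulr0.
  have {}IH := IH (ltnW iN).
  have s0 : 0 <= t + i%:R * e by rewrite addr_ge0// mulr_ge0// ltW.
  have st : t + i%:R * e < t + i.+1%:R * e by rewrite ltrD2l ltr_pM2r// ltr_nat.
  have [_] := mu_evi s0 st (flow_dom t0).
  have eh0 : 0 <= i.+1%:R * e by rewrite mulr_ge0// ltW.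
  have := hK _ (introT andP (conj eh0 (eN _ iN))); rewrite /psi.
  move: IH; rewrite -[i.+2%:R]natr1 -[i.+1%:R]natr1.
  move: (F _) (F _) (d _ _ ^+ 2) (d _ _ ^+ 2) => p q u v h1 h2 h3.
  have := ler_wpM2l (ltW e0) h2.
  by move: (i%:R) h1 h2 h3 => x h1 h2 h3 h4; lra.
apply/ler_addgt0Pr => e e0.
have e1 : 0 < e / (K * h ^+ 2 + 1).
  by rewrite divr_gt0// ltr_wpDl// mulr_ge0 ?sqr_ge0.
have [N _ /(_ N (leqnn N))/= Ne] := near_infty_natSinv_lt (PosNum e1).
have := main N N.+1 (leqnn _).
have N0 : 0 < N.+1%:R :> R by [].
rewrite mulrCA divff ?gt_eqF// mulr1 => /le_trans; apply.
have -> : K * (h / N.+1%:R) ^+ 2 * (N.+1%:R * N.+2%:R) =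
    K * h ^+ 2 * (1 + N.+1%:R^-1).
  rewrite -[N.+2%:R]natr1; move: (N.+1%:R) N0 => y y0; field.
  by rewrite gt_eqF.
rewrite mulrDr mulr1 lerD2l.
apply: (@le_trans _ _ ((K * h ^+ 2 + 1) * N.+1%:R^-1)).
  by rewrite ler_wpM2r ?invr_ge0// lerDl.
rewrite mulrC -ler_pdivlMr ?(ltW Ne)// ltr_wpDl// mulr_ge0 ?sqr_ge0//.
Qed.

(** Three one-sided estimates close up: [M ^+ 2 <= - k] by [flow_dist_le] to the right of [t]; [M]
    is a slope bound by the variational inequality to the left; every slope bound [C] satisfies
    [- k <= C * M]. With [C = M] the last one determines [k], and with [C] the slope it gives the
    remaining inequality. *)
Lemma flow_derivatives (t M k : R) : 0 < t ->
  metric_quotient d mu t s @[s --> t^'] --> M -> is_derive t (1 : R) psi k ->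
  k = - M ^+ 2 /\ slope phi d (mu t) = M%:E.
Proof.
move=> t0 qM dk.
have M0 : 0 <= M.
  apply: (cvgr_to_ge qM); apply: nearW => s.
  by rewrite divr_ge0 ?(dist_ge0 H).
have pq := is_derive_quotient dk.
have le1 : M ^+ 2 <= - k.
  apply/ler_addgt0Pr => e e0.
  have /cvgrPdist_le/(_ e e0) := cvg_dnbhs_at_right pq.
  rewrite near_withinE => /nbhs_ballP[r /= r0 kr].
  have q2 : metric_quotient d mu t s ^+ 2 @[s --> t^'+] --> M ^+ 2.
    have qM' := cvg_dnbhs_at_right qM.
    by under eq_fun do rewrite expr2; rewrite expr2; apply: cvgM.
  apply: (cvgr_to_le q2); rewrite near_withinE; apply/nbhs_ballP.
  exists r => //= s; rewrite /ball/= => sr ts.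
  have st0 : 0 < s - t by rewrite subr_gt0.
  rewrite /metric_quotient gtr0_norm// exprMn exprVn ler_pdivrMr ?exprn_gt0//.
  have := @flow_dist_le t (s - t) (- k + e) (ltW t0) st0.
  rewrite (addrC t) subrK; apply => u /andP[u0 us].
  move: u0; rewrite le_eqVlt => /predU1P[<-|u0]; first by rewrite addr0 subrr mulr0.
  have := kr (t + u); rewrite /ball/= opprD addrA subrr sub0r normrN gtr0_norm//.
  rewrite ltrDl => /(_ _ u0); rewrite addrAC subrr add0r.
  have ur : u < r.
    by apply: le_lt_trans us _; rewrite distrC gtr0_norm in sr.
  move=> /(_ ur); rewrite ler_norml => /andP[_].
  rewrite lerBlDl -lerBlDr ler_pdivlMr//.
  by move: (psi _) (psi _) => a b; lra.
(* The inequality from [s] to [t] involves the energy at the later time, hence the limit from the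
   left. *)
have sbM : slope_bound phi d (mu t) M.
  move=> w b wb; have [wd wF] := energy_fine_le H wb.
  have td := flow_dom (ltW t0).
  rewrite -(energy_fineK H td) lee_fin; apply: le_trans (lerD wF (lexx _)).
  rewrite -lerBlDl.
  pose u s := metric_quotient d mu t s *
    (d (mu t) w + metric_quotient d mu t s * `|s - t| / 2).
  have uM : u s @[s --> t^'] --> M * d (mu t) w.
    rewrite -[X in _ * X]addr0; apply: cvgM => //; apply: cvgD; first exact: cvg_cst.
    rewrite -[X in _ --> X](_ : M * `|t - t| / 2 = 0); last first.
      by rewrite subrr normr0 mulr0 mul0r.
    apply: cvgM; last exact: cvg_cst.
    apply: cvgM => //; apply: cvg_norm; apply: cvgB; last exact: cvg_cst.
    exact: cvg_within.
  apply: (cvgr_to_ge (cvg_dnbhs_at_left uM)).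
  rewrite near_withinE; apply: filterS (lt_nbhsr t0) => s s0 st.
  have [_] := mu_evi (ltW s0) st wd.
  have ts0 : 0 < t - s by rewrite subr_gt0.
  have qE : metric_quotient d mu t s * (t - s) = d (mu s) (mu t).
    by rewrite /metric_quotient ltr0_norm ?subr_lt0// opprB divfK// gt_eqF.
  rewrite /u ltr0_norm ?subr_lt0// opprB.
  have tri := dist_triangle H (mu s) (mu t) w.
  have dsw := dist_ge0 H (mu s) w.
  have : d (mu s) w ^+ 2 <= (d (mu s) (mu t) + d (mu t) w) ^+ 2.
    by rewrite lerXn2r ?nnegrE// (le_trans dsw).
  move=> h1 h2; rewrite -(ler_pM2r ts0); move: h1 h2; rewrite -qE.
  move: (metric_quotient _ _ _ _) (d _ _) (d _ _ ^+ 2) (t - s) => q e a r.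
  move: (F w) (F (mu t)) => fw fm.
  by lra.
have le2 C : slope_bound phi d (mu t) C -> - k <= C * M.
  move=> tC; have qC : C * metric_quotient d mu t s @[s --> t^'+] --> C * M.
    by apply: cvgM; [exact: cvg_cst|exact: cvg_dnbhs_at_right].
  apply: (ler_cvg_to (cvgN (cvg_dnbhs_at_right pq)) qC).
  rewrite near_withinE; apply: nearW => s /= ts.
  have st0 : 0 < s - t by rewrite subr_gt0.
  rewrite /metric_quotient gtr0_norm// mulrA -mulNr ler_pM2r ?invr_gt0// opprB.
  have := slope_bound_fine H tC (flow_dom (ltW (lt_trans t0 ts))).
  by rewrite -lerBlDl (dist_sym H (mu s)).
have kM : k = - M ^+ 2.
  have := le2 _ sbM; rewrite -expr2; move: le1; move: (M ^+ 2) => a; lra.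
split => //; apply/eqP; rewrite eq_le; apply/andP; split.
  exact/(slope_leP H _ M0).
case sE : (slope phi d (mu t)) (slope_ge0 H (mu t)) => [r| |] //; rewrite ?leey// !lee_fin => r0.
have /le2 : slope_bound phi d (mu t) r by apply/(slope_leP H _ r0); rewrite sE.
rewrite kM opprK expr2; move: M0; rewrite le_eqVlt => /predU1P[<- //|M0].
by rewrite ler_pM2r.
Qed.

Lemma Rintegral_cst_itv (C s t : R) : s <= t ->
  \int[leb]_(x in `]s, t]) C = C * (t - s).
Proof.
move=> st; rewrite Rintegral_cst//= lebesgue_measure_itv/= lte_fin.
move: st; rewrite le_eqVlt => /predU1P[->|st]; first by rewrite ltxx subrr.
by rewrite st.
Qed.

Lemma flow_local (a b : R) : 0 < a -> a < b -> exists p : R -> R,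
  [/\ leb.-integrable setT (EFin \o p),
      forall s t, a <= s -> s <= t -> t <= b ->
        psi t - psi s = \int[leb]_(x in `]s, t]) p x &
      {ae leb, forall t : R, `]a, b[%classic t -> exists M : R,
        [/\ metric_quotient d mu t s @[s --> t^'] --> M,
            is_derive t (1 : R) psi (p t), p t = - M ^+ 2 &
            slope phi d (mu t) = M%:E]}].
Proof.
move=> a0 ab; have [C [C0 CL]] := flow_lipschitz a0.
pose m := (fun=> C) \_ (`[a, b] : set R) : R -> R.
have m0 x : 0 <= m x by rewrite /m patchE; case: ifP.
have iC (u v : R) : leb.-integrable `[u, v] (EFin \o (fun=> C)).
  apply: continuous_compact_integrable; first exact: segment_compact.
  by move=> x; exact: cvg_cst.
have im : leb.-integrable setT (EFin \o m).
  by rewrite /m -restrict_EFin; apply/integrable_restrict => //=; rewrite setTI.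
have mE s t : a <= s -> s <= t -> t <= b ->
    \int[leb]_(x in `]s, t]) m x = C * (t - s).
  move=> as_ st tb; rewrite -Rintegral_cst_itv//; apply: eq_Rintegral => x.
  rewrite inE/= in_itv/= => /andP[sx xt]; rewrite /m patchE mem_set//=.
  by rewrite in_itv/= (le_trans as_ (ltW sx)) (le_trans xt).
have w_ac := @clamp_ac R S d mu m a b im m0 _ (ltW ab).
have {}w_ac : forall s t, s <= t ->
    d (mu (clamp a b s)) (mu (clamp a b t)) <= \int[leb]_(x in `]s, t]) m x.
  apply: w_ac => s t as_ st tb; rewrite mE//.
  by have [] := CL s t as_ st.
have psi_ac : forall s t, s <= t ->
    `|psi (clamp a b t) - psi (clamp a b s)| <= \int[leb]_(x in `]s, t]) m x.
  (* The same lemma for the real function [psi], with the line as metric space. *)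
  apply: (@clamp_ac R R (fun x y => `|y - x|) psi m a b im m0 _ (ltW ab)).
  move=> s t as_ st tb; rewrite mE//.
  by have [] := CL s t as_ st.
have [p [ip pE]] := majorized_density im m0 psi_ac.
exists p; split => //.
  move=> s t as_ st tb; rewrite -pE// !clamp_id//.
    by rewrite as_ (le_trans st).
  by rewrite tb (le_trans as_).
have [M [_ Mq]] := metric_derivative_ae (dist_sym H) (dist_triangle H) im m0 w_ac.
move: Mq (primitive_derive_ae ip pE).
apply: filterS2 => [|t Mt dt tab]; first exact: (ae_filter_ringOfSetsType leb).
have tab' : a < t < b by rewrite /= in_itv in tab.
exists (M t).
have qM : metric_quotient d mu t s @[s --> t^'] --> M t.
  by rewrite -(metric_derivative_clamp d mu tab').
have dp : is_derive t (1 : R) psi (p t).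
  apply: near_eq_is_derive dt => //.
  apply: filterS (near_in_itvoo tab) => s; rewrite in_itv/= => /andP[as_ sb].
  by rewrite clamp_id// !ltW.
have t0 : 0 < t by case/andP : tab' => /(lt_trans a0).
by have [] := flow_derivatives t0 qM dp.
Qed.

Lemma flow_ae : {ae leb, forall t : R, 0 < t -> exists M : R,
  [/\ metric_quotient d mu t s @[s --> t^'] --> M,
      is_derive t (1 : R) psi (- M ^+ 2) & slope phi d (mu t) = M%:E]}.
Proof.
(* With [n.+2] the interval is nonempty already for [n = 0], as [flow_local] requires. *)
have loc (n : nat) : {ae leb, forall t : R, `]n.+2%:R^-1, n.+2%:R[%classic t ->
    exists M : R, [/\ metric_quotient d mu t s @[s --> t^'] --> M,
      is_derive t (1 : R) psi (- M ^+ 2) & slope phi d (mu t) = M%:E]}.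
  have n0 : 0 < n.+2%:R^-1 :> R by rewrite invr_gt0.
  have n1 : n.+2%:R^-1 < n.+2%:R :> R.
    by apply: (@lt_trans _ _ 1); rewrite ?invf_lt1 ?ltr1n.
  have [p [_ _ ap]] := flow_local n0 n1.
  apply: filterS ap => [|t tp tn]; first exact: (ae_filter_ringOfSetsType leb).
  by have [M [qM dp pM sM]] := tp tn; exists M; split => //; rewrite -pM.
apply: filterS (ae_foralln loc) => t tn t0.
have [N1 _ N1t] := near_infty_natSinv_lt (PosNum t0).
have [N2 _ N2t] := nbhs_infty_gtr t.
apply: (tn (N1 + N2)%N); rewrite /= in_itv/=; apply/andP; split.
  by apply: (N1t (N1 + N2).+1); rewrite /= -addnS leq_addr.
by apply: N2t => /=; rewrite -addn2 -addnA; apply: leq_trans (leq_addl _ _); exact: leq_addr.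
Qed.

Lemma flow_curve_of_maximal_slope :
  curve_of_maximal_slope phi d (slope phi d) 0%E +oo%E mu.
Proof.
exists psi; split.
- move=> s t /andP[s0 _] _ st; apply: flow_energy_decr => //.
  by rewrite ltW// -lte_fin.
- apply: aeW => t /andP[t0 _]; rewrite /psi (energy_fineK H)//.
  by apply: flow_dom; rewrite ltW// -lte_fin.
apply: filterS flow_ae => [|t tM /andP[+ _]]; first exact: (ae_filter_ringOfSetsType leb).
rewrite lte_fin => /tM[M [qM dp sM]].
split.
- by apply/cvg_ex; exists M.
- by case: dp.
rewrite derive1E (@derive_val _ _ _ _ _ _ _ dp) sM.
have -> : metric_derivative d mu t = M by exact: cvg_lim.
by rewrite -EFin_expe -EFinM -!EFinN -EFinD lee_fin; lra.
Qed.

Lemma flow_slope_measurable :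
  measurable_fun (`]0, +oo[ : set (measurableTypeR R)) (slope phi d \o mu).
Proof.
have -> : (`]0, +oo[%classic : set R) = \bigcup_n eitv_oo (n.+1%:R^-1)%:E (n.+1%:R)%:E.
  apply/seteqP; split=> [t /=|t [n _ /andP[+ _]]]; rewrite /= in_itv/= andbT.
    move=> t0.
    have [N1 _ N1t] := near_infty_natSinv_lt (PosNum t0).
    have [N2 _ N2t] := nbhs_infty_gtr t.
    exists (N1 + N2)%N => //; apply/andP; rewrite !lte_fin; split.
      by apply: N1t; rewrite /= leq_addr.
    by apply: N2t => /=; rewrite -addnS; exact: (leq_trans _ (leq_addl _ _)).
  by rewrite lte_fin; apply: lt_trans; rewrite invr_gt0.
apply/measurable_fun_bigcup => n; first exact: measurable_eitv_oo.
apply: (slope_curve_measurable H).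
have n0 : 0 < n.+1%:R^-1 :> R by rewrite invr_gt0.
have [C [C0 CL]] := flow_lipschitz n0.
exists (fun=> C).
  have iC : leb.-integrable `[n.+1%:R^-1, n.+1%:R] (EFin \o (fun=> C)).
    apply: continuous_compact_integrable; first exact: segment_compact.
    by move=> x; exact: cvg_cst.
  apply: integrableS iC => //; first exact: measurable_eitv_oo.
  by move=> t /andP[]; rewrite !lte_fin /= in_itv/= => /ltW -> /ltW ->.
move=> s t /andP[s1 _] _ st; rewrite lte_fin in s1.
have [+ _] := CL s t (ltW s1) st.
rewrite -lee_fin => /le_trans; apply; rewrite integral_cst//=.
rewrite lebesgue_measure_itv/= lte_fin EFinM.
move: st; rewrite le_eqVlt => /predU1P[->|st]; first by rewrite ltxx subrr.
by rewrite st.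
Qed.

(** The energy decreases, so only a jump down at 0 is to be excluded: [flow_dist] gives
    [d (mu 0) (mu s) ^+ 2 <= 2 * s * psi 0], and lower semicontinuity at [mu 0] applies. *)
Lemma flow_energy_right_cont (s : nat -> R) : (forall n, 0 < s n) ->
  (forall n k, (n <= k)%N -> s k <= s n) -> s n @[n --> \oo] --> (0 : R) ->
  psi (s n) @[n --> \oo] --> psi 0.
Proof.
move=> s0 sdecr scvg; apply/cvgrPdist_le => e e0.
have psi_le n : psi (s n) <= psi 0 by rewrite flow_energy_decr// ltW.
have psi_incr n k : (n <= k)%N -> psi (s n) <= psi (s k).
  by move=> nk; apply: flow_energy_decr; [exact: ltW|exact: sdecr].
have [N Ne] : exists N, psi 0 - e <= psi (s N).
  apply: contrapT => nex.
  have small n : (phi (mu (s n)) <= (psi 0 - e)%:E)%E.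
    rewrite -(energy_fineK H (flow_dom (ltW (s0 n)))) lee_fin leNgt.
    by apply/negP => lt_e; apply: nex; exists n; exact: ltW.
  have : (phi (mu 0) <= (psi 0 - e)%:E)%E.
    apply: (energy_lsc H small); apply/cvgrPdist_lt => r r0.
    have c0 : 0 < 2 * psi 0 + 1.
      by rewrite ltr_wpDl// mulr_ge0//; exact: energy_fine_ge0 H _.
    have r1 : 0 < r ^+ 2 / (2 * psi 0 + 1) by rewrite divr_gt0 ?exprn_gt0.
    have /cvgrPdist_lt/(_ _ r1) := scvg.
    apply: filterS => n; rewrite !sub0r !normrN (gtr0_norm (s0 n)).
    rewrite ger0_norm ?(dist_ge0 H)// ltr_pdivlMr// => sr.
    rewrite -(ltr_pXn2r (ltn0Sn 1)) ?nnegrE ?(dist_ge0 H) ?(ltW r0)//.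
    apply: le_lt_trans sr; rewrite (dist_sym H).
    apply: le_trans (flow_dist (lexx 0) (ltW (s0 n))) _; rewrite subr0.
    have := energy_fine_ge0 H (mu (s n)); rewrite -/(psi _) => p0.
    have := mulr_ge0 (ltW (s0 n)) p0; have := s0 n.
    by move: (psi (s n)) (psi 0) => p q; move: (s n) => u; lra.
  by case/(energy_fine_le H) => _; rewrite -/(psi 0) => h1; move: e0 h1; lra.
exists N => // n /= Nn; rewrite ger0_norm ?subr_ge0//.
by rewrite lerBlDl -lerBlDr (le_trans Ne)// psi_incr.
Qed.

(** The Lipschitz bounds hold away from 0, so the derivative is integrated over []s n, t[]. As [s n]
    tends to 0, the integrals converge monotonically and the energies by
    [flow_energy_right_cont]. *)
Lemma flow_energy_identity (t : R) : 0 < t ->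
  (phi (mu t) = phi (mu 0)
    - \int[leb]_(s in `]0%R, t[) (slope phi d (mu s)) ^+ 2)%E.
Proof.
move=> t0.
pose s (n : nat) : R := t * n.+2%:R^-1.
have s0 n : 0 < s n by rewrite mulr_gt0// invr_gt0.
have st n : s n < t by rewrite /s gtr_pMr// invf_lt1// ltr1n.
have sdecr n k : (n <= k)%N -> s k <= s n.
  by move=> nk; rewrite ler_wpM2l ?(ltW t0)// lef_pV2 ?posrE// ler_nat.
have scvg : s n @[n --> \oo] --> (0 : R).
  rewrite -(mulr0 t); apply: cvgM; first exact: cvg_cst.
  have := @cvg_harmonic R; rewrite -(cvg_shiftn 1) /harmonic.
  by under eq_fun do rewrite addn1.
pose D n : set R := `]s n, t[%classic.
have DU : `]0, t[%classic = \bigcup_n D n.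
  apply/seteqP; split=> [u|u [n _]]; rewrite /D /= !in_itv/= => /andP[u1 u2].
    have /cvgrPdist_lt/(_ _ u1)[N _ /(_ N (leqnn N))/=] := scvg.
    rewrite sub0r normrN gtr0_norm// => sN.
    by exists N => //=; rewrite in_itv/= sN.
  by rewrite u2 (lt_trans (s0 n)).
have mslope : measurable_fun (`]0, t[ : set (measurableTypeR R))
    (fun u => (slope phi d (mu u)) ^+ 2)%E.
  have ms : measurable_fun (`]0, t[ : set (measurableTypeR R)) (slope phi d \o mu).
    apply: measurable_funS flow_slope_measurable => //.
    by move=> u /=; rewrite !in_itv/= andbT => /andP[].
  exact: (emeasurable_funM ms ms).
have intD n : (\int[leb]_(u in D n) (slope phi d (mu u)) ^+ 2 =
    (psi (s n) - psi t)%:E)%E.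
  have [p [ip pE ap]] := flow_local (s0 n) (st n).
  have mD : measurable (D n : set (measurableTypeR R)) by exact: measurable_itv.
  have ipD : leb.-integrable (D n) (EFin \o p).
    by apply: integrableS ip => //; exact: measurable_itv.
  rewrite -opprB EFinN pE// ?(ltW (st n))//.
  rewrite -Rintegral_itv_bndo_bndc; last exact: ipD.
  rewrite /Rintegral fineK; last exact: integrable_fin_num.
  rewrite -integralN; last first.
    by apply: fin_num_adde_defl; rewrite fin_numN; exact: integrable_neg_fin_num.
  apply: ae_eq_integral => //.
  - apply: measurable_funS mslope => //.
    by rewrite DU; exact: bigcup_sup.
  - by apply: measurableT_comp => //; exact: measurable_int ipD.
  apply: filterS ap => [|u pu Du]; first exact: (ae_filter_ringOfSetsType leb).
  by have [M [_ _ -> ->]] := pu Du; rewrite -EFin_expe -EFinN opprK.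
have lim1 : (\int[leb]_(u in D n) (slope phi d (mu u)) ^+ 2 @[n --> \oo] -->
    \int[leb]_(u in \bigcup_n D n) (slope phi d (mu u)) ^+ 2)%E.
  apply: ge0_nondecreasing_set_cvg_integral => [n k nk|n|n|n u _] //.
  - apply/subsetPset => u; rewrite /D /= !in_itv/= => /andP[u1 ->].
    by rewrite (le_lt_trans (sdecr _ _ nk) u1).
  - exact: measurable_itv.
  - by apply: measurable_funS mslope => //; rewrite DU; exact: bigcup_sup.
  - by rewrite sqre_ge0.
have lim2 : (psi (s n) - psi t)%:E @[n --> \oo] --> (psi 0 - psi t)%:E.
  apply: cvg_EFin; first exact: nearW.
  by apply: cvgB; [exact: flow_energy_right_cont|exact: cvg_cst].
rewrite DU; rewrite (funext intD) in lim1.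
have -> := cvg_unique _ lim1 lim2; last exact: ereal_hausdorff.
rewrite -(energy_fineK H mu0_dom) -(energy_fineK H (flow_dom (ltW t0))) -EFinB.
by congr EFin; rewrite -!/(psi _); ring.
Qed.

End evi_flow.

(** * Riesz representation on a compact set *)

Section riesz_representation.
Context {R : realType} {n : nat} (K : set 'rV[R]_n).
Hypothesis K_compact : compact K.
Local Notation T := 'rV[R]_n.
Local Notation CK g := {within K, continuous g}.

Lemma within_cst (a : R) : CK (fun=> a : R).
Proof. by move=> x; exact: cvg_cst. Qed.

Lemma withinD (f g : T -> R) : CK f -> CK g -> CK (fun x => f x + g x).
Proof. by move=> cf cg x; apply: cvgD; [exact: cf|exact: cg]. Qed.

Lemma withinB (f g : T -> R) : CK f -> CK g -> CK (fun x => f x - g x).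
Proof. by move=> cf cg x; apply: cvgB; [exact: cf|exact: cg]. Qed.

Lemma withinM (f g : T -> R) : CK f -> CK g -> CK (fun x => f x * g x).
Proof. by move=> cf cg x; apply: cvgM; [exact: cf|exact: cg]. Qed.

Lemma within_norm (f : T -> R) : CK f -> CK (fun x => `|f x|).
Proof. by move=> cf x; apply: cvg_norm; exact: cf. Qed.

Lemma within_sum (f : nat -> T -> R) m : (forall k, CK (f k)) ->
  CK (fun x => \sum_(k < m) f k x).
Proof.
move=> cf; elim: m => [|m IH].
  by under eq_fun do rewrite big_ord0; exact: within_cst.
by under eq_fun do rewrite big_ord_recr/=; exact: withinD.
Qed.

Lemma within_coord (i : 'I_n) : CK (fun x : T => x 0 i).
Proof. by apply: continuous_subspaceT => x; exact: coord_continuous. Qed.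

(** Truncation to [[0, 1]], written with absolute values so that continuity within [K] follows from
    the algebraic rules. *)
Definition cutoff (y : R) : R := (`|y| - `|y - 1| + 1) / 2.

Lemma cutoff_within (f : T -> R) : CK f -> CK (fun x => cutoff (f x)).
Proof.
move=> cf; apply: withinM; last exact: within_cst.
apply: withinD; last exact: within_cst.
apply: withinB; first exact: within_norm.
by apply: within_norm; apply: withinB => //; exact: within_cst.
Qed.

Lemma cutoff0 y : y <= 0 -> cutoff y = 0.
Proof. by move=> y0; rewrite /cutoff !ler0_norm; lra. Qed.

Lemma cutoff1 y : 1 <= y -> cutoff y = 1.
Proof. by move=> y1; rewrite /cutoff !ger0_norm; lra. Qed.

Lemma cutoff_id y : 0 <= y <= 1 -> cutoff y = y.
Proof. by move=> y1; rewrite /cutoff ger0_norm ?ler0_norm; lra. Qed.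

Lemma cutoff_itv y : 0 <= cutoff y <= 1.
Proof.
have [y0|y0] := leP y 0; first by rewrite cutoff0// lexx ler01.
have [y1|y1] := leP 1 y; first by rewrite cutoff1// lexx ler01.
by rewrite cutoff_id; lra.
Qed.

Lemma cutoff_homo x y : x <= y -> cutoff x <= cutoff y.
Proof.
move=> xy; have [x0|x0] := leP x 0.
  by rewrite (cutoff0 x0); case/andP : (cutoff_itv y).
have [y1|y1] := leP 1 y.
  by rewrite (cutoff1 y1); case/andP : (cutoff_itv x).
by rewrite !cutoff_id; lra.
Qed.

Variable L : (T -> R) -> R.
Hypothesis LD : forall f g : T -> R, CK f -> CK g -> L (fun x => f x + g x) = L f + L g.
Hypothesis LZ : forall (a : R) (f : T -> R), CK f -> L (fun x => a * f x) = a * L f.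
Hypothesis L_ge0 : forall f : T -> R, CK f -> (forall x, K x -> 0 <= f x) -> 0 <= L f.

Lemma functionalB (f g : T -> R) : CK f -> CK g -> L (fun x => f x - g x) = L f - L g.
Proof.
move=> cf cg; have cNg : CK (fun x => -1 * g x).
  by apply: withinM => //; exact: within_cst.
rewrite -[in RHS]mulN1r -LZ// -LD//.
by congr L; apply/funext => x; rewrite mulN1r.
Qed.

Lemma le_functional (f g : T -> R) : CK f -> CK g -> (forall x, K x -> f x <= g x) ->
  L f <= L g.
Proof.
move=> cf cg fg; rewrite -subr_ge0 -functionalB//; apply: L_ge0.
  exact: withinB.
by move=> x Kx; rewrite subr_ge0 fg.
Qed.

Lemma functional_sum (f : nat -> T -> R) m : (forall k, CK (f k)) ->
  L (fun x => \sum_(k < m) f k x) = \sum_(k < m) L (f k).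
Proof.
move=> cf; elim: m => [|m IH].
  rewrite big_ord0 (_ : (fun _ => _) = fun=> 0 * 0).
    by rewrite LZ ?mul0r//; exact: within_cst.
  by apply/funext => x; rewrite big_ord0 mul0r.
rewrite big_ord_recr/= -IH -LD//; last exact: within_sum.
by congr L; apply/funext => x; rewrite big_ord_recr.
Qed.

Lemma functional_cst (a : R) : L (fun=> a) = a * L (fun=> 1).
Proof.
rewrite -LZ; last exact: within_cst.
by congr L; apply/funext => x; rewrite mulr1.
Qed.

(** [c] bounds the outer measure of [A] in the manner of Daniell: open neighbourhoods are replaced
    by increasing limits of continuous functions, at least 1 on [A]. Sequences, rather than single
    functions, give access to countable subadditivity. *)
Definition covers (A : set T) (c : R) : Prop := exists g : nat -> T -> R,
  [/\ forall k, CK (g k), forall k x, K x -> 0 <= g k x <= g k.+1 x,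
      forall x e, A x -> K x -> 0 < e -> exists k, 1 - e < g k x &
      forall k, L (g k) <= c].

Lemma covers_homo (g : nat -> T -> R) :
  (forall k x, K x -> 0 <= g k x <= g k.+1 x) ->
  forall i k x, K x -> (i <= k)%N -> g i x <= g k x.
Proof.
move=> gk i k x Kx /subnKC <-; elim: (k - i)%N => [|l IH]; first by rewrite addn0.
by rewrite addnS (le_trans IH)//; case/andP : (gk (i + l)%N x Kx).
Qed.

Lemma covers_ge0 A c : covers A c -> 0 <= c.
Proof.
move=> [g [cg gk _ gc]]; apply: le_trans (gc 0%N); apply: L_ge0 => // x Kx.
by case/andP : (gk 0%N x Kx).
Qed.

Lemma covers_above A (h : T -> R) : CK h -> (forall x, K x -> 0 <= h x) ->
  (forall x, A x -> K x -> 1 <= h x) -> covers A (L h).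
Proof.
move=> ch h0 h1; exists (fun=> h); split => // [k x Kx|x e Ax Kx e0].
  by rewrite h0 ?lexx.
by exists 0%N; have := h1 x Ax Kx; lra.
Qed.

(* Dini's argument on the compact set [K]. *)
Lemma covers_below A (c : R) (g : T -> R) : covers A c -> CK g ->
  (forall x, K x -> g x <= 1) -> (forall x, K x -> ~ A x -> g x <= 0) -> L g <= c.
Proof.
move=> [h [ch hk hA hc]] cg g1 g0; apply/ler_addgt0Pr => e e0.
have L1 : 0 <= L (fun=> 1) by apply: L_ge0 => //; exact: within_cst.
have L10 : 0 < L (fun=> 1) + 1 by rewrite ltr_wpDl.
pose r := e / (L (fun=> 1) + 1); have r0 : 0 < r by rewrite divr_gt0.
have [k gh] : exists k, forall x, K x -> g x - r < h k x.
  have : \forall k \near \oo, K `<=` (fun x => g x - r < h k x).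
    move/compact_near_coveringP/near_covering_withinP : (K_compact).
    apply => x Kx.
    have [k0 hk0] : exists k, g x - r / 2 < h k x.
      have r2 : 0 < r / 2 by rewrite divr_gt0.
      have [Ax|nAx] := pselect (A x).
        by have [k hkx] := hA x _ Ax Kx r2; exists k; have := g1 x Kx; lra.
      exists 0%N; case/andP : (hk 0%N x Kx) => h0 _.
      by have := g0 x Kx nAx; lra.
    have cd : CK (fun x => h k0 x - g x) by exact: withinB.
    have r2 : 0 < r / 2 by rewrite divr_gt0.
    have /subspace_continuousP/(_ x Kx)/cvgrPdist_lt/(_ _ r2) := cd.
    rewrite near_withinE => near_x.
    exists ([set y | K y -> g y - r < h k0 y], [set k | (k0 <= k)%N]) => /=.
      split; last by exists k0.
      apply: filterS near_x => y /= near_y Ky.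
      by have := near_y Ky; rewrite /from_subspace ltr_norml => /andP[_]; lra.
    move=> [y k] /= [hy k0k] Ky.
    exact: lt_le_trans (hy Ky) (covers_homo hk Ky k0k).
  by move=> [N _ /(_ N (leqnn N))]; exists N.
have : L (fun x => g x - r) <= L (h k).
  apply: le_functional => //; last by move=> x Kx; apply/ltW/gh.
  by apply: withinB => //; exact: within_cst.
rewrite functionalB//; last exact: within_cst.
rewrite functional_cst.
have : r * L (fun=> 1) <= e.
  by rewrite /r mulrAC ler_pdivrMr// ler_wpM2l ?(ltW e0)// lerDl.
by have := hc k; lra.
Qed.

Definition riesz_content (A : set T) : R := inf [set c | covers A c].

Lemma covers_has_inf A : has_inf [set c | covers A c].
Proof.
split; last by exists 0 => c; exact: covers_ge0.
exists (L (fun=> 1)); by apply: covers_above => //; exact: within_cst.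
Qed.

Lemma riesz_content_le A c : covers A c -> riesz_content A <= c.
Proof. by move=> Ac; apply: ge_inf => //; exact: (covers_has_inf A).2. Qed.

Lemma riesz_content_ge A c : (forall c', covers A c' -> c <= c') ->
  c <= riesz_content A.
Proof. by move=> Ac; apply: lb_le_inf; [exact: (covers_has_inf A).1|exact: Ac]. Qed.

Lemma riesz_content_covers A e : 0 < e -> covers A (riesz_content A + e).
Proof.
move=> e0; have [c [g [cg gk gA gc]] ce] := inf_adherent e0 (covers_has_inf A).
by exists g; split => // k; apply: le_trans (gc k) (ltW ce).
Qed.

Lemma riesz_content_ge0 A : 0 <= riesz_content A.
Proof. by apply: riesz_content_ge => c; exact: covers_ge0. Qed.

Lemma riesz_content0 (A : set T) : A `&` K `<=` set0 -> riesz_content A = 0.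
Proof.
move=> AK; apply/eqP; rewrite eq_le riesz_content_ge0 andbT.
have -> : 0 = L (fun=> 0) by rewrite functional_cst mul0r.
apply: riesz_content_le; apply: covers_above => //; first exact: within_cst.
by move=> x Ax Kx; have /AK : (A `&` K) x by split.
Qed.

Lemma le_riesz_content A B : A `<=` B -> riesz_content A <= riesz_content B.
Proof.
move=> AB; apply: riesz_content_ge => c [g [cg gk gB gc]]; apply: riesz_content_le.
by exists g; split => // x e Ax Kx e0; apply: gB => //; exact: AB.
Qed.

Lemma riesz_content_sigma_subadditive (F : (set T)^nat) :
  ((riesz_content (\bigcup_k F k))%:E <= \sum_(k <oo) (riesz_content (F k))%:E)%E.
Proof.
have ser_ge0 : (0 <= \sum_(k <oo) (riesz_content (F k))%:E)%E.
  by apply: nneseries_ge0 => k _ _; rewrite lee_fin riesz_content_ge0.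
case sE : (\sum_(k <oo) (riesz_content (F k))%:E)%E ser_ge0 => [S| |] // S0;
  last by rewrite leey.
apply/lee_addgt0Pr => e e0; rewrite -EFinD lee_fin.
have ek k : 0 < e / 2 ^+ k.+1 by rewrite divr_gt0// exprn_gt0.
have [g gP] := choice (fun k => riesz_content_covers (F k) (ek k)).
(* Diagonal sums: passing to the next [m] adds a nonnegative function and increases the old ones, so
   a single sequence covers the union. *)
apply: riesz_content_le; exists (fun m x => \sum_(k < m.+1) g k m x); split.
- by move=> m; apply: (@within_sum (fun k => g k m)) => k; have [] := gP k.
- move=> m x Kx; apply/andP; split.
    apply: sumr_ge0 => k _; have [_ /(_ m x Kx)] := gP k.
    by case/andP.
  rewrite [leRHS]big_ord_recr/=; apply: ler_wpDr.
    by have [_ /(_ m.+1 x Kx)/andP[]] := gP m.+1.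
  by apply: ler_sum => k _; have [_ /(_ m x Kx)/andP[]] := gP k.
- move=> x r [k _ Fx] Kx r0; have [_ gk gF _] := gP k.
  have [i gi] := gF x r Fx Kx r0; exists (i + k)%N.
  have ki : (k < (i + k).+1)%N by rewrite ltnS leq_addl.
  rewrite (bigD1 (Ordinal ki))//=; apply: ltr_wpDr.
    by apply: sumr_ge0 => l _; have [_ /(_ (i + k)%N x Kx)/andP[]] := gP l.
  by apply: lt_le_trans gi _; apply: (covers_homo gk) => //; exact: leq_addr.
move=> m; rewrite (@functional_sum (fun k => g k m)); last first.
  by move=> k; have [] := gP k.
apply: (@le_trans _ _ (\sum_(k < m.+1) (riesz_content (F k) + e / 2 ^+ k.+1))).
  by apply: ler_sum => k _; have [_ _ _] := gP k.
rewrite big_split/=; apply: lerD.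
  rewrite -lee_fin -sumEFin -sE -(big_mkord xpredT (fun k => (riesz_content (F k))%:E)).
  by apply: nneseries_lim_ge => k _ _; rewrite lee_fin riesz_content_ge0.
suff -> : \sum_(k < m.+1) e / 2 ^+ k.+1 = e - e / 2 ^+ m.+1.
  by rewrite gerBl divr_ge0// ltW.
elim: m => [|m IH]; first by rewrite big_ord1 /= expr1; field.
rewrite big_ord_recr/= IH [2 ^+ m.+2]exprS.
have : (2 : R) ^+ m.+1 != 0 by rewrite expf_neq0.
by move: (2 ^+ m.+1) => p p0; field.
Qed.

Lemma riesz_outer_measure : exists mu : {outer_measure set T -> \bar R},
  forall A, mu A = (riesz_content A)%:E.
Proof.
pose m A := (riesz_content A)%:E.
have m0 : m set0 = 0%E by rewrite /m riesz_content0// set0I.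
have m_ge0 A : (0 <= m A)%E by rewrite lee_fin riesz_content_ge0.
have m_le : {homo m : A B / A `<=` B >-> (A <= B)%E}.
  by move=> A B AB; rewrite lee_fin le_riesz_content.
pose b := isOuterMeasure.Build R T m m0 m_ge0 m_le riesz_content_sigma_subadditive.
pose m' : {outer_measure set T -> \bar R} := HB.pack m b.
by exists m'.
Qed.

(** Caratheodory's criterion for a half-space, to whose indicator the cutoffs [u k] increase. If [g]
    covers [X] at cost [c], then [g k * u k] covers the inner part at cost [sup B]. Freezing an
    index [m] that nearly attains [sup B], the functions [g k * (1 - u m)] cover the rest at cost
    [c - sup B + e]. *)
Lemma riesz_content_halfspace (i : 'I_n) (a : R) (X : set T) :
  riesz_content (X `&` [set v | a < v 0 i]) +
  riesz_content (X `&` ~` [set v | a < v 0 i]) <= riesz_content X.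
Proof.
set U := [set v : T | a < v 0 i].
apply: riesz_content_ge => c [g [cg gk gX gc]]; apply/ler_addgt0Pr => e e0.
pose u (k : nat) (x : T) := cutoff (k%:R * (x 0 i - a)).
have cu k : CK (u k).
  apply: cutoff_within; apply: withinM; first exact: within_cst.
  by apply: withinB; [exact: within_coord|exact: within_cst].
have u01 k x : 0 <= u k x <= 1 by exact: cutoff_itv.
have u_out k x : ~ U x -> u k x = 0.
  move=> /negP; rewrite -leNgt => xa; apply: cutoff0.
  by rewrite mulr_ge0_le0// subr_le0.
have u_homo k l x : (k <= l)%N -> u k x <= u l x.
  move=> kl; have [Ux|nUx] := pselect (U x); last by rewrite !u_out.
  by apply: cutoff_homo; rewrite ler_wpM2r ?ler_nat// subr_ge0 ltW.
have g0 k x : K x -> 0 <= g k x by move=> Kx; case/andP : (gk k x Kx).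
have cgu k l : CK (fun x => g k x * u l x) by exact: withinM.
pose B := [set L (fun x => g k x * u k x) | k in [set: nat]].
have supB : has_sup B.
  split; first by exists (L (fun x => g 0%N x * u 0%N x)); exists 0%N.
  exists c => _ [k _ <-]; apply: le_trans (gc k); apply: le_functional => // x Kx.
  by rewrite ler_piMr ?g0//; case/andP : (u01 k x).
have [_ [m _ <-] mB] := sup_adherent e0 supB.
have cov1 : covers (X `&` U) (sup B).
  exists (fun k x => g k x * u k x); split => //.
  - move=> k x Kx; rewrite mulr_ge0 ?g0//=; last by case/andP : (u01 k x).
    apply: ler_pM; rewrite ?g0//; first by case/andP : (u01 k x).
      by case/andP : (gk k x Kx).
    exact: u_homo.
  - move=> x r [Xx Ux] Kx r0; have [k gkx] := gX x r Xx Kx r0.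
    have xa : 0 < x 0 i - a by rewrite subr_gt0.
    have [l lx] : exists l : nat, 1 <= l%:R * (x 0 i - a).
      have [N _ /(_ N (leqnn N))/= Nx] := nbhs_infty_ger (x 0 i - a)^-1.
      by exists N; rewrite -ler_pdivrMr// div1r.
    exists (k + l)%N; rewrite /u cutoff1 ?mulr1.
      apply: lt_le_trans gkx _; apply: (covers_homo gk) => //; exact: leq_addr.
    by apply: le_trans lx _; rewrite ler_wpM2r ?ler_nat ?leq_addl// ltW.
  - by move=> k; apply: ub_le_sup; [exact: supB.2|exists k].
have cov2 : covers (X `&` ~` U) (c - sup B + e).
  have um1 x : 0 <= 1 - u m x by rewrite subr_ge0; case/andP : (u01 m x).
  have cgu1 k : CK (fun x => g k x * (1 - u m x)).
    by apply: withinM => //; apply: withinB => //; exact: within_cst.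
  have homo1 k l x : K x -> (k <= l)%N -> g k x * (1 - u m x) <= g l x * (1 - u m x).
    by move=> Kx kl; rewrite ler_wpM2r// (covers_homo gk).
  exists (fun k x => g k x * (1 - u m x)); split => //.
  - by move=> k x Kx; rewrite mulr_ge0 ?g0//= homo1.
  - move=> x r [Xx nUx] Kx r0; have [k gkx] := gX x r Xx Kx r0.
    by exists k; rewrite u_out// subr0 mulr1.
  - move=> k; pose l := maxn k m.
    apply: (@le_trans _ _ (L (fun x => g l x * (1 - u m x)))).
      by apply: le_functional => // x Kx; apply: homo1 => //; exact: leq_maxl.
    rewrite (_ : (fun x => _) = (fun x => g l x - g l x * u m x)); last first.
      by apply/funext => x; rewrite mulrBr mulr1.
    rewrite functionalB//.
    have : L (fun x => g m x * u m x) <= L (fun x => g l x * u m x).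
      apply: le_functional => // x Kx; apply: ler_wpM2r; first by case/andP : (u01 m x).
      by apply: (covers_homo gk) => //; exact: leq_maxr.
    by have := gc l; move: mB; lra.
have := riesz_content_le cov1; have := riesz_content_le cov2.
move: (riesz_content _) (riesz_content _) (sup B) => x y z; lra.
Qed.

Lemma compact_measurable_rV : measurable K.
Proof.
rewrite -(setCK K); apply: measurableC; apply: open_measurable_rV.
by apply: closed_openC; apply: compact_closed => //; exact: norm_hausdorff.
Qed.

Lemma riesz_measure : exists mu : {finite_measure set T -> \bar R},
  forall A, mu A = (riesz_content A)%:E.
Proof.
have [m mE] := riesz_outer_measure.
(* Borel sets are Caratheodory measurable once the identity is measurable, which is tested on
   coordinates, hence on half-spaces. *)
have id_meas : measurable_fun [set: caratheodory_type m]
    (fun x : caratheodory_type m => x : T).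
  apply: measurable_fun_rVP => i.
  apply: (measurability _ (RGenOInfty.measurableE R)) => _ [_ [a ->] <-].
  rewrite setTI; apply: le_caratheodory_measurable => X.
  rewrite !mE -EFinD lee_fin.
  rewrite (_ : _ @^-1` _ = [set v : T | a < v 0 i]); first exact: riesz_content_halfspace.
  by apply/seteqP; split=> v /=; rewrite in_itv/= andbT.
have borel_cara (A : set T) : @measurable _ T A ->
    @measurable _ (caratheodory_type m) A.
  by move=> mA; have := id_meas measurableT A mA; rewrite setTI.
have m_add : semi_sigma_additive (m : set T -> \bar R).
  move=> F mF tF mUF.
  apply: (@measure_semi_sigma_additive _ (caratheodory_type m) _ m) => //.
  - by move=> k; exact: borel_cara.
  - exact: borel_cara.
have [m1 m1E] := measure_of (outer_measure0 m) (outer_measure_ge0 m) m_add.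
have [|m2 m2E] := @finite_measure_of _ _ _ m1; first by rewrite m1E mE ltry.
by exists m2 => A; rewrite m2E m1E mE.
Qed.

Lemma within_measurable (g : T -> R) : CK g -> measurable_fun K g.
Proof.
move=> cg; apply: (measurability _ (RGenOpens.measurableE R)).
move=> _ [_ [a [b ->] <-]].
have oab : open (`]a, b[%classic : set R) by exact: interval_open.
have /continuousP/(_ _ oab) := cg.
move=> /open_subspaceP[V oV VK].
rewrite setIC (_ : _ `&` K = V `&` K).
  exact: measurableI (open_measurable_rV oV) compact_measurable_rV.
by rewrite VK.
Qed.

Lemma within_bounded (g : T -> R) : CK g ->
  exists M, 0 <= M /\ forall x, K x -> `|g x| <= M.
Proof.
move=> cg; have := continuous_compact cg K_compact.
move=> /compact_bounded[M [_ gM]].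
exists (`|M| + 1); split; first by rewrite addr_ge0.
move=> x Kx; apply: gM; last by exists x.
by apply: le_lt_trans (ler_norm M) _; rewrite ltrDl.
Qed.

Lemma within_integrable (mu : {finite_measure set T -> \bar R}) (g : T -> R) :
  CK g -> mu.-integrable K (EFin \o g).
Proof.
move=> cg; apply: measurable_bounded_integrable.
- exact: compact_measurable_rV.
- rewrite ltey_eq fin_num_measure//; exact: compact_measurable_rV.
- exact: within_measurable.
have [M [M0 gM]] := within_bounded cg.
exists M; split; first exact: num_real.
by move=> r Mr x Kx /=; rewrite (le_trans (gM x Kx))// ltW.
Qed.

(** The slices of height 1 of [y]. With [count_below], they make the layer-cake formula a finite
    sum. *)
Lemma cutoff_sum (y : R) m : 0 <= y ->
  \sum_(i < m) cutoff (y - i%:R) = Num.min y m%:R.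
Proof.
move=> y0; elim: m => [|m IH]; first by rewrite big_ord0 min_r.
rewrite big_ord_recr/= IH -natr1.
have [ym|ym] := leP y m%:R.
  rewrite cutoff0 ?subr_le0// addr0 min_l//; lra.
have [ym1|ym1] := leP y (m%:R + 1).
  by rewrite cutoff_id; lra.
by rewrite cutoff1; lra.
Qed.

Lemma count_below (y : R) m : 0 <= y ->
  \sum_(i < m) ((i%:R < y)%R%:R : R) <= y + 1.
Proof.
move=> y0.
suff : \sum_(i < m) ((i%:R < y)%R%:R : R) <= Num.min (y + 1) m%:R.
  by rewrite le_min => /andP[].
elim: m => [|m IH]; first by rewrite big_ord0 le_min lexx andbT; lra.
rewrite big_ord_recr/= -natr1; move: IH; rewrite !le_min => /andP[IH1 IH2].
by case: ltP => my /=; apply/andP; split; lra.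
Qed.

(** For [0 <= g <= 1], [N1 * g] is the sum of its unit slices [h i]. A slice is at most 1 and
    vanishes outside [A i], so [L (h i) <= mu (A i)]; the indicators of the [A i] sum to at most
    [N1 * g + 1], whence [L g] is at most the integral of [g] plus [mu K / N1]. The total masses
    agree, so [1 - g] gives the converse; the general case is an affine change. *)
Theorem riesz_compact : exists mu : {finite_measure set T -> \bar R},
  mu (~` K) = 0%E /\
  forall g : T -> R, CK g -> \int[mu]_(x in K) g x = L g.
Proof.
have [mu muE] := riesz_measure.
have mK := compact_measurable_rV.
have ik g : CK g -> mu.-integrable K (EFin \o g) by exact: within_integrable.
have muK : fine (mu K) <= L (fun=> 1).
  rewrite muE /=; apply: riesz_content_le; apply: covers_above => //.
  exact: within_cst.
exists mu; split; first by rewrite muE riesz_content0// setICl.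
have le01 (g : T -> R) : CK g -> (forall x, K x -> 0 <= g x <= 1) ->
    L g <= \int[mu]_(x in K) g x.
  move=> cg g01; apply/ler_addgt0Pr => e e0.
  pose M := fine (mu K); have M0 : 0 <= M by exact: fine_ge0.
  have [N MN] : exists N : nat, M / e <= N.+1%:R.
    have [N _ /(_ N (leqnn N))/= Nx] := nbhs_infty_ger (M / e).
    by exists N; rewrite (le_trans Nx)// ler_nat leqnSn.
  have [N1 N1E] : exists N1 : R, N1 = N.+1%:R by exists N.+1%:R.
  have N0 : 0 < N1 by rewrite N1E.
  rewrite -N1E in MN.
  have y0 x : K x -> 0 <= N1 * g x.
    by move=> Kx; rewrite mulr_ge0 ?(ltW N0)//; case/andP : (g01 x Kx).
  pose h (i : nat) x := cutoff (N1 * g x - i%:R).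
  have cy : CK (fun x => N1 * g x) by apply: withinM => //; exact: within_cst.
  have ch i : CK (h i).
    by apply: cutoff_within; apply: withinB => //; exact: within_cst.
  pose A (i : nat) := K `&` [set x | i%:R < N1 * g x].
  pose ind (i : nat) (x : T) : R := (i%:R < N1 * g x)%R%:R.
  have mA i : measurable (A i).
    have := within_measurable cy mK (measurable_itv `]i%:R, +oo[).
    by congr (measurable (_ `&` _)); apply/seteqP; split=> x /=; rewrite in_itv/= andbT.
  have indE i : {in K, ind i =1 \1_(A i)}.
    move=> x; rewrite inE => Kx; rewrite /ind indicE; congr ((nat_of_bool _)%:R).
    by apply/idP/idP; rewrite inE; [split|case].
  have iind i : mu.-integrable K (EFin \o ind i).
    apply: (@eq_integrable _ _ _ _ _ mK (EFin \o \1_(A i))).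
      by move=> x xK; rewrite /= indE.
    apply: measurable_bounded_integrable => //.
      by rewrite ltey_eq fin_num_measure.
    exists 1; split; first exact: num_real.
    move=> r r1 x Kx /=; rewrite indicE; apply: le_trans (ltW r1).
    by case: (x \in A i); rewrite ?normr1 ?normr0.
  have intind i : \int[mu]_(x in K) ind i x = fine (mu (A i)).
    rewrite (eq_Rintegral _ (indE i)) /Rintegral integral_indic//.
    by rewrite setIC /A setIA setIid.
  have Lh i : L (h i) <= \int[mu]_(x in K) ind i x.
    rewrite intind muE /=; apply: riesz_content_ge => c Ac.
    apply: (covers_below Ac (ch i)) => [x _|x Kx nA].
      by case/andP : (cutoff_itv (N1 * g x - i%:R)).
    rewrite /h cutoff0// subr_le0 leNgt; apply/negP => ix.
    by apply: nA; split.
  have isum m : mu.-integrable K (EFin \o (fun x => \sum_(i < m) ind i x)) /\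
      \int[mu]_(x in K) (\sum_(i < m) ind i x) = \sum_(i < m) \int[mu]_(x in K) ind i x.
    elim: m => [|m [IH1 IH2]].
      have e0' : (fun x => \sum_(i < 0) ind i x) = fun=> 0.
        by apply/funext => x; rewrite big_ord0.
      rewrite e0' big_ord0 Rintegral_cst// mul0r; split => //.
      exact: (ik _ (@within_cst 0)).
    rewrite big_ord_recr/= -IH2 -RintegralD//; split.
      have := integrableD mK IH1 (iind m); congr (_.-integrable _ _).
      by apply/funext => x /=; rewrite big_ord_recr.
    by apply: eq_Rintegral => x _; rewrite big_ord_recr.
  have ile : \int[mu]_(x in K) (\sum_(i < N.+1) ind i x) <=
      N1 * (\int[mu]_(x in K) g x) + M.
    have cy1 : CK (fun x => N1 * g x + 1) by apply: withinD => //; exact: within_cst.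
    apply: (@le_trans _ _ (\int[mu]_(x in K) (N1 * g x + 1))).
      apply: le_Rintegral => //; [exact: (isum _).1|exact: ik|].
      by move=> x Kx; apply: count_below; exact: y0.
    rewrite RintegralD//; [|exact: ik|exact: (ik _ (@within_cst 1))].
    by rewrite RintegralZl ?ik// Rintegral_cst// mul1r.
  have Lg : L g <= N1^-1 * \sum_(i < N.+1) L (h i).
    rewrite -functional_sum// -LZ; last exact: within_sum.
    apply: le_functional => //.
      by apply: withinM; [exact: within_cst|exact: within_sum].
    move=> x Kx; rewrite cutoff_sum ?y0// min_l.
      by rewrite mulKf ?gt_eqF.
    by rewrite -N1E ger_pMr//; case/andP : (g01 x Kx).
  apply: (le_trans Lg); rewrite -(ler_pM2l N0) mulVKf ?gt_eqF//.
  apply: (@le_trans _ _ (N1 * (\int[mu]_(x in K) g x) + M)).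
    apply: le_trans ile; rewrite (isum _).2.
    by apply: ler_sum => i _; exact: Lh.
  by rewrite mulrDr lerD2l -ler_pdivrMr.
have muK1 : fine (mu K) = L (fun=> 1).
  apply/eqP; rewrite eq_le muK; have := le01 _ (@within_cst 1).
  by rewrite Rintegral_cst// mul1r; apply => x _; rewrite ler01 lexx.
have eq01 (g : T -> R) : CK g -> (forall x, K x -> 0 <= g x <= 1) ->
    \int[mu]_(x in K) g x = L g.
  move=> cg g01; apply/eqP; rewrite eq_le le01// andbT.
  have c1g : CK (fun x => 1 - g x) by apply: withinB => //; exact: within_cst.
  have := le01 _ c1g; rewrite functionalB//; last exact: within_cst.
  rewrite (RintegralB mK (ik _ (@within_cst 1)) (ik _ cg)).
  rewrite Rintegral_cst// mul1r muK1.
  have g01' x : K x -> 0 <= 1 - g x <= 1 by move=> /g01; lra.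
  by move=> /(_ g01'); lra.
move=> g cg; have [B [B0 gB]] := within_bounded cg.
pose C := B + 1; have C0 : 0 < C by rewrite /C; lra.
pose h x := (2 * C)^-1 * (g x + C).
have ch : CK h.
  by apply: withinM; [exact: within_cst|apply: withinD => //; exact: within_cst].
have gE : g = fun x => 2 * C * h x - C.
  by apply/funext => x; rewrite /h mulVKf ?addrK// gt_eqF// mulr_gt0.
have cCh : CK (fun x => 2 * C * h x) by apply: withinM => //; exact: within_cst.
rewrite gE functionalB//; last exact: within_cst.
rewrite (RintegralB mK (ik _ cCh) (ik _ (@within_cst C))).
rewrite LZ// (RintegralZl _ mK (ik _ ch)) Rintegral_cst// functional_cst muK1 eq01// => x Kx.
have := gB x Kx; rewrite ler_norml => /andP[g1 g2].
rewrite /h mulr_ge0 ?invr_ge0 ?mulr_ge0 ?(ltW C0)//=; last by rewrite /C; lra.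
by rewrite ler_pdivrMl ?mulr_gt0// mulr1 /C; lra.
Qed.

End riesz_representation.

(** * The transport energy *)

Section weighted_l2.
Context {R : realType}.

Definition wl2_term (a : nat -> R) (k : nat) : R := 2 ^- k * `|a k| ^+ 2.

Definition wl2 (a : nat -> R) : R := limn (series (wl2_term a)).

Definition bounded_seq (a : nat -> R) : Prop := exists B, forall k, `|a k| <= B.

Lemma wl2_term_ge0 a k : 0 <= wl2_term a k.
Proof. by rewrite mulr_ge0 ?sqr_ge0// invr_ge0 exprn_ge0. Qed.

Lemma wl2_cvg a : bounded_seq a -> cvgn (series (wl2_term a)).
Proof.
move=> [B aB]; have B0 : 0 <= B := le_trans (normr_ge0 _) (aB 0%N).
apply: (@series_le_cvg _ _ (geometric (B ^+ 2) (2^-1))).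
- exact: wl2_term_ge0.
- by move=> k; rewrite mulr_ge0 ?sqr_ge0// exprn_ge0// invr_ge0.
- move=> k; rewrite /wl2_term /= mulrC exprVn ler_wpM2r ?invr_ge0 ?exprn_ge0//.
  by rewrite lerXn2r ?nnegrE.
by apply: is_cvg_geometric_series; rewrite ger0_norm ?invr_ge0// invf_lt1// ltr1n.
Qed.

Lemma wl2_partial_le a m : bounded_seq a -> series (wl2_term a) m <= wl2 a.
Proof.
move=> ba; apply: nondecreasing_cvgn_le (wl2_cvg ba) _.
apply/nondecreasing_seqP => k; rewrite [leRHS]seriesSr lerDl.
exact: wl2_term_ge0.
Qed.

Lemma wl2_ge0 a : bounded_seq a -> 0 <= wl2 a.
Proof.
by move=> ba; have := wl2_partial_le 0 ba; rewrite /series/= big_geq.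
Qed.

Lemma wl2_term_le a k : bounded_seq a -> wl2_term a k <= wl2 a.
Proof.
move=> ba; apply: le_trans (wl2_partial_le k.+1 ba); rewrite seriesSr lerDr.
by rewrite /series/= sumr_ge0// => i _; exact: wl2_term_ge0.
Qed.

Lemma wl2_le a c : bounded_seq a -> (forall m, series (wl2_term a) m <= c) ->
  wl2 a <= c.
Proof.
by move=> ba ac; apply: (cvgr_to_le (wl2_cvg ba)); exact: nearW.
Qed.

Lemma wl2_le_comb (a b c : nat -> R) (p q : R) :
  bounded_seq a -> bounded_seq b -> bounded_seq c -> 0 <= p -> 0 <= q ->
  (forall k, `|c k| ^+ 2 <= p * `|a k| ^+ 2 + q * `|b k| ^+ 2) ->
  wl2 c <= p * wl2 a + q * wl2 b.
Proof.
move=> ba bb bc p0 q0 cab; apply: wl2_le => // m.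
apply: (@le_trans _ _ (p * series (wl2_term a) m + q * series (wl2_term b) m)).
  rewrite /series/= !mulr_sumr -big_split/=; apply: ler_sum => k _.
  rewrite /wl2_term [leRHS](_ : _ = 2 ^- k * (p * `|a k| ^+ 2 + q * `|b k| ^+ 2)).
    by rewrite ler_wpM2l// invr_ge0 exprn_ge0.
  by ring.
by apply: lerD; rewrite ler_wpM2l// wl2_partial_le.
Qed.

Lemma wl2_comb (a b c e : nat -> R) (p q r : R) :
  bounded_seq a -> bounded_seq b -> bounded_seq c -> bounded_seq e ->
  (forall k, `|c k| ^+ 2 = p * `|a k| ^+ 2 + q * `|b k| ^+ 2 - r * `|e k| ^+ 2) ->
  wl2 c = p * wl2 a + q * wl2 b - r * wl2 e.
Proof.
move=> ba bb bc be cE; apply/cvg_lim => //.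
rewrite (_ : series (wl2_term c) = fun m => p * series (wl2_term a) m +
    q * series (wl2_term b) m - r * series (wl2_term e) m).
  apply: cvgB; first apply: cvgD.
  - by apply: cvgM; [exact: cvg_cst|exact: wl2_cvg].
  - by apply: cvgM; [exact: cvg_cst|exact: wl2_cvg].
  - by apply: cvgM; [exact: cvg_cst|exact: wl2_cvg].
apply/funext => m; rewrite /series/= !mulr_sumr -big_split/= -sumrB.
by apply: eq_bigr => k _; rewrite /wl2_term cE; ring.
Qed.

(** Minkowski's inequality through [(s + t)^2 <= (x + y) / x * s^2 + (x + y) / y * t^2], which is
    linear in the squares and can be summed. Here [x] and [y] are the two norms, increased by
    [e / 2] to be positive. *)
Lemma wl2_triangle (a b c : nat -> R) :
  bounded_seq a -> bounded_seq b -> bounded_seq c ->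
  (forall k, `|c k| <= `|a k| + `|b k|) ->
  Num.sqrt (wl2 c) <= Num.sqrt (wl2 a) + Num.sqrt (wl2 b).
Proof.
move=> ba bb bc cab; apply/ler_addgt0Pr => e e0.
pose x := Num.sqrt (wl2 a) + e / 2; pose y := Num.sqrt (wl2 b) + e / 2.
have x0 : 0 < x by rewrite ltr_wpDl ?sqrtr_ge0// divr_gt0.
have y0 : 0 < y by rewrite ltr_wpDl ?sqrtr_ge0// divr_gt0.
have xa : wl2 a <= x ^+ 2.
  rewrite -[leLHS]sqr_sqrtr ?wl2_ge0// lerXn2r ?nnegrE ?sqrtr_ge0 ?(ltW x0)//.
  by rewrite lerDl divr_ge0// ltW.
have yb : wl2 b <= y ^+ 2.
  rewrite -[leLHS]sqr_sqrtr ?wl2_ge0// lerXn2r ?nnegrE ?sqrtr_ge0 ?(ltW y0)//.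
  by rewrite lerDl divr_ge0// ltW.
have -> : Num.sqrt (wl2 a) + Num.sqrt (wl2 b) + e = x + y by rewrite /x /y; lra.
have xy0 : 0 <= x + y by rewrite addr_ge0// ltW.
rewrite -(@ger0_norm _ (x + y))// -sqrtr_sqr ler_wsqrtr//.
have px : 0 <= (x + y) / x by rewrite divr_ge0// ltW.
have py : 0 <= (x + y) / y by rewrite divr_ge0// ltW.
have main k : `|c k| ^+ 2 <= (x + y) / x * `|a k| ^+ 2 + (x + y) / y * `|b k| ^+ 2.
  apply: (@le_trans _ _ ((`|a k| + `|b k|) ^+ 2)).
    by rewrite lerXn2r ?nnegrE ?addr_ge0.
  move: (`|a k|) (`|b k|) => s t.
  have : 0 <= (y * s - x * t) ^+ 2 / (x * y) by rewrite divr_ge0 ?sqr_ge0// mulr_ge0// ltW.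
  have -> : (y * s - x * t) ^+ 2 / (x * y) =
      (x + y) / x * s ^+ 2 + (x + y) / y * t ^+ 2 - (s + t) ^+ 2.
    by field; rewrite !gt_eqF.
  by rewrite subr_ge0.
apply: le_trans (wl2_le_comb ba bb bc px py main) _.
apply: (@le_trans _ _ ((x + y) / x * x ^+ 2 + (x + y) / y * y ^+ 2)).
  by apply: lerD; rewrite ler_wpM2l.
by rewrite le_eqVlt; apply/orP; left; apply/eqP; field; rewrite !gt_eqF.
Qed.

(** Fatou's lemma for series: a partial sum involves finitely many coordinates, so it passes to the
    limit. *)
Lemma wl2_closed (a : nat -> nat -> R) (b : nat -> R) (c : R) :
  (forall j, bounded_seq (a j)) -> bounded_seq b ->
  (forall k, a j k @[j --> \oo] --> b k) ->
  (\forall j \near \oo, wl2 (a j) <= c) -> wl2 b <= c.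
Proof.
move=> ba bb ab ac; apply: wl2_le => // m.
have : series (wl2_term (a j)) m @[j --> \oo] --> series (wl2_term b) m.
  rewrite /series/=; elim: m => [|m IH].
    by rewrite big_geq//; under eq_fun do rewrite big_geq//; exact: cvg_cst.
  rewrite big_nat_recr//=; under eq_fun do rewrite big_nat_recr//=.
  apply: cvgD => //; apply: cvgM; first exact: cvg_cst.
  rewrite expr2; under eq_fun do rewrite expr2.
  by apply: cvgM; apply: cvg_norm.
move=> sab; apply: (cvgr_to_le sab); apply: filterS ac => j.
exact/le_trans/wl2_partial_le.
Qed.

End weighted_l2.

(** * The transport energy as a convex energy *)

Section transport_convex_energy.
Context {R : realType} {n : nat} (f : 'rV[R]_n -> R) (Omega : set 'rV[R]_n)
  (phi : nat -> 'rV[R]_n -> R).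
Hypothesis Omega_bounded : bounded_set Omega.
Hypothesis phi_dense : dense_in_unit_sphere (closure Omega) phi.
Local Notation K := (closure Omega).
Local Notation CK g := {within K, continuous g}.
Local Notation leb := (@lebesgue_rV R n).
Local Notation E := (@transport_energy R n f Omega).
Local Notation d := (@d_w R n Omega phi).
Local Notation Int mu g := (\int[Mplus_measure mu]_(x in K) g x).
Local Notation mass mu := (\int[Mplus_measure mu]_(x in K) 1).

Lemma closure_compact : compact K.
Proof.
apply: bounded_closed_compact; last exact: closed_closure.
have [M [Mreal OM]] := Omega_bounded.
exists M; split => // r Mr x Kx.
have cl : closed [set y : 'rV[R]_n | `|y| <= r].
  by apply: closed_comp (@closed_le R r) => y _; exact: norm_continuous.
rewrite closure_id in cl; have : [set y : 'rV[R]_n | `|y| <= r] x; last by [].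
by rewrite cl; apply: closure_subset Kx => y; exact: OM.
Qed.

Let K_compact := closure_compact.

Let ik (mu : Mplus Omega) (g : 'rV[R]_n -> R) : CK g ->
  (Mplus_measure mu).-integrable K (EFin \o g).
Proof. by move=> cg; exact: (within_integrable K_compact). Qed.

Let mK : measurable K. Proof. exact: (compact_measurable_rV K_compact). Qed.

Let c1 : CK (fun=> 1 : R). Proof. exact: within_cst. Qed.

Lemma IntD (mu : Mplus Omega) (g h : 'rV[R]_n -> R) : CK g -> CK h ->
  Int mu (fun x => g x + h x) = Int mu g + Int mu h.
Proof. by move=> cg ch; exact: (RintegralD mK (ik _ cg) (ik _ ch)). Qed.

Lemma IntB (mu : Mplus Omega) (g h : 'rV[R]_n -> R) : CK g -> CK h ->
  Int mu (fun x => g x - h x) = Int mu g - Int mu h.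
Proof. by move=> cg ch; exact: (RintegralB mK (ik _ cg) (ik _ ch)). Qed.

Lemma IntZ (mu : Mplus Omega) (a : R) (g : 'rV[R]_n -> R) : CK g ->
  Int mu (fun x => a * g x) = a * Int mu g.
Proof. by move=> cg; exact: (RintegralZl _ mK (ik _ cg)). Qed.

Lemma mass_ge0 (mu : Mplus Omega) : 0 <= mass mu.
Proof. exact: Rintegral_ge0. Qed.

Lemma Int_le (mu : Mplus Omega) (g : 'rV[R]_n -> R) (B : R) : CK g ->
  (forall x, K x -> `|g x| <= B) -> `|Int mu g| <= B * mass mu.
Proof.
move=> cg gB; apply: le_trans (le_normr_Rintegral mK (ik mu cg)) _.
rewrite -IntZ//; apply: le_Rintegral => //.
- exact: (ik _ (within_norm cg)).
- by apply: ik; exact: within_cst.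
- by move=> x Kx; rewrite mulr1 gB.
Qed.

Lemma phi_within k : CK (phi k). Proof. by have [/(_ k)[]] := phi_dense. Qed.

Lemma within_le_sup (g : 'rV[R]_n -> R) x : CK g -> K x ->
  `|g x| <= sup [set `|g y| | y in K].
Proof.
move=> cg Kx; have [M [_ gM]] := within_bounded K_compact cg.
by apply: ub_le_sup; [exists M => _ [y Ky <-]; exact: gM|exists x].
Qed.

Lemma phi_le1 k x : K x -> `|phi k x| <= 1.
Proof.
by have [/(_ k)[ck <-] _] := phi_dense; exact: within_le_sup.
Qed.

Definition coord_diff (mu nu : Mplus Omega) (k : nat) : R :=
  Int mu (phi k) - Int nu (phi k).

Lemma coord_diff_bounded mu nu : bounded_seq (coord_diff mu nu).
Proof.
exists (1 * mass mu + 1 * mass nu) => k; apply: le_trans (ler_normB _ _) _.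
by apply: lerD; (apply: Int_le; [exact: phi_within|move=> x; exact: phi_le1]).
Qed.

Lemma d_wE mu nu : d mu nu = Num.sqrt (wl2 (coord_diff mu nu)).
Proof. by []. Qed.

Lemma d_w_sqr mu nu : d mu nu ^+ 2 = wl2 (coord_diff mu nu).
Proof. by rewrite d_wE sqr_sqrtr// wl2_ge0//; exact: coord_diff_bounded. Qed.

Lemma coord_diff_le mu nu k : `|coord_diff mu nu k| <= 2 ^+ k * d mu nu.
Proof.
have p0 : 0 < (2 : R) ^+ k by rewrite exprn_gt0.
rewrite -(ler_pXn2r (ltn0Sn 1)) ?nnegrE ?mulr_ge0 ?sqrtr_ge0 ?(ltW p0)//.
have := wl2_term_le k (coord_diff_bounded mu nu); rewrite -d_w_sqr /wl2_term.
rewrite mulrC ler_pdivrMr// => /le_trans; apply.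
rewrite exprMn mulrC ler_wpM2r ?sqr_ge0// expr2 ler_peMl ?(ltW p0)//.
by apply: exprn_ege1; rewrite ler1n.
Qed.

(** Divided by its sup norm [s], [g] lies on the unit sphere, where [phi] is dense; if [s] is 0, the
    multiple 0 of [phi 0] will do. *)
Lemma dense_approx (g : 'rV[R]_n -> R) (e : R) : CK g -> 0 < e ->
  exists k s, 0 <= s /\ forall x, K x -> `|g x - s * phi k x| <= e.
Proof.
move=> cg e0; pose s := sup [set `|g y| | y in K].
have gs x : K x -> `|g x| <= s by exact: within_le_sup.
have [s0|s0] := leP s 0.
  exists 0%N, 0; split => // x Kx; rewrite mul0r subr0.
  by rewrite (le_trans (gs x Kx))// (le_trans s0)// ltW.
have cgs : CK (fun x => s^-1 * g x) by apply: withinM => //; exact: within_cst.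
have sphere : uniform_unit_sphere K (fun x => s^-1 * g x).
  split => //; rewrite -(@mulVf _ s) ?gt_eqF//.
  have [x0 Kx0] : K !=set0.
    apply: contrapT => /set0P/negP; rewrite negbK => /eqP K0.
    by move: s0; rewrite /s K0 image_set0 sup0 ltxx.
  apply/eqP; rewrite eq_le; apply/andP; split.
    apply: ge_sup; first by exists `|s^-1 * g x0|; exists x0.
    move=> _ [x Kx <-]; rewrite normrM ger0_norm ?invr_ge0 ?(ltW s0)//.
    by rewrite ler_wpM2l ?invr_ge0 ?(ltW s0)// gs.
  rewrite ler_pdivrMl//.
  apply: ge_sup; first by exists `|g x0|; exists x0.
  move=> _ [x Kx <-]; rewrite -ler_pdivrMl//.
  have := within_le_sup cgs Kx.
  by rewrite normrM [X in X * _]ger0_norm ?invr_ge0 ?(ltW s0).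
have es : 0 < e / s by rewrite divr_gt0.
have [k kP] := phi_dense.2 _ sphere _ es.
exists k, s; split=> [|x Kx]; first exact: ltW.
have -> : g x - s * phi k x = - (s * (phi k x - s^-1 * g x)).
  by rewrite mulrBr mulVKf ?gt_eqF// opprB.
rewrite normrN normrM gtr0_norm// -ler_pdivlMl//.
by apply: le_trans (ltW (kP x Kx)) _; rewrite mulrC.
Qed.

(** The modulus is uniform over masses at most [c], so that it serves Cauchy sequences as well as
    convergent ones. The mass controls the error of replacing [g] by [s * phi k], at most [e / 4]
    for each measure, and the [k]-th term of [d] controls the rest. *)
Lemma weak_modulus (g : 'rV[R]_n -> R) (c e : R) : CK g -> 0 <= c -> 0 < e ->
  exists2 r : R, 0 < r & forall mu nu : Mplus Omega,
    mass mu <= c -> mass nu <= c -> d mu nu <= r -> `|Int mu g - Int nu g| <= e.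
Proof.
move=> cg c0 e0.
have e1 : 0 < e / (4 * (c + 1)) by rewrite divr_gt0// mulr_gt0// ltr_wpDl.
have [k [s [s0 gs]]] := dense_approx cg e1.
have p0 : 0 < (2 : R) ^+ k by rewrite exprn_gt0.
have q0 : 0 < 2 * ((s + 1) * 2 ^+ k) by rewrite !mulr_gt0// ltr_wpDl.
exists (e / (2 * ((s + 1) * 2 ^+ k))); first exact: divr_gt0.
move=> mu nu muc nuc dr.
have csp : CK (fun x => s * phi k x).
  by apply: withinM; [exact: within_cst|exact: phi_within].
have cgsp : CK (fun x => g x - s * phi k x) by exact: withinB.
have gE (m : Mplus Omega) : Int m g =
    Int m (fun x => g x - s * phi k x) + s * Int m (phi k).
  by rewrite IntB// IntZ ?subrK//; exact: phi_within.
have le4 (m : Mplus Omega) : mass m <= c ->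
    `|Int m (fun x => g x - s * phi k x)| <= e / 4.
  move=> mc; apply: le_trans (Int_le m cgsp gs) _.
  apply: (@le_trans _ _ (e / (4 * (c + 1)) * (c + 1))).
    by rewrite ler_wpM2l ?(ltW e1)// (le_trans mc)// lerDl.
  rewrite le_eqVlt; apply/orP; left; apply/eqP; field.
  by rewrite gt_eqF// ltr_wpDl.
have h1 := le4 _ muc; have h2 := le4 _ nuc.
have h3 : `|s * (Int mu (phi k) - Int nu (phi k))| <= e / 2.
  rewrite normrM ger0_norm//.
  apply: (@le_trans _ _ ((s + 1) * (2 ^+ k * d mu nu))).
    apply: ler_pM => //; [by rewrite lerDl|exact: coord_diff_le].
  rewrite mulrA -ler_pdivlMl ?mulr_gt0 ?ltr_wpDl//.
  apply: le_trans dr _; rewrite le_eqVlt; apply/orP; left; apply/eqP; field.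
  by rewrite !gt_eqF// ltr_wpDl.
rewrite !gE; move: h1 h2 h3.
rewrite mulrBr !ler_norml => /andP[a1 a2] /andP[b1 b2] /andP[u1 u2].
by apply/andP; split; lra.
Qed.

Lemma weak_cvg (mu : nat -> Mplus Omega) (nu : Mplus Omega) (c : R) g :
  (forall j, mass (mu j) <= c) -> d (mu j) nu @[j --> \oo] --> (0 : R) ->
  CK g -> Int (mu j) g @[j --> \oo] --> Int nu g.
Proof.
move=> muc munu cg; apply/cvgrPdist_le => e e0.
pose c' := Num.max c (mass nu).
have c'0 : 0 <= c' by rewrite le_max mass_ge0 orbT.
have [r r0 rP] := weak_modulus cg c'0 e0.
move/cvgrPdist_le/(_ _ r0) : munu; apply: filterS => j.
rewrite sub0r normrN ger0_norm ?sqrtr_ge0// => jr.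
rewrite distrC; apply: (rP _ _ _ _ jr); first by rewrite le_max muc.
by rewrite le_max lexx orbT.
Qed.

Definition admissible (u : 'rV[R]_n -> R) (Du : 'rV[R]_n -> 'rV[R]_n) : Prop :=
  C1_closure Omega u Du /\ (\int[leb]_(x in Omega) (u x)%:E = 0)%E.

Lemma within_sqr_euclid (Du : 'rV[R]_n -> 'rV[R]_n) : CK Du ->
  CK (fun x => sqr_euclid (Du x)).
Proof.
move=> cD; have cDi (i : 'I_n) : CK (fun x => Du x 0 i ^+ 2).
  have ci : CK (fun x => Du x 0 i).
    move=> x; have := @continuous_comp (subspace K) 'rV[R]_n R Du (fun v => v 0 i) x (cD x).
    by apply; exact: coord_continuous.
  by under eq_fun do rewrite expr2; exact: withinM.
rewrite (_ : (fun _ => _) = \sum_(i < n) (fun x => Du x 0 i ^+ 2)); last first.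
  by apply/funext => x; rewrite /sqr_euclid fct_sumE.
elim/big_ind : _ => //; first exact: within_cst.
by move=> g h; exact: withinD.
Qed.

(** A sublevel is cut out by inequalities whose left side is independent of [mu] and whose right
    side is affine in [mu], and continuous for [d_w] at bounded mass. Convexity and lower
    semicontinuity are read off from them. *)
Lemma transport_energy_leP (mu : Mplus Omega) (c : R) :
  (E mu <= c%:E)%E <-> forall u Du, admissible u Du ->
  (2%:E * \int[leb]_(x in Omega) (f x * u x)%:E <=
    (c + Int mu (fun x => sqr_euclid (Du x)) - mass mu)%:E)%E.
Proof.
have massE : (\int[mu]_(x in K) 1 = (mass mu)%:E)%E.
  by rewrite /Rintegral fineK// integrable_fin_num//; exact: (ik mu c1).
have IE u Du : admissible u Du ->
    (\int[mu]_(x in K) (sqr_euclid (Du x))%:E =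
     (Int mu (fun x => sqr_euclid (Du x)))%:E)%E.
  move=> [[_ cD _] _]; rewrite /Rintegral fineK// integrable_fin_num//.
  exact: (ik mu (within_sqr_euclid cD)).
rewrite /transport_energy massE -leeBrDr// -EFinB; split=> [Ec u Du uDu|Ec].
  have : (2%:E * \int[leb]_(x in Omega) (f x * u x)%:E -
      \int[mu]_(x in K) (sqr_euclid (Du x))%:E <= (c - mass mu)%:E)%E.
    apply: le_trans Ec; apply: ereal_sup_ubound; exists u, Du.
    by case: uDu => uDu u0; split.
  rewrite (IE _ _ uDu) leeBlDr// -EFinD => /le_trans; apply.
  by rewrite lee_fin addrAC.
apply: ge_ereal_sup => _ [u [Du [uDu u0 ->]]].
have ad : admissible u Du by split.
rewrite (IE _ _ ad) leeBlDr// -EFinD; apply: le_trans (Ec _ _ ad) _.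
by rewrite lee_fin addrAC.
Qed.

Lemma admissible0 : admissible (fun=> 0) (fun=> 0).
Proof.
split; last by rewrite integral0.
split.
- exact: within_cst.
- by move=> x; exact: cvg_cst.
- by move=> x _ i; rewrite mxE; exact: is_derive_cst.
Qed.

(** Testing with [u = 0]. Sublevels thus have bounded mass, the condition under which [d_w] controls
    integrals. *)
Lemma mass_le_energy (mu : Mplus Omega) (c : R) : (E mu <= c%:E)%E -> mass mu <= c.
Proof.
move=> /transport_energy_leP/(_ _ _ admissible0).
have -> : (fun x : 'rV[R]_n => (f x * 0)%:E) = cst 0%E.
  by apply/funext => x; rewrite mulr0.
rewrite integral0 mule0 lee_fin.
have -> : (fun x : 'rV[R]_n => sqr_euclid (0 : 'rV[R]_n)) = fun=> 0 * 1.
  apply/funext => x; rewrite mul0r /sqr_euclid big1// => i _.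
  by rewrite mxE expr0n.
by rewrite IntZ// mul0r addr0 subr_ge0.
Qed.

Lemma transport_energy_ge0 (mu : Mplus Omega) : (0 <= E mu)%E.
Proof.
rewrite leNgt; apply/negP => E0.
have [c c0 Ec] : exists2 c : R, c < 0 & (E mu <= c%:E)%E.
  move: E0; case: (E mu) => [r| |] //=.
    by rewrite lte_fin => r0; exists r.
  by move=> _; exists (-1); rewrite ?ltrN10// leNye.
by have := mass_le_energy Ec; rewrite leNgt (lt_le_trans c0)// mass_ge0.
Qed.

Lemma ereal_le_comb (z : \bar R) (p q th : R) : 0 <= th <= 1 ->
  (z <= p%:E)%E -> (z <= q%:E)%E -> (z <= ((1 - th) * p + th * q)%:E)%E.
Proof.
move=> /andP[th0 th1]; case: z => [r| |]; rewrite ?leNye// !lee_fin => rp rq.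
have := ler_wpM2l th0 rq; have := ler_wpM2l (_ : 0 <= 1 - th) rp.
by rewrite subr_ge0 => /(_ th1); lra.
Qed.

Lemma d_w_triangle (mu nu eta : Mplus Omega) : d mu eta <= d mu nu + d nu eta.
Proof.
apply: wl2_triangle; try exact: coord_diff_bounded.
move=> k; rewrite /coord_diff -[X in `|X|](subrKA (Int nu (phi k))).
exact: ler_normD.
Qed.

(** The convex combination is formed on functionals and represented by Riesz's theorem: distance and
    energy depend on integrals of continuous functions. *)
Lemma transport_interp (mu nu : Mplus Omega) (th : R) : 0 <= th <= 1 ->
  exists eta : Mplus Omega, forall g : 'rV[R]_n -> R, CK g ->
    Int eta g = (1 - th) * Int mu g + th * Int nu g.
Proof.
move=> th01; pose L g := (1 - th) * Int mu g + th * Int nu g.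
have [||| m [m0 mL]] := @riesz_compact R n K K_compact L.
- by move=> g h cg ch; rewrite /L (IntD mu cg ch) (IntD nu cg ch); ring.
- by move=> a g cg; rewrite /L (IntZ mu a cg) (IntZ nu a cg); ring.
- case/andP : th01 => th0 th1 g cg g0; rewrite /L.
  by apply: addr_ge0; apply: mulr_ge0; rewrite ?subr_ge0//; exact: Rintegral_ge0.
by exists (MkMplus m0).
Qed.

(** Bounded mass makes the integrals of each continuous function a Cauchy sequence; their limits
    form a positive functional, represented by a measure. Convergence for [d] follows by letting [j]
    tend to infinity in [d (mu i) (mu j) < e]. *)
Lemma transport_complete (mu : nat -> Mplus Omega) (c : R) :
  (forall j, (E (mu j) <= c%:E)%E) ->
  (forall e : R, 0 < e -> exists N, forall i j,
      (N <= i)%N -> (N <= j)%N -> d (mu i) (mu j) < e) ->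
  exists nu, d (mu j) nu @[j --> \oo] --> (0 : R).
Proof.
move=> muc mu_cauchy.
have massc j : mass (mu j) <= c by exact: mass_le_energy.
have c0 : 0 <= c by exact: le_trans (mass_ge0 _) (massc 0%N).
have cvgI (g : 'rV[R]_n -> R) : CK g -> cvgn (fun j => Int (mu j) g).
  move=> cg; apply/cauchy_cvgP/cauchy_exP => e e0.
  have e2 : 0 < e / 2 by rewrite divr_gt0.
  have [r r0 rP] := weak_modulus cg c0 e2.
  have [N Nr] := mu_cauchy r r0.
  exists (Int (mu N) g); exists N => // j /= Nj.
  rewrite /ball/=; apply: le_lt_trans (rP _ _ _ _ _) _ => //.
    by apply/ltW/Nr.
  by rewrite ltr_pdivrMr// ltr_pMr// ltr1n.
pose L (g : 'rV[R]_n -> R) := limn (fun j => Int (mu j) g).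
have [||| m [m0 mL]] := @riesz_compact R n K K_compact L.
- move=> g h cg ch; rewrite /L; under eq_fun do rewrite IntD//.
  by rewrite limD//; exact: cvgI.
- move=> a g cg; rewrite /L; under eq_fun do rewrite IntZ//.
  by apply/cvg_lim => //; apply: cvgM; [exact: cvg_cst|exact: cvgI].
- move=> g cg g0; apply: limr_ge; first exact: cvgI.
  by apply: nearW => j; exact: Rintegral_ge0.
exists (MkMplus m0); apply/cvgrPdist_le => e e0.
have [N Ne] := mu_cauchy e e0; exists N => // i /= Ni.
rewrite sub0r normrN ger0_norm ?sqrtr_ge0//.
rewrite -(ler_pXn2r (ltn0Sn 1)) ?nnegrE ?sqrtr_ge0 ?(ltW e0)// d_w_sqr.
apply: (wl2_closed (a := fun j => coord_diff (mu i) (mu j))).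
- by move=> j; exact: coord_diff_bounded.
- exact: coord_diff_bounded.
- move=> k; apply: cvgB; first exact: cvg_cst.
  rewrite [X in _ --> X](mL _ (@phi_within k)).
  exact: (cvgI _ (@phi_within k)).
exists N => // j /= Nj; rewrite -d_w_sqr.
by rewrite lerXn2r ?nnegrE ?sqrtr_ge0 ?(ltW e0)// ltW// Ne.
Qed.

Lemma transport_convex_energy : (exists mu, (E mu < +oo)%E) -> convex_energy E d.
Proof.
move=> Edom; split => //.
- by move=> mu nu; exact: sqrtr_ge0.
- move=> mu; rewrite d_wE (_ : coord_diff mu mu = fun=> 0); last first.
    by apply/funext => k; rewrite /coord_diff subrr.
  apply/eqP; rewrite sqrtr_eq0; apply: wl2_le.
    by exists 0 => k; rewrite normr0.
  move=> m; rewrite /series/= big1// => k _.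
  by rewrite /wl2_term normr0 expr0n mulr0.
- move=> mu nu; rewrite !d_wE; congr (Num.sqrt (limn (series _))).
  by apply/funext => k; rewrite /wl2_term /coord_diff distrC.
- exact: d_w_triangle.
- exact: transport_energy_ge0.
- move=> mu nu th th01; have [eta etaE] := transport_interp mu nu th01.
  exists eta; split=> [w|a b /transport_energy_leP muc /transport_energy_leP nuc].
    (* The coordinates of [eta] are convex combinations, so the quadratic identity holds in each
       coordinate and is summed. *)
    rewrite !d_w_sqr; apply: wl2_comb; try exact: coord_diff_bounded.
    move=> k; rewrite /coord_diff etaE; last exact: phi_within.
    by rewrite -!normrX !ger0_norm ?sqr_ge0//; ring.
  apply/transport_energy_leP => u Du uDu.
  have cD : CK (fun x => sqr_euclid (Du x)).
    by apply: within_sqr_euclid; case: uDu => -[].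
  rewrite !etaE//.
  apply: le_trans (ereal_le_comb th01 (muc _ _ uDu) (nuc _ _ uDu)) _.
  by rewrite lee_fin; lra.
- move=> mu nu c muc munu; apply/transport_energy_leP => u Du uDu.
  have massc j : mass (mu j) <= c by exact: mass_le_energy.
  have cD : CK (fun x => sqr_euclid (Du x)).
    by apply: within_sqr_euclid; case: uDu => -[].
  have lim : c + Int (mu j) (fun x => sqr_euclid (Du x)) - mass (mu j) @[j --> \oo] -->
      c + Int nu (fun x => sqr_euclid (Du x)) - mass nu.
    apply: cvgB; last exact: weak_cvg massc munu c1.
    by apply: cvgD; [exact: cvg_cst|exact: weak_cvg massc munu cD].
  have bound j := (transport_energy_leP (mu j) c).1 (muc j) u Du uDu.
  move: bound; case: (2%:E * _)%E => [r| |] bound; rewrite ?leNye//; last by have := bound 0%N.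
  rewrite lee_fin; apply: (cvgr_to_ge lim); apply: nearW => j.
  by rewrite -lee_fin.
- exact: transport_complete.
Qed.

End transport_convex_energy.

Theorem theorem3p1 (R : realType) (n : nat) (f : 'rV[R]_n -> R)
    (Omega : set 'rV[R]_n) (phi : nat -> 'rV[R]_n -> R)
    (f_Linfty : f \in Lfun (@lebesgue_rV R n) +oo%E)
    (f_compact_support : compact (ess_support f))
    (f_mean0 : (\int[@lebesgue_rV R n]_x (f x)%:E = 0)%E)
    (Omega_open : open Omega) (Omega_nonempty : Omega !=set0)
    (Omega_convex : convex_set Omega) (Omega_bounded : bounded_set Omega)
    (Omega_conv_supp : conv_hull (ess_support f) `<=` Omega)
    (phi_dense : dense_in_unit_sphere (closure Omega) phi) :
  let E := @transport_energy R n f Omega in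
  let d := @d_w R n Omega phi in
  forall c : R, (ereal_inf (range E) < c%:E)%E ->
  forall mu0 : Mplus Omega, (E mu0 <= c%:E)%E ->
  [/\ minimizing_movements E d mu0 !=set0,
      strong_upper_gradient E d (slope E d) &
      forall mu : R -> Mplus Omega, minimizing_movements E d mu0 mu ->
        curve_of_maximal_slope E d (slope E d) 0%E +oo%E mu /\
        forall t : R, 0 < t ->
          (E (mu t) = E mu0
            - \int[@lebesgue_measure R]_(s in `]0%R, t[) (slope E d (mu s)) ^+ 2)%E].
Proof.
move=> E d c _ mu0 mu0c.
have mu0_dom : (E mu0 < +oo)%E by apply: le_lt_trans mu0c _; rewrite ltry.
have H : convex_energy E d.
  by apply: transport_convex_energy => //; exists mu0.
split=> [||mu mu_mm].
- exact: minimizing_movements_nonempty.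
- exact: slope_strong_upper_gradient.
have E0 := minimizing_movement_start H mu_mm.
have mu_dom : (E (mu 0%R) < +oo)%E by rewrite E0.
have evi := minimizing_movement_evi H mu0_dom mu_mm.
have slp (t C : R) : 0 < t -> 0 <= C -> fine (E (mu 0)) <= t * C ^+ 2 ->
    slope_bound E d (mu t) C.
  by rewrite E0; exact: (minimizing_movement_slope H mu0_dom mu_mm).
split; first exact: (flow_curve_of_maximal_slope H mu_dom evi slp).
by move=> t t0; rewrite -E0; exact: (flow_energy_identity H mu_dom evi slp).
Qed.
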